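(* Let $E=A\#_fH$ be a crossed product, and let $\phi_*:(X_*,d_* )\to(B_*(E),b'_* )$ and $\psi_*:(B_*(E),b'_* )\to(X_*,d_* )$ be the morphisms of complexes of $E$-bimodules recursively defined in the context. Then $\psi_*\circ\phi_*=\mathrm{id}_*$, and $\phi_*\circ\psi_*$ is homotopically equivalent to the identity map. A homotopy $\omega_{*+1}$ from $\phi_*\circ\psi_*$ to $\mathrm{id}_*$ (that is, $b'_{n+1}\omega_{n+1}+\omega_nb'_n=\phi_n\psi_n-\mathrm{id}$) is given by the $E$-bimodule maps $\omega_{n+1}:B_n(E)\to B_{n+1}(E)$ recursively defined by $\omega_1=0$ and $$\omega_{n+1}(\mathbf x)=\xi_{n+1}\circ(\phi_n\circ\psi_n-\mathrm{id}-\omega_n\circ b'_n)(\mathbf x)\qquad\text{for }\mathbf x\in E\otimes\overline E^n\otimes k .$$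
   Context: $k$ is a commutative ring with unit, $\otimes=\otimes_k$, $H$ is a Hopf algebra with counit $\epsilon$ and Sweedler notation $\Delta(h)=h^{(1)}\otimes h^{(2)}$ (sum understood), $A$ is a $k$-algebra. A weak action of $H$ on $A$ is a bilinear map $(h,a)\mapsto a^h$, $H\times A\to A$, with $(ab)^h=a^{h^{(1)}}b^{h^{(2)}}$, $1^h=\epsilon(h)1$, $a^1=a$. Given a weak action and a $k$-linear map $f:H\otimes H\to A$, $A\#_fH$ is $A\otimes H$ (elements written $a\#h$) with product $(a\#h)(b\#l)=ab^{h^{(1)}}f(h^{(2)},l^{(1)})\#h^{(3)}l^{(2)}$; it is called a crossed product if it is associative with unit $1\#1$, equivalently: $f(h,1)=f(1,h)=\epsilon(h)1_A$; $f(l^{(1)},m^{(1)})^{h^{(1)}}f(h^{(2)},l^{(2)}m^{(2)})=f(h^{(1)},l^{(1)})f(h^{(2)}l^{(2)},m)$; and $(a^{l^{(1)}})^{h^{(1)}}f(h^{(2)},l^{(2)})=f(h^{(1)},l^{(1)})a^{h^{(2)}l^{(2)}}$ for all $h,l,m\in H$, $a\in A$. Notation: $\overline B=B/k$ for a $k$-algebra $B$ (classes denoted by the same letter), $\overline B^l=\overline B\otimes\cdots\otimes\overline B$ ($l$ times). $\mathbf h_{ij}=h_i\otimes\cdots\otimes h_j$, $\mathbf a_{ij}=a_i\otimes\cdots\otimes a_j$. For $\mathbf h=h_i\otimes\cdots\otimes h_j$, $\mathbf h^{(1)}\otimes\mathbf h^{(2)}=(h_i^{(1)}\otimes\cdots\otimes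 h_j^{(1)})\otimes(h_i^{(2)}\otimes\cdots\otimes h_j^{(2)})$, and $a^{\overline{\mathbf h}}=(\cdots((a^{h_j})^{h_{j-1}})\cdots)^{h_i}$ for $a\in A$. ''$\otimes k$'' at the end of a tensor product denotes the elements whose last factor is a multiple of $1_E$. The complex $(X_*,d_* )$. $X_{rs}=E\otimes\overline H^s\otimes\overline A^r\otimes E$ ($r,s\ge0$), an $E$-bimodule by multiplication on the outer factors. Elements are written $a_0\otimes\mathbf h_{0s}\otimes\mathbf a\otimes h_{s+1}$ with $\mathbf a=a_1\otimes\cdots\otimes a_{r+1}$, where the left factor $E$ contains $a_0\#h_0$ and the right factor $E$ contains $a_{r+1}\#h_{s+1}$. $Y_s=E\otimes\overline H^s\otimes H$, with elements $a_0\otimes\mathbf h$, $\mathbf h=h_0\otimes\cdots\otimes h_{s+1}$; left action canonical, right action $(a_0\otimes\mathbf h)(a\#h)=a_0a^{\overline{\mathbf h^{(1)}}}f(h_{s+1}^{(2)},h^{(1)})^{\overline{\mathbf h_{0s}^{(2)}}}\otimes(\mathbf h_{0s}^{(3)}\otimes h_{s+1}^{(3)}h^{(2)})$. Bimodule maps $\mu_s:X_{0s}\to Y_s$, $d^0_{rs}:X_{rs}\to X_{r-1,s}$, $\partial_s:Y_s\to Y_{s-1}$: $\mu_s(a_0\otimes\mathbf h_{0s}\otimes a_1\otimes h_{s+1})=a_0a_1^{\overline{\mathbf h_{0s}^{(1)}}}\otimes\mathbf h_{0s}^{(2)}\otimes h_{s+1}$; $d^0_{rs}(a_0\otimes\mathbf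 h_{0s}\otimes\mathbf a\otimes h_{s+1})=a_0a_1^{\overline{\mathbf h_{0s}^{(1)}}}\otimes\mathbf h_{0s}^{(2)}\otimes\mathbf a_{2,r+1}\otimes h_{s+1}+\sum_{i=1}^r(-1)^ia_0\otimes\mathbf h_{0s}\otimes\mathbf a_{1,i-1}\otimes a_ia_{i+1}\otimes\mathbf a_{i+2,r+1}\otimes h_{s+1}$; $\partial_s(a\otimes\mathbf h)=\sum_{i=0}^s(-1)^{i+1}af(h_i^{(1)},h_{i+1}^{(1)})^{\overline{\mathbf h_{0,i-1}^{(1)}}}\otimes\mathbf h_{0,i-1}^{(2)}\otimes h_i^{(2)}h_{i+1}^{(2)}\otimes\mathbf h_{i+2,s+1}$. Left $E$-module maps $\sigma^0_{0s}:Y_s\to X_{0s}$, $\sigma^0_{r+1,s}:X_{rs}\to X_{r+1,s}$ ($r\ge0$): $\sigma^0_{r+1,s}(a_0\otimes\mathbf h_{0s}\otimes\mathbf a\otimes h_{s+1})=(-1)^{r+1}a_0\otimes\mathbf h_{0s}\otimes\mathbf a\otimes1\#h_{s+1}$ for $r\ge-1$ (no $\mathbf a$ if $r=-1$). Bimodule maps $d^l_{rs}:X_{rs}\to X_{r+l-1,s-l}$ ($r\ge0$, $1\le l\le s$), recursively, on $\mathbf x\in k\otimes\overline H^s\otimes\overline A^r\otimes k$: $d^1_{0s}(\mathbf x)=-\sigma^0_{0,s-1}\partial_s\mu_s(\mathbf x)$; $d^l_{0s}(\mathbf x)=-\sum_{j=1}^{l-1}\sigma^0_{l-1,s-l}d^{l-j}_{j-1,s-j}d^j_{0s}(\mathbf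 x)$ for $1<l\le s$; $d^l_{rs}(\mathbf x)=-\sum_{j=0}^{l-1}\sigma^0_{r+l-1,s-l}d^{l-j}_{r+j-1,s-j}d^j_{rs}(\mathbf x)$ for $r>0$. $X_n=\bigoplus_{r+s=n}X_{rs}$, $d_n=\sum_{r+s=n}\sum_{0\le l\le s,\,r+l>0}d^l_{rs}$. The contracting homotopy $\overline\sigma_*$ of the augmented complex. $\sigma^{-1}_0:E\to Y_0$, $\sigma^{-1}_{s+1}:Y_s\to Y_{s+1}$ are $\sigma^{-1}_{s+1}(x)=(-1)^sx\otimes1_H$ ($s\ge-1$). Writing $\sigma^l_{l,s-l}:Y_s\to X_{l,s-l}$ (case $r=-1$) and $\sigma^l_{r+l+1,s-l}:X_{rs}\to X_{r+l+1,s-l}$ ($r\ge0$), put $\sigma^l_{r+l+1,s-l}=-\sum_{i=0}^{l-1}\sigma^0_{r+l+1,s-l}\,d^{l-i}_{r+i+1,s-i}\,\sigma^i_{r+i+1,s-i}$ for $0<l\le s$, $r\ge-1$. Then $\overline\sigma_0=\sigma^0_{00}\sigma^{-1}_0:E\to X_0$ and $\overline\sigma_{n+1}=-\sum_{l=0}^{n+1}\sigma^l_{l,n-l+1}\,\sigma^{-1}_{n+1}\,\mu_n+\sum_{r+s=n,\ r\ge 0}\sum_{l=0}^s\sigma^l_{r+l+1,s-l}:X_n\to X_{n+1}$ ($n\ge0$; $\mu_n$ is extended by $0$ on $X_{r,n-r}$, $r>0$). The Hochschild resolution. $B_n(E)=E\otimes\overline E^n\otimes E$, $b'_n(x_0\otimes\cdots\otimes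 x_{n+1})=\sum_{i=0}^n(-1)^ix_0\otimes\cdots\otimes x_ix_{i+1}\otimes\cdots\otimes x_{n+1}$, with left $E$-linear contracting homotopy $\xi_n(\mathbf x)=(-1)^n\mathbf x\otimes1$, $\xi_n:B_{n-1}(E)\to B_n(E)$. The $E$-bimodule maps $\phi_n:X_n\to B_n(E)$ and $\psi_n:B_n(E)\to X_n$ are defined by $\phi_0=\mathrm{id}$, $\psi_0=\mathrm{id}$ (note $X_0=E\otimes E=B_0(E)$), $\phi_{n+1}(\mathbf x\otimes1)=\xi_{n+1}\phi_nd_{n+1}(\mathbf x\otimes1)$ and $\psi_{n+1}(\mathbf y\otimes1)=\overline\sigma_{n+1}\psi_nb'_{n+1}(\mathbf y\otimes1)$, for $\mathbf x\in E\otimes\overline H^s\otimes\overline A^r$ with $r+s=n+1$ and $\mathbf y\in E\otimes\overline E^{n+1}$. *)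

(* Defs.v *)
From HB Require Import structures.
From mathcomp Require Import all_boot all_order all_algebra.
From mathcomp Require Import generic_quotient ring_quotient boolp.
From mathcomp Require Import freeg.

Set Implicit Arguments.
Unset Strict Implicit.
Unset Printing Implicit Defensive.

Import GRing.Theory.
Local Open Scope ring_scope.

Section LinearQuotient.
Variables (k : comNzRingType) (V : lmodType k) (R : V -> Prop).

Inductive in_lspan : V -> Prop :=
| InLspan0 : in_lspan 0
| InLspanZD c x y : R x -> in_lspan y -> in_lspan (c *: x + y).

Definition lspan : {pred V} := [pred x | `[< in_lspan x >]].

Fact lspan_submod : submod_closed lspan.
Proof.
split=> [|c x y /asboolP sx /asboolP sy]; first by apply/asboolP; left.
apply/asboolP; elim: sx => [|d z t Rz _ IH]; first by rewrite scaler0 add0r.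
by rewrite scalerDr scalerA -addrA; right.
Qed.
HB.instance Definition _ := GRing.isSubmodClosed.Build k V lspan lspan_submod.

Definition lquot : Type := Quotient.quot lspan.
HB.instance Definition _ := GRing.Zmodule.on lquot.

Definition lquot_pi (x : V) : lquot := \pi_(Quotient.quot lspan)%qT x.
Definition lquot_scale (c : k) (x : lquot) : lquot :=
  lquot_pi (c *: repr (x : Quotient.quot lspan)).

Fact lquot_piE x y : (lquot_pi x == lquot_pi y) = (x - y \in lspan).
Proof. by rewrite Quotient.idealrBE. Qed.

Fact lquot_pi_scale c x : lquot_scale c (lquot_pi x) = lquot_pi (c *: x).
Proof.
apply/eqP; rewrite lquot_piE -scalerBr rpredZ //.
by rewrite -lquot_piE /lquot_pi reprK.
Qed.

Fact lquot_piD : {morph lquot_pi : x y / x + y}.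
Proof. by move=> x y; rewrite /lquot_pi [RHS]piE. Qed.

Fact lquot_piW (P : lquot -> Prop) :
  (forall x, P (lquot_pi x)) -> forall y, P y.
Proof. by move=> Ppi y; rewrite -[y](@reprK _ (Quotient.quot lspan)). Qed.

Fact lquot_scaleA a b x :
  lquot_scale a (lquot_scale b x) = lquot_scale (a * b) x.
Proof.
by move: x; apply: lquot_piW => x; rewrite !lquot_pi_scale scalerA.
Qed.
Fact lquot_scale1 : left_id 1 lquot_scale.
Proof. by apply: lquot_piW => x; rewrite lquot_pi_scale scale1r. Qed.
Fact lquot_scaleDr : right_distributive lquot_scale +%R.
Proof.
move=> a; apply: lquot_piW => x; apply: lquot_piW => y.
by rewrite -lquot_piD !lquot_pi_scale scalerDr lquot_piD.
Qed.
Fact lquot_scaleDl x : {morph lquot_scale^~ x : a b / a + b}.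
Proof.
move: x; apply: lquot_piW => x a b.
by rewrite !lquot_pi_scale scalerDl lquot_piD.
Qed.
HB.instance Definition _ := GRing.Zmodule_isLmodule.Build k lquot
  lquot_scaleA lquot_scale1 lquot_scaleDr lquot_scaleDl.
End LinearQuotient.

Section Tensor.
Variable k : comNzRingType.

Definition is_bilinear (U V W : lmodType k) (f : U -> V -> W) :=
  (forall u, linear (f u)) /\ (forall v, linear (f^~ v)).

Section Binary.
Variables M N : lmodType k.

Inductive tensor_rel : {freeg (M * N) / k} -> Prop :=
| TensorL c m m' n :
    tensor_rel (<< (c *: m + m', n) >> - c *: << (m, n) >> - << (m', n) >>)
| TensorR c m n n' :
    tensor_rel (<< (m, c *: n + n') >> - c *: << (m, n) >> - << (m, n') >>).

Definition tensor : lmodType k := lquot tensor_rel.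
Definition tens (m : M) (n : N) : tensor := lquot_pi tensor_rel << (m, n) >>.
End Binary.

Section Expression.
Variables (G : Type) (V : lmodType k) (el : G -> V).

(* A list of generators with sum x, chosen arbitrarily. *)
Definition expr (x : V) : seq G :=
  match pselect (exists l, x = \sum_(g <- l) el g) with
  | left ex_l => sval (cid ex_l)
  | right _ => [::]
  end.

(* When the el g span V additively and F respects the relations between them,
   this is the unique additive map sending each el g to F g. *)
Definition linext (W : lmodType k) (F : G -> W) (x : V) : W :=
  \sum_(g <- expr x) F g.
End Expression.

Section LiftBilinear.
Variables (M N W : lmodType k) (F : M -> N -> W) (bF : is_bilinear F).

Fact lift_rel D :
  in_lspan (@tensor_rel M N) D -> fglift (fun p => F p.1 p.2) D = 0.
Proof.
have [lF rF] := bF; pose G := fglift (fun p => F p.1 p.2).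
have addG : additive G by exact: lift_is_additive.
have G1 m n : G << (m,n) >> = F m n by rewrite /G liftU scale1r.
have GB x y : G (x - y) = G x - G y by exact: addG.
have G0 : G 0 = 0 by rewrite -(subrr 0) GB subrr.
have GD x y : G (x + y) = G x + G y.
  by rewrite -[y in LHS]opprK GB -[- y]sub0r GB G0 sub0r opprK.
have GZ c x : G (c *: x) = c *: G x.
  rewrite -[x]freeg_sumE scaler_sumr.
  elim: (dom x) => [|z s IH]; first by rewrite !big_nil G0 scaler0.
  rewrite !big_cons !GD IH scalerDr; congr (_ + _).
  have -> : c *: << coeff z x *g z >> = << c * coeff z x *g z >>.
    by apply/eqP/freeg_eqP => t; rewrite coeffZ !coeffU mulrA.
  by rewrite /G !liftU scalerA.
elim=> [|c x y Rx _ IH]; first exact: G0.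
rewrite -/G GD GZ [G y]IH addr0.
case: Rx => [c' m m' n|c' m n n']; rewrite !GB !GZ !G1.
  by rewrite rF -addrA -opprD subrr scaler0.
by rewrite lF -addrA -opprD subrr scaler0.
Qed.
Lemma linext_tens m n :
  linext (fun p : M * N => tens p.1 p.2) (fun p => F p.1 p.2) (tens m n)
  = F m n.
Proof.
rewrite /linext /expr; case: pselect => [ex|[]]; last first.
  by exists [:: (m, n)]; rewrite big_seq1.
case: cid => s /= sE; pose G := fglift (fun p => F p.1 p.2).
have piS :
    tens m n = lquot_pi (@tensor_rel M N) (\sum_(p <- s) << (p.1, p.2) >>).
  rewrite sE; elim: s {sE} => [|p s IH].
    rewrite !big_nil; apply/eqP; have := lquot_piD (@tensor_rel M N) 0 0.
    by rewrite addr0 => /esym/eqP; rewrite -subr_eq0 addrK => /eqP ->.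
  by rewrite !big_cons IH lquot_piD.
have /asboolP/lift_rel :
    (<< (m, n) >> - \sum_(p <- s) << (p.1, p.2) >>) \in lspan (@tensor_rel M N).
  by rewrite -lquot_piE -piS.
have addG : additive G by exact: lift_is_additive.
have GB x y : G (x - y) = G x - G y by exact: addG.
have G0 : G 0 = 0 by rewrite -(subrr 0) GB subrr.
have GD x y : G (x + y) = G x + G y.
  by rewrite -[y in LHS]opprK GB -[- y]sub0r GB G0 sub0r opprK.
rewrite -/G GB (big_morph G GD G0) => /eqP; rewrite subr_eq0 => /eqP.
rewrite {1}/G liftU scale1r /= => ->.
by apply: eq_bigr => p _; rewrite /G liftU scale1r.
Qed.
End LiftBilinear.

Definition texpr (M N : lmodType k) : tensor M N -> seq (M * N) :=
  expr (fun p => tens p.1 p.2).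

(* M (x) (M (x) ( ... (M (x) N))), with n factors M. *)
Fixpoint tpow (M N : lmodType k) (n : nat) : lmodType k :=
  if n is n'.+1 then tensor M (tpow M N n') else N.

Fixpoint tpow_el (M N : lmodType k) (n : nat) (ms : seq M) (x : N) :
    tpow M N n :=
  match n with
  | 0 => x
  | n'.+1 => tens (head 0 ms) (tpow_el n' (behead ms) x)
  end.

(* M / k u *)
Definition modline (M : lmodType k) (u : M) : lmodType k :=
  lquot (fun x => x = u).
Definition cls (M : lmodType k) (u : M) : M -> modline u :=
  lquot_pi (fun x => x = u).
End Tensor.

Section DirectSum.
Variables (k : comNzRingType) (n : nat) (M : 'I_n -> lmodType k).

Definition dsum : Type := {dffun forall i : 'I_n, M i}.
HB.instance Definition _ := Choice.on dsum.
Implicit Types x y z : dsum.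

Definition dsum_add x y : dsum := [ffun i => x i + y i].
Definition dsum_zero : dsum := [ffun i => 0].
Definition dsum_opp x : dsum := [ffun i => - x i].
Definition dsum_scale (c : k) x : dsum := [ffun i => c *: x i].

Fact dsum_addA : associative dsum_add.
Proof. by move=> x y z; apply/ffunP=> i; rewrite !ffunE addrA. Qed.
Fact dsum_addC : commutative dsum_add.
Proof. by move=> x y; apply/ffunP=> i; rewrite !ffunE addrC. Qed.
Fact dsum_add0 : left_id dsum_zero dsum_add.
Proof. by move=> x; apply/ffunP=> i; rewrite !ffunE add0r. Qed.
Fact dsum_addN : left_inverse dsum_zero dsum_opp dsum_add.
Proof. by move=> x; apply/ffunP=> i; rewrite !ffunE addNr. Qed.
HB.instance Definition _ := GRing.isZmodule.Build dsum
  dsum_addA dsum_addC dsum_add0 dsum_addN.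

Fact dsum_scaleA a b x : dsum_scale a (dsum_scale b x) = dsum_scale (a * b) x.
Proof. by apply/ffunP=> i; rewrite !ffunE scalerA. Qed.
Fact dsum_scale1 : left_id 1 dsum_scale.
Proof. by move=> x; apply/ffunP=> i; rewrite !ffunE scale1r. Qed.
Fact dsum_scaleDr : right_distributive dsum_scale +%R.
Proof. by move=> a x y; apply/ffunP=> i; rewrite !ffunE scalerDr. Qed.
Fact dsum_scaleDl x : {morph dsum_scale^~ x : a b / a + b}.
Proof. by move=> a b; apply/ffunP=> i; rewrite !ffunE scalerDl. Qed.
HB.instance Definition _ := GRing.Zmodule_isLmodule.Build k dsum
  dsum_scaleA dsum_scale1 dsum_scaleDr dsum_scaleDl.
End DirectSum.

(* Course-of-values recursion: F n prev may use prev i for i < n. *)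
Section StrongRecursion.
Variables (T : Type) (x0 : T) (F : nat -> (nat -> T) -> T).

Fixpoint below (n : nat) : nat -> T :=
  if n is n'.+1 then
    fun i => if i == n' then F n' (below n') else below n' i
  else fun=> x0.

Definition srec (n : nat) : T := F n (below n).

Lemma srecE n : srec n = F n (fun i => if (i < n)%N then srec i else x0).
Proof.
rewrite {1}/srec; congr F; apply/funext.
elim: n => [|n IHn] i //=; rewrite ltnS leq_eqVlt IHn.
by case: eqP => [->|_].
Qed.
End StrongRecursion.

Record hopf (k : comNzRingType) (H : algType k) := Hopf {
  Delta : {linear H -> tensor H H};
  counit : {scalar H};
  antipode : {linear H -> H};
  sweedler h : seq (H * H) := texpr (Delta h);
  DeltaA h :
    \sum_(p <- sweedler h) \sum_(q <- sweedler p.1) tens q.1 (tens q.2 p.2)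
    = \sum_(p <- sweedler h) \sum_(q <- sweedler p.2) tens p.1 (tens q.1 q.2);
  DeltaL h : \sum_(p <- sweedler h) counit p.1 *: p.2 = h;
  DeltaR h : \sum_(p <- sweedler h) counit p.2 *: p.1 = h;
  Delta1 : Delta 1 = tens 1 1;
  DeltaM h l : Delta (h * l)
    = \sum_(p <- sweedler h) \sum_(q <- sweedler l)
        tens (p.1 * q.1) (p.2 * q.2);
  counit1 : counit 1 = 1;
  counitM h l : counit (h * l) = counit h * counit l;
  antipodeL h : \sum_(p <- sweedler h) antipode p.1 * p.2 = (counit h)%:A;
  antipodeR h : \sum_(p <- sweedler h) p.1 * antipode p.2 = (counit h)%:A
}.

(* x_0 ... x_i * x_(i+1) ... *)
Definition merge_at (R : nzRingType) (i : nat) (x : seq R) : seq R :=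
  take i x ++ (x`_i * x`_i.+1) :: drop i.+2 x.

Section CrossedProduct.
Variables (k : comNzRingType) (A H : algType k) (hH : hopf H).
Variables (act : H -> A -> A) (f : {linear tensor H H -> A}).

Local Notation sw := (sweedler hH).

(* act h a is a^h *)
Definition weak_action : Prop :=
  [/\ is_bilinear act,
      forall h a b, act h (a * b) = \sum_(p <- sw h) act p.1 a * act p.2 b,
      forall h, act h 1 = (counit hH h)%:A
    & forall a, act 1 a = a].

Definition E : lmodType k := tensor A H.
Definition cr (a : A) (h : H) : E := tens a h.

Definition fc (h l : H) : A := f (tens h l).

Definition sw3 (h : H) : seq (H * H * H) :=
  [seq (p.1, q.1, q.2) | p <- sw h, q <- sw p.2].

Definition mulE (x y : E) : E :=
  \sum_(u <- texpr x) \sum_(v <- texpr y)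
   \sum_(p <- sw3 u.2) \sum_(q <- sw v.2)
     cr (u.1 * act p.1.1 v.1 * fc p.1.2 q.1) (p.2 * q.2).

Definition oneE : E := cr 1 1.

Definition crossed_product : Prop :=
  [/\ associative mulE, left_id oneE mulE & right_id oneE mulE].

Definition Hbar : lmodType k := modline (1 : H).
Definition Abar : lmodType k := modline (1 : A).
Definition Ebar : lmodType k := modline oneE.
Definition clsH (h : H) : Hbar := cls 1 h.
Definition clsA (a : A) : Abar := cls 1 a.
Definition clsE (e : E) : Ebar := cls oneE e.

(* The list of all pairs (h^(1), h^(2)) for a multi-index h of elements of H. *)
Definition sws (hs : seq H) : seq (seq H * seq H) :=
  foldr (fun h ps => [seq (p.1 :: q.1, p.2 :: q.2) | p <- sw h, q <- ps])
    [:: ([::], [::])] hs.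

(* acts a [:: h_i; ...; h_j] = (... (a^(h_j)) ...)^(h_i) *)
Definition acts (a : A) (hs : seq H) : A := foldr act a hs.

(* The families below are written with the source and target bidegrees as
   independent arguments, so that no transport between equal bidegrees is
   needed; each map is meaningful only at the bidegrees given with it. *)

Definition X (r s : nat) : lmodType k := tensor E (tpow Hbar (tpow Abar E r) s).
Definition Y (s : nat) : lmodType k := tensor E (tpow Hbar H s).
Definition B (n : nat) : lmodType k := tensor E (tpow Ebar E n).

Definition X_tens r s (e : E) (hs : seq H) (as_ : seq A) (e' : E) : X r s :=
  tens e (tpow_el s (map clsH hs) (tpow_el r (map clsA as_) e')).

(* a_0 (x) h_0 ... h_s (x) a_1 ... a_(r+1) (x) h_(s+1) *)
Definition X_el r s (a0 : A) (hs : seq H) (as_ : seq A) (h : H) : X r s :=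
  X_tens r s (cr a0 hs`_0) (behead hs) as_ (cr as_`_r h).

(* a_0 (x) h_0 ... h_(s+1) *)
Definition Y_el s (a0 : A) (hs : seq H) : Y s :=
  tens (cr a0 hs`_0) (tpow_el s (map clsH (behead hs)) hs`_s.+1).

(* x_0 (x) ... (x) x_(n+1) *)
Definition B_el n (xs : seq E) : B n :=
  tens (head 0 xs) (tpow_el n (map clsE (behead xs)) xs`_n.+1).

Record X_gen r s := XGen {
  xa0 : A; xhs : s.+1.-tuple H; xas : r.+1.-tuple A; xh : H }.
Record Y_gen s := YGen { ya0 : A; yhs : s.+2.-tuple H }.

Definition X_of r s (g : X_gen r s) : X r s :=
  X_el r s (xa0 g) (xhs g) (xas g) (xh g).
Definition Y_of s (g : Y_gen s) : Y s := Y_el s (ya0 g) (yhs g).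
Definition B_of n (xs : n.+2.-tuple E) : B n := B_el n xs.

Definition X_lact r s (e : E) (x : X r s) : X r s :=
  linext (@X_of r s) (fun g =>
    X_tens r s (mulE e (cr (xa0 g) (xhs g)`_0)) (behead (xhs g)) (xas g)
      (cr (xas g)`_r (xh g))) x.
Definition X_ract r s (x : X r s) (e : E) : X r s :=
  linext (@X_of r s) (fun g =>
    X_tens r s (cr (xa0 g) (xhs g)`_0) (behead (xhs g)) (xas g)
      (mulE (cr (xas g)`_r (xh g)) e)) x.
Definition B_lact n (e : E) (x : B n) : B n :=
  linext (@B_of n) (fun xs => B_el n (mulE e xs`_0 :: behead xs)) x.
Definition B_ract n (x : B n) (e : E) : B n :=
  linext (@B_of n) (fun xs =>
    B_el n (rcons (take n.+1 xs) (mulE xs`_n.+1 e))) x.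

(* mu_s, for r = 0 *)
Definition mu r s : X r s -> Y s :=
  linext (@X_of r s) (fun g =>
    \sum_(p <- sws (xhs g))
      Y_el s (xa0 g * acts (xas g)`_0 p.1) (rcons p.2 (xh g))).

(* d^0_(r,s), for r' = r - 1 and s' = s *)
Definition d0 r s r' s' : X r s -> X r' s' :=
  linext (@X_of r s) (fun g =>
    \sum_(p <- sws (xhs g))
      X_el r' s' (xa0 g * acts (xas g)`_0 p.1) p.2 (behead (xas g)) (xh g)
    + \sum_(i < r)
      (-1) ^+ i.+1 *: X_el r' s' (xa0 g) (xhs g) (merge_at i (xas g)) (xh g)).

(* partial_s, for s' = s - 1 *)
Definition bd s s' : Y s -> Y s' :=
  linext (@Y_of s) (fun g => let hs : seq H := yhs g in
    \sum_(i < s.+1) (-1) ^+ i.+1 *: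
      \sum_(p <- sws (take i hs)) \sum_(q <- sw hs`_i) \sum_(t <- sw hs`_i.+1)
        Y_el s' (ya0 g * acts (fc q.1 t.1) p.1)
          (p.2 ++ (q.2 * t.2) :: drop i.+2 hs)).

(* sigma^0_(0,s) : Y_s -> X_(0,s), for r' = 0 and s' = s *)
Definition sigma0Y s r' s' : Y s -> X r' s' :=
  linext (@Y_of s) (fun g =>
    X_el r' s' (ya0 g) (take s.+1 (yhs g)) [:: 1] (yhs g)`_s.+1).

(* sigma^0_(r+1,s) : X_(r,s) -> X_(r+1,s), for r' = r + 1 and s' = s *)
Definition sigma0 r s r' s' : X r s -> X r' s' :=
  linext (@X_of r s) (fun g =>
    (-1) ^+ r.+1 *: X_el r' s' (xa0 g) (xhs g) (rcons (xas g) 1) (xh g)).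

(* The bimodule map given by D on k (x) Hbar^s (x) Abar^r (x) k. *)
Definition X_biext r s r' s' (D : X r s -> X r' s') : X r s -> X r' s' :=
  linext (@X_of r s) (fun g =>
    X_lact (cr (xa0 g) (xhs g)`_0)
      (X_ract (D (X_tens r s oneE (behead (xhs g)) (xas g) oneE))
        (cr (xas g)`_r (xh g)))).

(* d^l_(r,s), for r' = r + l - 1 and s' = s - l *)
Definition dl : nat -> forall r s r' s', X r s -> X r' s' :=
  srec (fun r s r' s' (_ : X r s) => 0)
    (fun l d => if l == 0%N then d0 else
      fix d_l r : forall s r' s', X r s -> X r' s' :=
        match r with
        | 0 => fun s r' s' => X_biext (fun x : X 0 s =>
            if l == 1%N then - sigma0Y r' s' (bd s' (mu x)) else
            - \sum_(1 <= j < l)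
                sigma0 r' s' (d (l - j)%N j.-1 (s - j)%N r'.-1 s'
                  (d j 0%N s j.-1 (s - j)%N x)))
        | r0.+1 => fun s r' s' => X_biext (fun x : X r0.+1 s =>
            - (sigma0 r' s' (d_l r0 s r'.-1 s' (d0 r0 s x))
               + \sum_(1 <= j < l)
                   sigma0 r' s' (d (l - j)%N (r0 + j)%N (s - j)%N r'.-1 s'
                     (d j r0.+1 s (r0 + j)%N (s - j)%N x))))
        end).

Definition Xn (n : nat) : lmodType k := dsum (fun s : 'I_n.+1 => X (n - s) s).

Definition Xn_lact n (e : E) (x : Xn n) : Xn n :=
  [ffun s : 'I_n.+1 => X_lact e (x s)].
Definition Xn_ract n (x : Xn n) (e : E) : Xn n :=
  [ffun s : 'I_n.+1 => X_ract (x s) e].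

(* d_(n+1) on the summand X_(n+1-s, s) *)
Definition dsummand n (s : 'I_n.+2) (x : X (n.+1 - s) s) : Xn n :=
  [ffun s' : 'I_n.+1 => if (s' <= s)%N then
     dl (s - s') (n - s') s' x else 0].

(* d_(n+1) *)
Definition dX n (x : Xn n.+1) : Xn n := \sum_(s < n.+2) dsummand (x s).

(* sigma^(-1)_(s+1) *)
Definition sigmam1 s : Y s -> Y s.+1 :=
  linext (@Y_of s) (fun g => (-1) ^+ s *: Y_el s.+1 (ya0 g) (rcons (yhs g) 1)).

(* sigma^l_(r1+l, s-l), for r' = r1 + l and s' = s - l, when base is
   sigma^0_(r1, s) : V -> X_(r1, s). *)
Definition sigmal (V : lmodType k) (r1 s : nat)
    (base : forall r' s', V -> X r' s') : nat -> forall r' s', V -> X r' s' :=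
  srec (fun r' s' _ => 0)
    (fun l sg => if l == 0%N then base else fun r' s' x =>
      - \sum_(0 <= i < l)
          sigma0 r' s' (dl (l - i) r'.-1 s' (sg i (r1 + i)%N (s - i)%N x))).

Definition sigmaY s (l : nat) : forall r' s', Y s -> X r' s' :=
  sigmal 0 s (@sigma0Y s) l.
Definition sigmaX r s (l : nat) : forall r' s', X r s -> X r' s' :=
  sigmal r.+1 s (@sigma0 r s) l.

(* \overline\sigma_(n+1) *)
Definition sigmabar n (x : Xn n) : Xn n.+1 :=
  [ffun s' : 'I_n.+2 =>
    - sigmaY (n.+1 - s') (n.+1 - s') s' (sigmam1 (mu (x ord_max)))
    + \sum_(s < n.+1 | (s' <= s)%N) sigmaX (s - s') (n.+1 - s') s' (x s)].

(* b'_(n+1) *)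
Definition mergeE (i : nat) (xs : seq E) : seq E :=
  take i xs ++ mulE xs`_i xs`_i.+1 :: drop i.+2 xs.
Definition b' n : B n.+1 -> B n :=
  linext (@B_of n.+1) (fun xs =>
    \sum_(i < n.+2) (-1) ^+ i *: B_el n (mergeE i xs)).

(* xi_(n+1) *)
Definition xi n : B n -> B n.+1 :=
  linext (@B_of n) (fun xs => (-1) ^+ n.+1 *: B_el n.+1 (rcons xs oneE)).

(* X_0 has the single summand X_(0,0), which is B_0 by definition. *)
Fixpoint phi (n : nat) : Xn n -> B n :=
  match n with
  | 0 => fun x => x ord0
  | m.+1 => fun x => \sum_(s < m.+2)
      linext (@X_of (m.+1 - s) s) (fun g =>
        B_ract
          (xi (phi (dsummand
             (X_tens (m.+1 - s) s (cr (xa0 g) (xhs g)`_0) (behead (xhs g))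
                (xas g) oneE))))
          (cr (xas g)`_(m.+1 - s) (xh g))) (x s)
  end.

Fixpoint psi (n : nat) : B n -> Xn n :=
  match n with
  | 0 => fun y =>
      [ffun s : 'I_1 => ecast i (X (0 - i) i) (esym (ord1 s)) (y : X 0 0)]
  | m.+1 => linext (@B_of m.+1) (fun xs =>
      Xn_ract
        (sigmabar (psi (b' (B_el m.+1 (rcons (take m.+2 xs) oneE)))))
        xs`_m.+2)
  end.

(* omega_(n+1) *)
Fixpoint omega (n : nat) : B n -> B n.+1 :=
  match n with
  | 0 => fun=> 0
  | m.+1 => linext (@B_of m.+1) (fun xs =>
      B_ract
        (let x := B_el m.+1 (rcons (take m.+2 xs) oneE) in
         xi (phi (psi x) - x - omega (b' x)))
        xs`_m.+2)
  end.

Definition bimodule_map (V W : lmodType k) (lV : E -> V -> V) (rV : V -> E -> V)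
    (lW : E -> W -> W) (rW : W -> E -> W) (u : V -> W) : Prop :=
  [/\ linear u, forall e x, u (lV e x) = lW e (u x)
    & forall e x, u (rV x e) = rW (u x) e].

(* u and v are complex endomorphisms given in degrees n >= 0 (u_n, v_n), and
   w n is w_(n+1) : B_n -> B_(n+1). *)
Definition homotopy (u v : forall n, B n -> B n)
    (w : forall n, B n -> B n.+1) : Prop :=
  [/\ forall n, bimodule_map (@B_lact n) (@B_ract n)
                  (@B_lact n.+1) (@B_ract n.+1) (@w n),
      forall x : B 0, b' (w 0%N x) = u 0%N x - v 0%N x
    & forall n (x : B n.+1),
        b' (w n.+1 x) + w n (b' x) = u n.+1 x - v n.+1 x].

End CrossedProduct.

(* Main.v *)
(* Moving the A-components to the left identifies Y_s with
   E (x)_A (E/A)^s (x)_A E and X_rs with E (x)_A (E/A)^s (x) Abar^r (x) E. In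
   this form mu, d^0 and partial only multiply neighbours in a list, and the
   Hopf algebra structure enters only through the associativity of E. The rows
   X_*s -> Y_s, the column Y_* -> E and the bar resolution all have left linear
   contractions whose images generate them as right E-modules; hence
   d^0 d^0 = 0, partial partial = 0 and b' b' = 0 follow from the contraction
   identities and right linearity.

   Let d be mu or d^0, let h be sigma^0, let delta be the sum of partial and of
   the d^l with l > 0, and let D = d + delta. On the elements x (x) 1 the
   recursive definition says delta x = - h delta D x, so that w = D (D x)
   satisfies w = - h delta w, provided D (D (D x)) = 0, which is an induction
   hypothesis. As h delta strictly raises r, this forces w = 0. In the same way
   h' = h - h delta h', the sum of the sigma^l, satisfies D h' + h' D = 1,
   because u = D h' + h' D - 1 satisfies u = - h delta u. Correcting h' by
   sigma^(-1) mu gives the contraction sigmabar of X_*.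

   The map sigmabar vanishes on the elements x (x) 1, whence
   psi phi (x (x) 1) = sigmabar d (x (x) 1) = x (x) 1 by induction; the formula
   for omega only uses b' xi + xi b' = 1. *)

(* The maps of the complexes are given by [linext] on an arbitrarily chosen expression of the
   argument, so nothing can be computed before the defining formula is known to respect the tensor
   relations. Each map therefore gets a specification: a multilinear function of lists, zero on
   units in normalized places and on lists of the wrong length, that gives its values on generators.

   The twisted formulas are normal forms. Since E = A (x) H is free over A on the left, every
   element over A is moved to the form a (x) h_1 ... h_s by the rules (1#h)(a#1) = sum of a^(h1) #
   h2 and (1#h)(1#l) = sum of f(h1,l1) # h2 l2; each A-component pushed leftwards through earlier
   h_i picks up their iterated action. The cocycle identity is thus never expanded.

   Y is kept as a column beside the X_rs because, with mu counted in d and ∂ in delta, d h + h d = 1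
   holds also at r = 0, and the two cases of each recursion (for d^l and for sigma^l) become one
   equation between operators. *)
Require Import Defs.
From HB Require Import structures.
From mathcomp Require Import all_boot all_order all_algebra.
From mathcomp Require Import generic_quotient boolp.
From mathcomp Require Import freeg zify.

Set Implicit Arguments.
Unset Strict Implicit.
Unset Printing Implicit Defensive.

Import GRing.Theory.
Local Open Scope ring_scope.

(** * Linear maps and tensor products *)

Section LinearPredicate.
Variable k : comNzRingType.
Implicit Types U V W : lmodType k.

Section Values.
Variables (U V : lmodType k) (u : U -> V) (lu : linear u).

Lemma lin0 : u 0 = 0.
Proof. by have := lu (-1) 0 0; rewrite scaler0 addr0 scaleN1r addNr. Qed.
Lemma linD x y : u (x + y) = u x + u y.
Proof. by have := lu 1 x y; rewrite !scale1r. Qed.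
Lemma linZ c x : u (c *: x) = c *: u x.
Proof. by rewrite -[c *: x]addr0 lu lin0 addr0. Qed.
Lemma linN x : u (- x) = - u x.
Proof. by rewrite -scaleN1r linZ scaleN1r. Qed.
Lemma linB x y : u (x - y) = u x - u y.
Proof. by rewrite linD linN. Qed.
Lemma lin_sum I (s : seq I) (P : pred I) F :
  u (\sum_(i <- s | P i) F i) = \sum_(i <- s | P i) u (F i).
Proof. exact: (big_morph u linD lin0). Qed.
End Values.

Lemma linear_id U : linear (fun x : U => x).
Proof. by []. Qed.
Lemma linear_zero U V : linear (fun _ : U => 0 : V).
Proof. by move=> c x y; rewrite scaler0 addr0. Qed.
Lemma linear_comp U V W (u : V -> W) (v : U -> V) :
  linear u -> linear v -> linear (fun x => u (v x)).
Proof. by move=> lu lv c x y; rewrite lv lu. Qed.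
Lemma linear_add U V (u v : U -> V) :
  linear u -> linear v -> linear (fun x => u x + v x).
Proof. by move=> lu lv c x y; rewrite lu lv scalerDr addrACA. Qed.
Lemma linear_opp U V (u : U -> V) : linear u -> linear (fun x => - u x).
Proof. by move=> lu c x y; rewrite lu opprD scalerN. Qed.
Lemma linear_sub U V (u v : U -> V) :
  linear u -> linear v -> linear (fun x => u x - v x).
Proof. by move=> lu lv; apply: linear_add => //; apply: linear_opp. Qed.
Lemma linear_scale U V a (u : U -> V) :
  linear u -> linear (fun x => a *: u x).
Proof.
by move=> lu c x y; rewrite lu scalerDr !scalerA mulrC.
Qed.
Lemma linear_big U V I (s : seq I) (P : pred I) (u : I -> U -> V) :
  (forall i, linear (u i)) -> linear (fun x => \sum_(i <- s | P i) u i x).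
Proof.
move=> lu c x y; rewrite scaler_sumr -big_split.
by apply: eq_bigr => i _; apply: lu.
Qed.

Lemma linear_eq U V (u v : U -> V) : v =1 u -> linear u -> linear v.
Proof. by move=> uv lu c x y; rewrite !uv lu. Qed.

Lemma linear_if U V (b : bool) (u v : U -> V) :
  linear u -> linear v -> linear (fun x => if b then u x else v x).
Proof. by case: b. Qed.
End LinearPredicate.

Section Quotients.
Variable k : comNzRingType.
Implicit Types V W : lmodType k.

Lemma lquot_pi_linear V (R : V -> Prop) : linear (lquot_pi R).
Proof. by move=> c x y; rewrite lquot_piD -lquot_pi_scale. Qed.

Lemma lquot_pi_rel V (R : V -> Prop) x : R x -> lquot_pi R x = 0.
Proof.
move=> Rx; rewrite -(lin0 (lquot_pi_linear R)); apply/eqP.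
rewrite lquot_piE subr0; apply/asboolP.
by rewrite -[x]scale1r -[1 *: x]addr0; right=> //; left.
Qed.

Lemma lquot_lift V W (R : V -> Prop) (g : V -> W) :
    linear g -> (forall x, R x -> g x = 0) ->
  exists2 G : lquot R -> W, linear G & forall x, G (lquot_pi R x) = g x.
Proof.
move=> lg gR.
have gS x : in_lspan R x -> g x = 0.
  elim=> [|c y z Ry _ IH]; first exact: lin0.
  by rewrite lg gR // IH scaler0 addr0.
pose G (x : lquot R) := g (repr (x : Quotient.quot (lspan R))).
have GE x : G (lquot_pi R x) = g x.
  apply/eqP; rewrite -subr_eq0 -(linB lg); apply/eqP/gS/asboolP.
  change ((repr (lquot_pi R x : Quotient.quot (lspan R)) - x) \in lspan R).
  by rewrite -lquot_piE /lquot_pi reprK.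
exists G => // c; apply: lquot_piW => x; apply: lquot_piW => y.
by rewrite -(lquot_pi_linear R) !GE lg.
Qed.

Lemma fglift_linear V (T : choiceType) (F : T -> V) : linear (fglift F : {freeg T / k}
  -> V).
Proof.
pose G := fglift F : {freeg T / k} -> V.
have addG : zmod_morphism G by exact: lift_is_additive.
have GB x y : G (x - y) = G x - G y by exact: addG.
have G0 : G 0 = 0 by rewrite -(subrr 0) GB subrr.
have GD x y : G (x + y) = G x + G y.
  by rewrite -[y in LHS]opprK GB -[- y]sub0r GB G0 sub0r opprK.
have GZ c x : G (c *: x) = c *: G x.
  rewrite -[x]freeg_sumE scaler_sumr.
  elim: (dom x) => [|z s IH]; first by rewrite !big_nil G0 scaler0.
  rewrite !big_cons !GD IH scalerDr; congr (_ + _).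
  have -> : c *: << coeff z x *g z >> = << c * coeff z x *g z >>.
    by apply/eqP/freeg_eqP => t; rewrite coeffZ !coeffU mulrA.
  by rewrite /G !liftU scalerA.
by move=> c x y; rewrite -/G GD GZ.
Qed.

Lemma tens_linearl (M N : lmodType k) (n : N) : linear (fun m : M => tens m n).
Proof.
move=> c m m'; apply/eqP; rewrite -subr_eq0 opprD addrA.
by rewrite -(linZ (lquot_pi_linear _)) -!(linB (lquot_pi_linear _)) lquot_pi_rel //;
  left.
Qed.
Lemma tens_linearr (M N : lmodType k) (m : M) : linear (fun n : N => tens m n).
Proof.
move=> c n n'; apply/eqP; rewrite -subr_eq0 opprD addrA.
by rewrite -(linZ (lquot_pi_linear _)) -!(linB (lquot_pi_linear _)) lquot_pi_rel //;
  right.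
Qed.

Lemma tensor_ind (M N : lmodType k) (P : tensor M N -> Prop) :
    P 0 -> (forall x y, P x -> P y -> P (x + y)) ->
    (forall m n, P (tens m n)) -> forall x, P x.
Proof.
move=> P0 PD Pt; apply: lquot_piW => x; rewrite -[x]freeg_sumE.
rewrite (lin_sum (lquot_pi_linear _)).
elim: (dom x) => [|z s IH]; rewrite ?big_nil // big_cons; apply: PD => //.
have -> : << coeff z x *g z >> = coeff z x *: << z >>.
  by apply/eqP/freeg_eqP => t; rewrite coeffZ !coeffU mul1r.
rewrite (linZ (lquot_pi_linear _)); case: z => m n.
by rewrite -/(tens m n) -(linZ (tens_linearl n)).
Qed.

Lemma tensor_ext (M N W : lmodType k) (u v : tensor M N -> W) :
    linear u -> linear v -> (forall m n, u (tens m n) = v (tens m n)) ->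
  u =1 v.
Proof.
move=> lu lv uv; apply: tensor_ind => [|x y ux uy|//].
  by rewrite (lin0 lu) (lin0 lv).
by rewrite (linD lu) (linD lv) ux uy.
Qed.

Lemma tensor_lift (M N W : lmodType k) (F : M -> N -> W) :
    is_bilinear F ->
  exists2 G : tensor M N -> W, linear G & forall m n, G (tens m n) = F m n.
Proof.
move=> bF; have [x /= Rx|G lG GE] :=
    @lquot_lift _ _ (@tensor_rel k M N) _ (fglift_linear (fun p => F p.1 p.2)).
  by apply: (lift_rel bF); rewrite -[x]scale1r -[1 *: x]addr0; right=> //; left.
by exists G => // m n; rewrite GE liftU scale1r.
Qed.

(** A linear map does not see which expression of x was chosen. The spanning hypothesis rules out
    the default branch of [expr], the empty list. *)
Lemma linextE (G : Type) (V W : lmodType k) (el : G -> V) (F : G -> W) u :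
    linear u -> (forall g, u (el g) = F g) ->
    (forall x, exists l, x = \sum_(g <- l) el g) ->
  linext el F =1 u.
Proof.
move=> lu uF spn x; rewrite /linext /expr; case: pselect => [ex|[]] //.
case: cid => l /= ->; rewrite (lin_sum lu).
by apply: eq_bigr.
Qed.

Lemma cls_linear (M : lmodType k) (u : M) : linear (cls u).
Proof. exact: lquot_pi_linear. Qed.
Lemma cls_unit (M : lmodType k) (u : M) : cls u u = 0.
Proof. exact: lquot_pi_rel. Qed.
End Quotients.

(** * Multilinear functions of lists *)

Section Multilinear.
Variable k : comNzRingType.
Implicit Types M N V W : lmodType k.

(** Stated for lists of every length, with slots given by splittings instead of indices, so that
    merging and appending entries need no dependent types. *)
Definition mulin M W (F : seq M -> W) :=
  forall l1 l2, linear (fun m => F (l1 ++ m :: l2)).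

(** The last [n] entries are exempt: [n] is 1 when the list ends with the unreduced right factor,
    and 0 when that factor is a separate argument. *)
Definition normd n M W (u : M) (F : seq M -> W) :=
  forall l1 l2, (n <= size l2)%N -> F (l1 ++ u :: l2) = 0.

Lemma mulin_cons M W (F : seq M -> W) m : mulin F -> mulin (fun l => F (m :: l)).
Proof. by move=> mF l1 l2; apply: (mF (m :: l1)). Qed.
Lemma normd_cons n M W u (F : seq M -> W) m :
  normd n u F -> normd n u (fun l => F (m :: l)).
Proof. by move=> nF l1 l2; apply: (nF (m :: l1)). Qed.
Lemma mulin_head M W (F : seq M -> W) l : mulin F -> linear (fun m => F (m :: l)).
Proof. by move=> mF; apply: (mF [::]). Qed.
Lemma mulin_comp M V W (u : V -> W) (F : seq M -> V) :
  linear u -> mulin F -> mulin (fun l => u (F l)).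
Proof. by move=> lu mF l1 l2; apply: linear_comp (mF l1 l2). Qed.
Lemma normd_comp n M V W m (u : V -> W) (F : seq M -> V) :
  linear u -> normd n m F -> normd n m (fun l => u (F l)).
Proof. by move=> lu mF l1 l2 le_n; rewrite mF // (lin0 lu). Qed.
Lemma mulin_map M N W (u : N -> M) (F : seq M -> W) :
  linear u -> mulin F -> mulin (fun l => F (map u l)).
Proof.
move=> lu mF l1 l2 c x y.
by rewrite !map_cat /= lu mF.
Qed.
(** Replacing an entry leaves the length unchanged, so the guard is constant in the slot that
    varies. *)
Lemma mulin_guard M W (P : pred nat) (F : seq M -> W) :
    (forall l1 l2, P (size l1 + size l2).+1 -> linear (fun m => F (l1 ++ m :: l2))) ->
  mulin (fun l => if P (size l) then F l else 0).
Proof.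
move=> lF l1 l2.
have sE m : size (l1 ++ m :: l2) = (size l1 + size l2).+1.
  by rewrite size_cat addnS.
apply: (@linear_eq _ _ _ (fun m => if P (size l1 + size l2).+1 then F (l1 ++ m :: l2)
  else 0)).
  by move=> m; rewrite sE.
by case: (P _) (lF l1 l2) => [/(_ isT)|_] //; apply: linear_zero.
Qed.

Lemma tpow_ind M (u : M) N n (P : tpow (modline u) N n -> Prop) :
    P 0 -> (forall x y, P x -> P y -> P (x + y)) ->
    (forall ms x, size ms = n -> P (tpow_el n (map (cls u) ms) x)) ->
  forall x, P x.
Proof.
elim: n P => [|n IH] P P0 PD Pt x; first exact: (Pt [::]).
elim/tensor_ind: x => // m t; move: m; apply: lquot_piW => m.
elim/IH: t => [|x y Px Py|ms x sz_ms].
- by rewrite (lin0 (tens_linearr _)).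
- by rewrite (linD (tens_linearr _)); apply: PD.
by have := Pt (m :: ms) x; rewrite /= sz_ms; apply.
Qed.

(** One factor is peeled off at a time: the tail is lifted for each fixed first entry, and since the
    lifts are determined on generators they are linear in that entry and vanish at [u]. *)
Lemma tpow_lift M (u : M) N W (F : seq M -> N -> W) n :
    (forall x, mulin (F^~ x)) -> (forall x, normd 0 u (F^~ x)) ->
    (forall ms, linear (F ms)) ->
  exists2 G : tpow (modline u) N n -> W, linear G
    & forall ms x, size ms = n -> G (tpow_el n (map (cls u) ms) x) = F ms x.
Proof.
elim: n F => [|n IH] F mF nF lF.
  by exists (F [::]) => // ms x /size0nil->.
have /choice[G GP] m : exists G : tpow (modline u) N n -> W, linear G
    /\ forall ms x, size ms = n ->
        G (tpow_el n (map (cls u) ms) x) = F (m :: ms) x.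
  have [|||G lG GE] := IH (fun ms x => F (m :: ms) x); last by exists G.
  - by move=> x; exact: (mulin_cons m (mF x)).
  - by move=> x; exact: (normd_cons m (nF x)).
  by move=> ms; exact: lF.
have lG m : linear (G m) by case: (GP m).
have GE m ms x : size ms = n ->
  G m (tpow_el n (map (cls u) ms) x) = F (m :: ms) x by case: (GP m) => _; apply.
have /choice[B BP] t : exists B : modline u -> W, linear B
    /\ forall m, B (cls u m) = G m t.
  have [|_ ->|B lB BE] := @lquot_lift _ _ _ (fun x => x = u) (G^~ t); last by exists B.
    move=> c x y; elim/tpow_ind: t => [|t1 t2|ms z sz].
    - by rewrite !(lin0 (lG _)) scaler0 addr0.
    - by move=> E1 E2; rewrite !(linD (lG _)) E1 E2 scalerDr addrACA.
    by rewrite !GE // (mulin_head _ (mF z)).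
  elim/tpow_ind: t => [|t1 t2|ms z sz]; first exact: lin0.
    by move=> E1 E2; rewrite (linD (lG _)) E1 E2 addr0.
  by rewrite GE // (nF z [::]).
have [|G' lG' GE'] := @tensor_lift _ (modline u) (tpow (modline u) N n) W (fun m t => B
  t m).
  split=> [|t]; last by case: (BP t).
  apply: lquot_piW => m c x y.
  by rewrite !(BP _).2 (lG m).
exists G' => // -[|m ms] //= x [sz].
by rewrite GE' (BP _).2 GE.
Qed.
End Multilinear.

Section LastEntry.
Variables (k : comNzRingType) (M : lmodType k).

(** Lets a function that treats the last factor apart from the others still be a function of one
    list; the empty list gets the default 0. *)
Definition onlast (W : lmodType k) (G : seq M -> M -> W) (l : seq M) : W :=
  if l is x :: l' then G (belast x l') (last x l') else 0.

Lemma onlast_rcons (W : lmodType k) (G : seq M -> M -> W) l x :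
  onlast G (rcons l x) = G l x.
Proof. by case: l => //= y l; rewrite belast_rcons last_rcons. Qed.

Lemma onlast_mulin (W : lmodType k) (G : seq M -> M -> W) :
    (forall x, mulin (G^~ x)) -> (forall l, linear (G l)) ->
  mulin (onlast G).
Proof.
move=> mG lG l1 l2; case/lastP: l2 => [|l2 x].
  by apply: (linear_eq (u := G l1)) => // m; rewrite cats1 onlast_rcons.
apply: (linear_eq (u := fun m => G (l1 ++ m :: l2) x)) => [m|]; last exact: mG.
by rewrite -rcons_cons -rcons_cat onlast_rcons.
Qed.

Lemma onlast_normd (W : lmodType k) (G : seq M -> M -> W) u :
  (forall x, normd 0 u (G^~ x)) -> normd 1 u (onlast G).
Proof.
move=> nG l1; case/lastP=> // l2 x _.
by rewrite -rcons_cons -rcons_cat onlast_rcons nG.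
Qed.
End LastEntry.

Section TensorPowers.
Variable k : comNzRingType.

Lemma tpow_el_linear_last (M N : lmodType k) n (ms : seq M) :
  linear (fun x : N => tpow_el n ms x).
Proof.
elim: n ms => [|n IH] ms //=.
exact: (linear_comp (tens_linearr _) (IH _)).
Qed.

Lemma tpow_el_mulin (M N : lmodType k) (u : M) n (x : N) l1 l2 :
    (size l1 + size l2).+1 = n ->
  linear (fun m => tpow_el n (map (cls u) (l1 ++ m :: l2)) x).
Proof.
elim: n l1 => [|n IH] [|m l1] //= [sz].
  exact: (linear_comp (tens_linearl _) (cls_linear _)).
exact: (linear_comp (tens_linearr _) (IH _ sz)).
Qed.

Lemma tpow_el_unit (M N : lmodType k) (u : M) n (x : N) l1 l2 :
    (size l1 < n)%N ->
  tpow_el n (map (cls u) (l1 ++ u :: l2)) x = 0.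
Proof.
elim: n l1 => [|n IH] [|m l1] //= sz.
  by rewrite cls_unit (lin0 (tens_linearl _)).
by rewrite IH // (lin0 (tens_linearr _)).
Qed.

Lemma tpow_el_cat (M N : lmodType k) n (ms ms' : seq M) (x : N) :
  size ms = n -> tpow_el n (ms ++ ms') x = tpow_el n ms x.
Proof. by elim: n ms => [|n IH] [|m ms] //= [sz]; rewrite IH. Qed.
End TensorPowers.

(** * Generators of normalized tensor powers *)

Section BarGenerators.
Variables (k : comNzRingType) (V M : lmodType k) (u : M).
Local Notation P := (tpow (modline u) M).

(* e (x) m_1 ... m_(n+1), and 0 on lists of any other size, so that multilinearity
   holds without side conditions. *)
Definition Gt n (e : V) (ms : seq M) : tensor V (P n) :=
  if size ms == n.+1 then tens e (tpow_el n (map (cls u) ms) ms`_n) else 0.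

Record Gmul (W : lmodType k) (F : V -> seq M -> W) : Prop := {
  Gmul_l : forall ms, linear (F^~ ms);
  Gmul_r : forall e, mulin (F e);
  Gmul_1 : forall e, normd 1 u (F e) }.

Lemma Gt_rcons n e ms m : size ms = n ->
  Gt n e (rcons ms m) = tens e (tpow_el n (map (cls u) ms) m).
Proof.
move=> sz; rewrite /Gt size_rcons sz eqxx nth_rcons sz ltnn eqxx.
by rewrite map_rcons -cats1 tpow_el_cat // size_map.
Qed.

Lemma Gt_size n e ms : size ms != n.+1 -> Gt n e ms = 0.
Proof. by rewrite /Gt => /negbTE->. Qed.

Lemma Gt_mul n : Gmul (Gt n).
Proof.
split=> [ms|e|e].
- by apply: linear_if; [apply: tens_linearl | apply: linear_zero].
- apply: (@mulin_guard _ _ _ (pred1 n.+1)) => l1 l2 /eqP[sz].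
  case/lastP: l2 sz => [|l2 y]; rewrite ?addn0 ?size_rcons => sz.
    apply: (@linear_eq _ _ _ (fun m => tens e (tpow_el n (map (cls u) l1) m))) => [m|].
      rewrite cats1 map_rcons -cats1 tpow_el_cat ?size_map //.
      by rewrite nth_rcons sz ltnn eqxx.
    exact: (linear_comp (tens_linearr _) (@tpow_el_linear_last _ _ _ _ _)).
  apply: (@linear_eq _ _ _ (fun m => tens e (tpow_el n (map (cls u) (l1 ++ m :: l2))
    y))) => [m|].
    rewrite -rcons_cons -rcons_cat map_rcons -cats1 tpow_el_cat ?size_map ?size_cat
      -?sz //=.
    by rewrite nth_rcons size_cat /= ltnn eqxx.
  apply: (linear_comp (tens_linearr _)); apply: tpow_el_mulin.
  by rewrite -sz addnS.
move=> l1 l2 l2P; rewrite /Gt; case: eqP => // sz.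
rewrite tpow_el_unit ?(lin0 (tens_linearr _)) //.
by move: sz; rewrite size_cat addnS => -[<-]; rewrite -[X in (X < _)%N]addn0 ltn_add2l.
Qed.

Lemma Gt_ind n (Q : tensor V (P n) -> Prop) :
    Q 0 -> (forall x y, Q x -> Q y -> Q (x + y)) ->
    (forall e ms, size ms = n.+1 -> Q (Gt n e ms)) ->
  forall x, Q x.
Proof.
move=> Q0 QD Qt; elim/tensor_ind => // e t.
elim/tpow_ind: t => [|x y Qx Qy|ms x sz].
- by rewrite (lin0 (tens_linearr _)).
- by rewrite (linD (tens_linearr _)); apply: QD.
by rewrite -Gt_rcons //; apply: Qt; rewrite size_rcons sz.
Qed.

Lemma Gt_ext n (W : lmodType k) (f g : tensor V (P n) -> W) :
    linear f -> linear g ->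
    (forall e ms, size ms = n.+1 -> f (Gt n e ms) = g (Gt n e ms)) ->
  f =1 g.
Proof.
move=> lf lg fg; apply: Gt_ind => // [|x y fgx fgy].
  by rewrite (lin0 lf) (lin0 lg).
by rewrite (linD lf) (linD lg) fgx fgy.
Qed.

Lemma Gt_lift n (W : lmodType k) F : Gmul F ->
  exists2 f : tensor V (P n) -> W, linear f
    & forall e ms, size ms = n.+1 -> f (Gt n e ms) = F e ms.
Proof.
move=> mF.
have lift1 e : exists G : P n -> W, linear G /\
    forall ms x, size ms = n -> G (tpow_el n (map (cls u) ms) x) = F e (rcons ms x).
  have [|||G lG GE] := @tpow_lift k M u M W (fun ms x => F e (rcons ms x)) n; last by
    exists G.
  - move=> x l1 l2; apply: (@linear_eq _ _ _ (fun m => F e (l1 ++ m :: rcons l2 x))).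
      by move=> m; rewrite -rcons_cons -rcons_cat.
    exact: Gmul_r.
  - by move=> x l1 l2 _; rewrite rcons_cat rcons_cons (Gmul_1 mF) // size_rcons.
  move=> ms; apply: (@linear_eq _ _ _ (fun m => F e (ms ++ [:: m]))).
    by move=> m; rewrite cats1.
  exact: Gmul_r.
have /choice[G GP] := lift1.
have lG e : linear (G e) by case: (GP e).
have [|f lf fE] := @tensor_lift k V (P n) W G.
  split=> // t c x y; elim/tpow_ind: t => [|t1 t2|ms z sz].
  - by rewrite !(lin0 (lG _)) scaler0 addr0.
  - by move=> E1 E2; rewrite !(linD (lG _)) E1 E2 scalerDr addrACA.
  by rewrite !(GP _).2 // (Gmul_l mF).
exists f => // e ms; case/lastP: ms => // ms m; rewrite size_rcons => -[sz].
by rewrite Gt_rcons // fE (GP e).2.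
Qed.

Lemma Gmul_comp (W W' : lmodType k) (f : W -> W') F : linear f -> Gmul F ->
  Gmul (fun e ms => f (F e ms)).
Proof.
move=> lf mF; split=> *.
- by apply: (linear_comp lf); apply: Gmul_l.
- by apply: (mulin_comp lf); apply: Gmul_r.
by apply: (normd_comp lf); apply: Gmul_1.
Qed.

(** As both [F] and [Gt] vanish on lists of the wrong length, the evaluation rule holds for all
    lists, and later rewriting carries no size conditions. *)
Lemma Gt_linext n (W : lmodType k) F (J : Type) (el : J -> tensor V (P n)) (F' : J ->
  W) :
    Gmul F ->
    (forall e ms, size ms != n.+1 -> F e ms = 0) ->
    (forall x, exists l, x = \sum_(g <- l) el g) ->
    (forall j, exists e ms, [/\ size ms = n.+1, el j = Gt n e ms & F' j = F e ms]) ->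
  linear (linext el F') /\ forall e ms, linext el F' (Gt n e ms) = F e ms.
Proof.
move=> mF F0 spn FE; have [f lf fE] := Gt_lift n mF.
have E : linext el F' =1 f.
  apply: (linextE lf) => // j.
  by have [e [ms [sz -> ->]]] := FE j; rewrite fE.
split=> [|e ms]; first exact: linear_eq E lf.
have [sz|sz] := eqVneq (size ms) n.+1; first by rewrite E fE.
by rewrite F0 // E Gt_size // (lin0 lf).
Qed.
End BarGenerators.

(** * Generators of X, Y and B *)

Section Generators.
Variables (k : comNzRingType) (A H : algType k).
Local Notation E := (E A H).
Local Notation X := (X A H).
Local Notation Y := (Y A H).
Local Notation B := (B A H).
Local Notation cr := (@cr k A H).
Local Notation oneE := (oneE A H).
Local Notation X_tens := (@X_tens k A H).

Definition X_gt r s (e : E) (hs : seq H) (as_ : seq A) (z : E) : X r s :=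
  if (size hs == s) && (size as_ == r) then X_tens r s e hs as_ z else 0.

Definition Yt s (e : E) (hs : seq H) : Y s := Gt 1 s e hs.
Definition B_gt n (es : seq E) : B n :=
  if es is e :: es' then Gt oneE n e es' else 0.

Lemma cr_linearl h : linear (cr^~ h).
Proof. exact: tens_linearl. Qed.
Lemma cr_linearr a : linear (cr a).
Proof. exact: tens_linearr. Qed.

Lemma E_ext (W : lmodType k) (u v : E -> W) :
  linear u -> linear v -> (forall a h, u (cr a h) = v (cr a h)) -> u =1 v.
Proof. exact: tensor_ext. Qed.

Lemma E_spanned (e : E) : exists l, e = \sum_(p <- l) cr p.1 p.2.
Proof.
elim/tensor_ind: e => [|x y [lx ->] [ly ->]|a h].
- by exists [::]; rewrite big_nil.
- by exists (lx ++ ly); rewrite big_cat.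
by exists [:: (a, h)]; rewrite big_seq1.
Qed.

Record Xmul (W : lmodType k) (F : E -> seq H -> seq A -> E -> W) : Prop := {
  Xmul_l : forall hs as_ z, linear (fun e => F e hs as_ z);
  Xmul_H : forall e as_ z, mulin (fun hs => F e hs as_ z);
  Xmul_H1 : forall e as_ z, normd 0 1 (fun hs => F e hs as_ z);
  Xmul_A : forall e hs z, mulin (fun as_ => F e hs as_ z);
  Xmul_A1 : forall e hs z, normd 0 1 (fun as_ => F e hs as_ z);
  Xmul_r : forall e hs as_, linear (F e hs as_) }.

Lemma Xt_mul r s : Xmul (@X_gt r s).
Proof.
rewrite /X_gt /X_tens; split.
- move=> hs as_ z; apply: linear_if; last exact: linear_zero.
  exact: tens_linearl.
- move=> e as_ z; apply: (@mulin_guard _ _ _ (fun n => (n == s) && (size as_ == r))).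
  move=> l1 l2 /andP[/eqP sz _]; apply: (linear_comp (tens_linearr _)).
  exact: tpow_el_mulin.
- move=> e as_ z l1 l2 _; case: ifP => // /andP[/eqP sz _].
  rewrite tpow_el_unit ?(lin0 (tens_linearr _)) //.
  by rewrite -sz size_cat addnS ltnS leq_addr.
- move=> e hs z; apply: (@mulin_guard _ _ _ (fun n => (size hs == s) && (n == r))).
  move=> l1 l2 /andP[_ /eqP sz]; apply: (linear_comp (tens_linearr _)).
  apply: (linear_comp (@tpow_el_linear_last _ _ _ _ _)).
  exact: tpow_el_mulin.
- move=> e hs z l1 l2 _; case: ifP => // /andP[_ /eqP sz].
  rewrite (@tpow_el_unit _ _ _ 1 r z l1 l2) ?(lin0 (@tpow_el_linear_last _ _ _ _ _)).
    by rewrite (lin0 (tens_linearr _)).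
  by rewrite -sz size_cat addnS ltnS leq_addr.
move=> e hs as_; apply: linear_if; last exact: linear_zero.
apply: (linear_comp (tens_linearr _)).
apply: (linear_comp (@tpow_el_linear_last _ _ _ _ _)).
exact: tpow_el_linear_last.
Qed.

Lemma Xmul_comp (V W : lmodType k) (u : V -> W) F : linear u -> Xmul F ->
  Xmul (fun e hs as_ z => u (F e hs as_ z)).
Proof.
move=> lu mF; split=> *.
- by apply: (linear_comp lu); apply: Xmul_l.
- by apply: (mulin_comp lu); apply: Xmul_H.
- by apply: (normd_comp lu); apply: Xmul_H1.
- by apply: (mulin_comp lu); apply: Xmul_A.
- by apply: (normd_comp lu); apply: Xmul_A1.
by apply: (linear_comp lu); apply: Xmul_r.
Qed.

Lemma X_ind r s (P : X r s -> Prop) :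
    P 0 -> (forall x y, P x -> P y -> P (x + y)) ->
    (forall a0 h0 hs as_ a h, size hs = s -> size as_ = r ->
       P (X_gt r s (cr a0 h0) hs as_ (cr a h))) ->
  forall x, P x.
Proof.
move=> P0 PD Pt x.
have {}Pt e hs as_ z : size hs = s -> size as_ = r -> P (X_tens r s e hs as_ z).
  move=> szh sza; have XE : X_tens r s e hs as_ z = X_gt r s e hs as_ z.
    by rewrite /X_gt szh sza !eqxx.
  rewrite XE; have [le ->] := E_spanned e; have [lz ->] := E_spanned z.
  rewrite (lin_sum (Xmul_l (Xt_mul r s) _ _ _)); elim/big_rec: _ => // p y _ Py.
  apply: (PD) => //; rewrite (lin_sum (Xmul_r (Xt_mul r s) _ _ _)).
  by elim/big_rec: _ => // q t _ Pqt; apply: (PD) => //; apply: Pt.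
elim/tensor_ind: x => // e t; elim/tpow_ind: t => [|x y Px Py|hs t szh].
- by rewrite (lin0 (tens_linearr _)).
- by rewrite (linD (tens_linearr _)); apply: PD.
elim/tpow_ind: t => [|x y Px Py|as_ t sza].
- by rewrite (lin0 (@tpow_el_linear_last _ _ _ _ _)) (lin0 (tens_linearr _)).
- by rewrite (linD (@tpow_el_linear_last _ _ _ _ _)) (linD (tens_linearr _)); apply: PD.
exact: Pt.
Qed.

Lemma X_ext r s (W : lmodType k) (u v : X r s -> W) :
    linear u -> linear v ->
    (forall e hs as_ z, size hs = s -> size as_ = r ->
       u (X_gt r s e hs as_ z) = v (X_gt r s e hs as_ z)) ->
  u =1 v.
Proof.
move=> lu lv uv; apply: X_ind => [|x y ux uy|*]; last exact: uv.
  by rewrite (lin0 lu) (lin0 lv).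
by rewrite (linD lu) (linD lv) ux uy.
Qed.

Lemma X_lift r s (W : lmodType k) F : Xmul F ->
  exists2 u : X r s -> W, linear u &
    forall e hs as_ z, size hs = s -> size as_ = r ->
      u (X_gt r s e hs as_ z) = F e hs as_ z.
Proof.
move=> mF.
have lift1 e hs : exists G : tpow (Abar A) E r -> W, linear G /\
    forall as_ z, size as_ = r -> G (tpow_el r (map (@clsA k A) as_) z) = F e hs as_ z.
  have [|||G lG GE] := @tpow_lift k A 1 E W (F e hs) r; last by exists G.
  - by move=> z; apply: Xmul_A.
  - by move=> z; apply: Xmul_A1.
  by move=> ms; apply: Xmul_r.
pose G e hs := projT1 (cid (lift1 e hs)).
have lG e hs : linear (G e hs) by rewrite /G; case: cid => ? [].
have GE e hs as_ z : size as_ = r ->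
    G e hs (tpow_el r (map (@clsA k A) as_) z) = F e hs as_ z.
  by rewrite /G; case: cid => ? [] /=; auto.
have lift2 e : exists K : tpow (Hbar H) (tpow (Abar A) E r) s -> W, linear K /\
    forall hs t, size hs = s -> K (tpow_el s (map (@clsH k H) hs) t) = G e hs t.
  have [|||K lK KE] := @tpow_lift k H 1 _ W (G e) s; last by exists K.
  - move=> t l1 l2 c x y; elim/tpow_ind: t => [|t1 t2|as_ z sz].
    + by rewrite !(lin0 (lG _ _)) scaler0 addr0.
    + by move=> E1 E2; rewrite !(linD (lG _ _)) E1 E2 scalerDr addrACA.
    by rewrite !GE // (Xmul_H mF).
  - move=> t l1 l2 sz; elim/tpow_ind: t => [|t1 t2|as_ z sza].
    + by rewrite !(lin0 (lG _ _)).
    + by move=> E1 E2; rewrite !(linD (lG _ _)) E1 E2 addr0.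
    by rewrite !GE // (Xmul_H1 mF).
  exact: lG.
pose K e := projT1 (cid (lift2 e)).
have lK e : linear (K e) by rewrite /K; case: cid => ? [].
have KE e hs t : size hs = s ->
    K e (tpow_el s (map (@clsH k H) hs) t) = G e hs t.
  by rewrite /K; case: cid => ? [] /=; auto.
have [|L lL LE] := @tensor_lift k E (tpow (Hbar H) (tpow (Abar A) E r) s) W K.
  split=> // t c x y; elim/tpow_ind: t => [|t1 t2|hs t szh].
  - by rewrite !(lin0 (lK _)) scaler0 addr0.
  - by move=> E1 E2; rewrite !(linD (lK _)) E1 E2 scalerDr addrACA.
  rewrite !KE //; elim/tpow_ind: t => [|t1 t2|as_ z sza].
  - by rewrite !(lin0 (lG _ _)) scaler0 addr0.
  - by move=> E1 E2; rewrite !(linD (lG _ _)) E1 E2 scalerDr addrACA.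
  by rewrite !GE // (Xmul_l mF).
exists L => // e hs as_ z szh sza.
by rewrite /X_gt szh sza !eqxx /= /X_tens LE KE // GE.
Qed.

(** The tuple [xas] has r+1 entries, the last being the A-component of the right factor; [X_tens]
    ignores it in the middle, whence [take r]. *)
Lemma X_of_Xt r s (g : X_gen A H r s) :
  X_of g = X_gt r s (cr (xa0 g) (xhs g)`_0) (behead (xhs g)) (take r (xas g))
              (cr (xas g)`_r (xh g)).
Proof.
case: g => a0 hs as_ h; rewrite /X_of /X_el /X_gt /=.
rewrite size_behead size_tuple eqxx size_takel ?size_tuple // eqxx /=.
rewrite /X_tens -{1}(cat_take_drop r as_) map_cat tpow_el_cat //.
by rewrite size_map size_takel ?size_tuple.
Qed.

Lemma X_of_spanned r s (x : X r s) : exists l, x = \sum_(g <- l) @X_of k A H r s g.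
Proof.
elim/X_ind: x => [|x y [lx ->] [ly ->]|a0 h0 hs as_ a h szh sza].
- by exists [::]; rewrite big_nil.
- by exists (lx ++ ly); rewrite big_cat.
have szh' : size (h0 :: hs) == s.+1 by rewrite /= szh.
have sza' : size (rcons as_ a) == r.+1 by rewrite size_rcons sza.
exists [:: XGen a0 (Tuple szh') (Tuple sza') h].
rewrite big_seq1 X_of_Xt /= nth_rcons sza ltnn eqxx.
by rewrite -cats1 take_cat sza ltnn subnn take0 cats0.
Qed.

Lemma X_linext r s (W : lmodType k) F (F' : X_gen A H r s -> W) :
    Xmul F ->
    (forall e hs as_ z, (size hs == s) && (size as_ == r) = false -> F e hs as_ z = 0)
      ->
    (forall a0 h0 hs as_ a h (sh : size (h0 :: hs) == s.+1)
       (sa : size (rcons as_ a) == r.+1),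
      F' (XGen a0 (Tuple sh) (Tuple sa) h) = F (cr a0 h0) hs as_ (cr a h)) ->
  linear (linext (@X_of k A H r s) F') /\
  forall e hs as_ z, linext (@X_of k A H r s) F' (X_gt r s e hs as_ z) = F e hs as_ z.
Proof.
move=> mF F0 FE; have [u lu uE] := @X_lift r s W F mF.
have E : linext (@X_of k A H r s) F' =1 u.
  apply: (linextE lu) => [|x]; last exact: X_of_spanned.
  case=> a0 [[|h0 hs] sh] [as_ sa] h; first by [].
  rewrite X_of_Xt /= uE ?size_takel ?(eqP sa) //; last by case/eqP: sh.
  case/lastP: as_ sa => // as_ a sa; rewrite FE.
  move: (sa); rewrite size_rcons => /eqP[sa'].
  rewrite nth_rcons sa' ltnn eqxx.
  by rewrite -cats1 take_cat sa' ltnn subnn take0 cats0.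
split=> [|e hs as_ z]; first exact: linear_eq E lu.
have [/andP[/eqP sh /eqP sa]|/negbTE sz] := boolP ((size hs == s) && (size as_ == r)).
  by rewrite E uE.
by rewrite F0 // E /X_gt sz (lin0 lu).
Qed.

Lemma Y_of_Yt s a0 h0 hs (sh : size (h0 :: hs) == s.+2) :
  Y_of (YGen a0 (Tuple sh)) = Yt s (cr a0 h0) hs.
Proof.
rewrite /Y_of /Yt /Gt /Y_el /=; move: (sh) => /= /eqP[->].
by rewrite eqxx.
Qed.

Lemma Y_of_spanned s (x : Y s) : exists l, x = \sum_(g <- l) @Y_of k A H s g.
Proof.
elim/(@Gt_ind k E H 1 s): x => [|x y [lx ->] [ly ->]|e hs szh].
- by exists [::]; rewrite big_nil.
- by exists (lx ++ ly); rewrite big_cat.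
have [l ->] := E_spanned e; rewrite (lin_sum (Gmul_l (Gt_mul _ _ _) hs)).
elim: l => [|[a0 h0] l [l' E]]; first by exists [::]; rewrite !big_nil.
have szh' : size (h0 :: hs) == s.+2 by rewrite /= szh.
exists (YGen a0 (Tuple szh') :: l').
by rewrite !big_cons -E Y_of_Yt.
Qed.

Lemma Y_linext s (W : lmodType k) F (F' : Y_gen A H s -> W) :
    Gmul 1 F ->
    (forall e hs, size hs != s.+1 -> F e hs = 0) ->
    (forall a0 h0 hs (sh : size (h0 :: hs) == s.+2),
      F' (YGen a0 (Tuple sh)) = F (cr a0 h0) hs) ->
  linear (linext (@Y_of k A H s) F') /\
  forall e hs, linext (@Y_of k A H s) F' (Yt s e hs) = F e hs.
Proof.
move=> mF F0 FE; apply: (Gt_linext mF F0 (@Y_of_spanned s)) => -[a0 [[|h0 hs] sh]] //.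
exists (cr a0 h0), hs; split; [|exact: Y_of_Yt|exact: FE].
by move: (sh) => /= /eqP[].
Qed.

Lemma B_of_Bt n (xs : n.+2.-tuple E) : B_of xs = B_gt n xs.
Proof.
case: xs => -[|x xs] //= sz; rewrite /B_of /B_el /B_gt /Gt /=.
by move: (sz) => /= /eqP[->]; rewrite eqxx.
Qed.

Lemma B_of_spanned n (x : B n) : exists l, x = \sum_(g <- l) @B_of k A H n g.
Proof.
elim/(@Gt_ind k E E oneE n): x => [|x y [lx ->] [ly ->]|e es sz].
- by exists [::]; rewrite big_nil.
- by exists (lx ++ ly); rewrite big_cat.
have sz' : size (e :: es) == n.+2 by rewrite /= sz.
by exists [:: Tuple sz']; rewrite big_seq1 B_of_Bt.
Qed.

Lemma B_linext n (W : lmodType k) F (F' : n.+2.-tuple E -> W) :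
    Gmul oneE (fun e es => F (e :: es)) ->
    (forall es, size es != n.+2 -> F es = 0) ->
    (forall es : n.+2.-tuple E, F' es = F es) ->
  linear (linext (@B_of k A H n) F') /\
  forall es, linext (@B_of k A H n) F' (B_gt n es) = F es.
Proof.
move=> mF F0 FE.
have F0' e es : size es != n.+1 -> F (e :: es) = 0 by move=> sz; apply: F0.
have [|lF F'E] := Gt_linext (F' := F') mF F0' (@B_of_spanned n).
  case=> -[|e es] sz; first by [].
  by exists e, es; split; [case/eqP: (sz)|exact: B_of_Bt|exact: FE].
split=> // -[|e es]; last exact: F'E.
by rewrite (lin0 lF) F0.
Qed.

Lemma B_ext n (W : lmodType k) (f g : B n -> W) :
    linear f -> linear g ->
    (forall es, size es = n.+2 -> f (B_gt n es) = g (B_gt n es)) ->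
  f =1 g.
Proof.
move=> lf lg fg; apply: (Gt_ext lf lg) => e es sz.
by apply: (fg (e :: es)); rewrite /= sz.
Qed.
End Generators.

(** * Alternating sums of products of neighbours *)

Section AlternatingMerges.
Variables (k : comNzRingType) (S : Type) (op : S -> S -> S).
Implicit Types (V W : lmodType k) (x y : S) (l t : seq S).

(* The alternating sum of the values of G on the lists obtained from x :: l by
   multiplying two neighbours. *)
Fixpoint alt W (G : seq S -> W) x l : W :=
  if l is y :: l' then G (op x y :: l') - alt (fun t => G (x :: t)) y l' else 0.

Lemma eq_alt W (G G' : seq S -> W) x l :
  (forall t, size t = size l -> G t = G' t) -> alt G x l = alt G' x l.
Proof.
elim: l x G G' => //= y l IH x G G' GG'; congr (_ - _); first exact: GG'.
by apply: IH => t sz; apply: GG'; rewrite /= sz.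
Qed.

Lemma alt_eq0 W (G : seq S -> W) x l :
  (forall t, size t = size l -> (0 < size t)%N -> G t = 0) -> alt G x l = 0.
Proof.
elim: l x G => //= y l IH x G G0; rewrite G0 // IH ?subr0 // => t sz _.
by apply: G0; rewrite //= sz.
Qed.

Lemma lin_alt V W (u : V -> W) (G : seq S -> V) x l : linear u ->
  u (alt G x l) = alt (fun t => u (G t)) x l.
Proof.
move=> lu; elim: l x G => [|y l IH] x G /=; first exact: lin0.
by rewrite (linB lu) IH.
Qed.

Lemma linear_alt_fun V W (G : V -> seq S -> W) x l :
  (forall t, linear (fun v => G v t)) -> linear (fun v => alt (G v) x l).
Proof.
elim: l x G => [|y l IH] x G lG /=; first exact: linear_zero.
by apply: linear_sub => //; apply: (IH _ (fun v t => G v (x :: t))).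
Qed.

(** Bridge to the indexed sums in the definitions of [bd], [d0] and [b']. *)
Lemma alt_sum W (G : seq S -> W) x0 x l : alt G x l =
  \sum_(i < size l) (-1) ^+ i *: G (take i (x :: l) ++
     op (nth x0 (x :: l) i) (nth x0 (x :: l) i.+1) :: drop i.+2 (x :: l)).
Proof.
elim: l x G => [|y l IH] x G; first by rewrite big_ord0.
rewrite [alt _ _ _]/= IH big_ord_recl expr0 scale1r [size _]/= /= drop0 -sumrN.
by congr (_ + _); apply: eq_bigr => i _; rewrite exprS mulN1r scaleNr.
Qed.

(** Only the merge of the last two entries meets the factor [a], and there associativity suffices.
    This is the source of the right linearity of the differentials. *)
Lemma alt_rcons_mul W (G G' : seq S -> W) a b x l : associative op ->
    (forall t y, G' (rcons t y) = G (rcons t (op y a))) ->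
  alt G' x (rcons l b) = alt G x (rcons l (op b a)).
Proof.
move=> opA; elim: l x G G' => [|y l IH] x G G' GG' /=.
  by rewrite (GG' [::]) opA.
rewrite -!rcons_cons GG'; congr (_ - _); apply: IH => t z.
by rewrite -!rcons_cons GG'.
Qed.

Lemma alt_lmul W (G G' : seq S -> W) a x l : associative op ->
    (forall y t, G' (y :: t) = G (op a y :: t)) ->
  alt G' x l = alt G (op a x) l.
Proof.
case: l => //= y l opA GG'; rewrite GG' opA; congr (_ - _).
by apply: eq_alt => t _; apply: GG'.
Qed.

Variable u : S.

(** The one merge that consumes the appended unit returns the original list. All contraction
    identities below rest on this surviving term. *)
Lemma alt_rcons_unit W (G : seq S -> W) x l : right_id u op ->
  alt G x (rcons l u) =
    alt (fun t => G (rcons t u)) x l + (-1) ^+ size l *: G (x :: l).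
Proof.
move=> opu; elim: l x G => [|y l IH] x G /=.
  by rewrite opu subr0 add0r scale1r.
by rewrite IH opprD addrA exprS mulN1r scaleNr.
Qed.

(** The two merges next to the unit give the same list with opposite signs; every other merge leaves
    the unit in a normalized place. *)
Lemma alt_unit W (G : seq S -> W) x l1 l2 : left_id u op -> right_id u op ->
    (forall e l l', (0 < size l')%N -> G (e :: l ++ u :: l') = 0) ->
  (0 < size l2)%N -> alt G x (l1 ++ u :: l2) = 0.
Proof.
move=> uop opu Gu l2P; elim: l1 x G Gu => [|y l1 IH] x G Gu.
  case: l2 l2P => // z l2 _.
  rewrite -cat1s [cat _ _]/= [LHS]/= opu uop -/(alt _ _ _) alt_eq0 ?subr0 ?subrr // =>
    t _ tP.
  exact: (Gu x [::]).
rewrite /= Gu // IH ?subr0 // => e l l'; exact: (Gu x (e :: l)).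
Qed.
End AlternatingMerges.

Section AlternatingMergesLinear.
Variables (k : comNzRingType) (S : lmodType k) (op : S -> S -> S).
Hypothesis op_bilinear : is_bilinear op.

Definition altl (W : lmodType k) (G : seq S -> W) (l : seq S) : W :=
  if l is x :: l' then alt op G x l' else 0.

Lemma altl_mulin (W : lmodType k) (G : seq S -> W) : mulin G -> mulin (altl G).
Proof.
have [lr ll] := op_bilinear.
move=> mG l1 l2; elim: l1 G mG => [|x l1 IH] G mG.
  case: l2 => [|y l2] /=; first exact: linear_zero.
  apply: linear_sub; first exact: (linear_comp (mulin_head l2 mG) (ll y)).
  by apply: (linear_alt_fun op y l2 (G := fun v t => G (v :: t))) => t; apply:
    mulin_head.
case: l1 IH => [|y l1] IH /=; apply: linear_sub.
- exact: (linear_comp (mulin_head l2 mG) (lr x)).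
- exact: (IH _ (mulin_cons x mG)).
- exact: (mG (op x y :: l1)).
exact: (IH _ (mulin_cons x mG)).
Qed.
End AlternatingMergesLinear.

(** * The algebra E *)

Section TensorSum.
Variable k : comNzRingType.

Definition tsum (M N W : lmodType k) (F : M -> N -> W) (x : tensor M N) : W :=
  \sum_(p <- texpr x) F p.1 p.2.

Section Bilinear.
Variables (M N W : lmodType k) (F : M -> N -> W) (bF : is_bilinear F).

Lemma tsum_tens m n : tsum F (tens m n) = F m n.
Proof. exact: linext_tens. Qed.

Lemma tsum_linear : linear (tsum F).
Proof.
have [u lu uE] := tensor_lift bF; apply: linear_eq (lu).
apply: (linextE lu) => [[m n]|]; first exact: uE.
elim/tensor_ind => [|x y [lx ->] [ly ->]|m n].
- by exists [::]; rewrite big_nil.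
- by exists (lx ++ ly); rewrite big_cat.
by exists [:: (m, n)]; rewrite big_seq1.
Qed.
End Bilinear.

Lemma eq_tsum (M N W : lmodType k) (F G : M -> N -> W) x :
  (forall m n, F m n = G m n) -> tsum F x = tsum G x.
Proof. by move=> FG; apply: eq_bigr => p _. Qed.

Lemma lin_tsum (M N V W : lmodType k) (u : V -> W) (F : M -> N -> V) x :
  linear u -> u (tsum F x) = tsum (fun m n => u (F m n)) x.
Proof. by move=> lu; rewrite /tsum (lin_sum lu). Qed.

Lemma linear_tsum_fun (M N V W : lmodType k) (F : V -> M -> N -> W) x :
  (forall m n, linear (fun v => F v m n)) -> linear (fun v => tsum (F v) x).
Proof. by move=> lF; apply: linear_big => p; apply: lF. Qed.

Lemma linear_mulr (V : lmodType k) (A : algType k) (u : V -> A) b :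
  linear u -> linear (fun x => u x * b).
Proof. by move=> lu c x y; rewrite lu mulrDl scalerAl. Qed.
Lemma linear_mull (V : lmodType k) (A : algType k) (u : V -> A) b :
  linear u -> linear (fun x => b * u x).
Proof. by move=> lu c x y; rewrite lu mulrDr scalerAr. Qed.
End TensorSum.

Section CrossedProductAlgebra.
Variables (k : comNzRingType) (A H : algType k) (hH : hopf H).
Variables (act : H -> A -> A) (f : {linear tensor H H -> A}).
Hypotheses (act_weak : weak_action hH act) (E_crossed : crossed_product hH act f).
Local Notation E := (E A H).
Local Notation cr := (@cr k A H).
Local Notation oneE := (oneE A H).
Local Notation "x ** y" := (mulE hH act f x y) (at level 40, left associativity).
Local Notation sw := (sweedler hH).
Local Notation fc := (fc f).

Definition iA (a : A) : E := cr a 1.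
Definition jH (h : H) : E := cr 1 h.

Lemma iA_linear : linear iA. Proof. exact: cr_linearl. Qed.
Lemma jH_linear : linear jH. Proof. exact: cr_linearr. Qed.

Lemma mulEA x y z : x ** (y ** z) = x ** y ** z.
Proof. by case: E_crossed => /(_ x y z). Qed.
Lemma mul1E x : oneE ** x = x.
Proof. by case: E_crossed => _ /(_ x). Qed.
Lemma mulE1 x : x ** oneE = x.
Proof. by case: E_crossed => _ _ /(_ x). Qed.

Definition dsw (W : lmodType k) (F : H -> H -> W) h := \sum_(p <- sw h) F p.1 p.2.

Lemma dsw_linear (W : lmodType k) (F : H -> H -> W) :
  is_bilinear F -> linear (dsw F).
Proof.
move=> bF; apply: (linear_comp (tsum_linear bF)).
by move=> c x y; rewrite linearP.
Qed.
Lemma dsw1 (W : lmodType k) (F : H -> H -> W) :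
  is_bilinear F -> dsw F 1 = F 1 1.
Proof. by move=> bF; rewrite /dsw /sweedler Delta1; apply: (tsum_tens bF). Qed.

Lemma act_linearl a : linear (act^~ a).
Proof. by case: act_weak => -[_ /(_ a)]. Qed.
Lemma act_linearr h : linear (act h).
Proof. by case: act_weak => -[/(_ h)]. Qed.
Lemma act_1 h : act h 1 = (counit hH h)%:A.
Proof. by case: act_weak => _ _ ->. Qed.
Lemma fc_linearl h : linear (fc^~ h).
Proof. by apply: (linear_comp _ (tens_linearl _)) => c x y; rewrite linearP. Qed.
Lemma fc_linearr h : linear (fc h).
Proof. by apply: (linear_comp _ (tens_linearr _)) => c x y; rewrite linearP. Qed.

Definition crmul a h b l : E :=
  dsw (fun h1 h' => dsw (fun h2 h3 => dsw (fun l1 l2 =>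
    cr (a * act h1 b * fc h2 l1) (h3 * l2)) l) h') h.

Lemma crmul_bil1 a b h1 h2 h3 :
  is_bilinear (fun l1 l2 => cr (a * act h1 b * fc h2 l1) (h3 * l2)).
Proof.
split=> ?.
  by apply: (linear_comp (cr_linearr _)); apply: linear_mull; apply: linear_id.
apply: (linear_comp (cr_linearl _)); apply: linear_mull; exact: fc_linearr.
Qed.

Lemma crmul_bil2 a b l h1 :
  is_bilinear (fun h2 h3 => dsw (fun l1 l2 =>
    cr (a * act h1 b * fc h2 l1) (h3 * l2)) l).
Proof.
split=> ?; apply: linear_big => p.
  by apply: (linear_comp (cr_linearr _)); apply: linear_mulr; apply: linear_id.
apply: (linear_comp (cr_linearl _)); apply: linear_mull; exact: fc_linearl.
Qed.

Lemma crmul_bil3 a b l :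
  is_bilinear (fun h1 => dsw (fun h2 h3 => dsw (fun l1 l2 =>
    cr (a * act h1 b * fc h2 l1) (h3 * l2)) l)).
Proof.
split=> ?; first exact: dsw_linear (crmul_bil2 _ _ _ _).
apply: linear_big => p; apply: linear_big => q.
apply: (linear_comp (cr_linearl _)); apply: linear_mulr; apply: linear_mull.
exact: act_linearl.
Qed.

Lemma crmul_linear1 h b l : linear (fun a => crmul a h b l).
Proof.
apply: linear_big => p; apply: linear_big => q; apply: linear_big => t.
by apply: (linear_comp (cr_linearl _)); do 2!apply: linear_mulr; apply: linear_id.
Qed.
Lemma crmul_linear2 a b l : linear (fun h => crmul a h b l).
Proof. exact: dsw_linear (crmul_bil3 _ _ _). Qed.
Lemma crmul_linear3 a h l : linear (fun b => crmul a h b l).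
Proof.
apply: linear_big => p; apply: linear_big => q; apply: linear_big => t.
apply: (linear_comp (cr_linearl _)); apply: linear_mulr; apply: linear_mull.
exact: act_linearr.
Qed.
Lemma crmul_linear4 a h b : linear (crmul a h b).
Proof.
apply: linear_big => p; apply: linear_big => q; apply: dsw_linear.
exact: crmul_bil1.
Qed.

Lemma mulE_tsum x y :
  x ** y = tsum (fun a h => tsum (fun b l => crmul a h b l) y) x.
Proof.
apply: eq_bigr => u _; apply: eq_bigr => v _.
by rewrite /sw3 big_allpairs_dep.
Qed.

Lemma crmul_bilinear a h : is_bilinear (crmul a h).
Proof. by split=> ?; [apply: crmul_linear4 | apply: crmul_linear3]. Qed.
Lemma crmul_bilinear' y : is_bilinear (fun a h => tsum (fun b l => crmul a h b l) y).
Proof.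
by split=> ?; apply: linear_tsum_fun => *; [apply: crmul_linear2 | apply:
  crmul_linear1].
Qed.

Lemma mulE_linearl y : linear (fun x => x ** y).
Proof.
apply: (linear_eq (u := tsum (fun a h => tsum (fun b l => crmul a h b l) y))).
  by move=> x; apply: mulE_tsum.
exact: tsum_linear (crmul_bilinear' y).
Qed.
Lemma mulE_linearr x : linear (fun y => x ** y).
Proof.
apply: (linear_eq (u := fun y => tsum (fun a h => tsum (fun b l => crmul a h b l) y)
  x)).
  by move=> y; apply: mulE_tsum.
by apply: linear_big => p; apply: tsum_linear (crmul_bilinear _ _).
Qed.

(** The expressions chosen inside [mulE] disappear because [crmul] is linear in each of its four
    arguments. *)
Lemma mulE_cr a h b l : cr a h ** cr b l = crmul a h b l.
Proof.
by rewrite mulE_tsum (tsum_tens (crmul_bilinear' _)) (tsum_tens (crmul_bilinear _ _)).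
Qed.

Lemma crmul_scal a c h b l : crmul (c * a) h b l = tsum (fun a' h' => cr (c * a') h')
  (crmul a h b l).
Proof.
have bF : is_bilinear (fun a' h' => cr (c * a') h').
  split=> ?; first exact: cr_linearr.
  by apply: (linear_comp (cr_linearl _)); apply: linear_mull; apply: linear_id.
rewrite /crmul /dsw !(lin_sum (tsum_linear bF)); apply: eq_bigr => p _.
rewrite !(lin_sum (tsum_linear bF)); apply: eq_bigr => q _.
rewrite !(lin_sum (tsum_linear bF)); apply: eq_bigr => t _.
by rewrite (tsum_tens bF) !mulrA.
Qed.

(** For a = 1 this is the left unit law, and [a] enters [crmul] only as a factor on the far left. *)
Lemma iA_mul_cr a b h : iA a ** cr b h = cr (a * b) h.
Proof.
have E1 : crmul 1 1 b h = cr b h by rewrite -mulE_cr; apply: mul1E.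
rewrite /iA mulE_cr -[a in LHS]mulr1 crmul_scal E1 (@tsum_tens _ A H) //.
split=> ?; first exact: cr_linearr.
by apply: (linear_comp (cr_linearl _)); apply: linear_mull; apply: linear_id.
Qed.

Lemma iAM a b : iA a ** iA b = iA (a * b).
Proof. exact: iA_mul_cr. Qed.
Lemma iA_jH a h : iA a ** jH h = cr a h.
Proof. by rewrite iA_mul_cr mulr1. Qed.

Lemma dsw_counitl (W : lmodType k) (u : H -> W) h :
  linear u -> dsw (fun h1 h2 => counit hH h1 *: u h2) h = u h.
Proof.
move=> lu; rewrite -[in RHS](DeltaL hH h) (lin_sum lu).
by apply: eq_bigr => p _; rewrite (linZ lu).
Qed.

Lemma crmul_r1 a h b : crmul a h b 1 =
  dsw (fun h1 h' => dsw (fun h2 h3 => cr (a * act h1 b * fc h2 1) h3) h') h.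
Proof.
apply: eq_bigr => p _; apply: eq_bigr => q _.
by rewrite (dsw1 (crmul_bil1 _ _ _ _ _)) mulr1.
Qed.

(** Read off from the right unit law for 1#h: the action on 1 is a counit, which absorbs the first
    Sweedler leg. *)
Lemma fc_unit h : dsw (fun h1 h2 => cr (fc h1 1) h2) h = jH h.
Proof.
have := mulE1 (jH h); rewrite mulE_cr crmul_r1 => <-.
rewrite -[LHS](@dsw_counitl _ (dsw (fun h1 h2 => cr (fc h1 1) h2))); last first.
  apply: dsw_linear; split=> ?; first exact: cr_linearr.
  exact: (linear_comp (cr_linearl _) (fc_linearl _)).
apply: eq_bigr => p _; rewrite /dsw scaler_sumr; apply: eq_bigr => q _.
by rewrite act_1 mul1r -scalerAl mul1r (linZ (cr_linearl _)).
Qed.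

(** The factor f(h2,1) of the product is absorbed by [fc_unit], so only the action remains. *)
Lemma cr_mul_iA b h a : cr b h ** iA a = dsw (fun h1 h2 => cr (b * act h1 a) h2) h.
Proof.
have bF c : is_bilinear (fun a' h' => cr (c * a') h').
  split=> ?; first exact: cr_linearr.
  by apply: (linear_comp (cr_linearl _)); apply: linear_mull; apply: linear_id.
rewrite mulE_cr crmul_r1; apply: eq_bigr => p _.
transitivity (tsum (fun a' h' => cr ((b * act p.1 a) * a') h') (jH p.2)); last first.
  by rewrite (tsum_tens (bF _)) mulr1.
rewrite -fc_unit /dsw (lin_sum (tsum_linear (bF _))); apply: eq_bigr => q _.
by rewrite (tsum_tens (bF _)).
Qed.

Lemma jH_mul_iA h a : jH h ** iA a = dsw (fun h1 h2 => cr (act h1 a) h2) h.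
Proof. by rewrite cr_mul_iA; apply: eq_bigr => p _; rewrite mul1r. Qed.

(** Here 1^(h1) is a counit and absorbs the first leg of h, so only the cocycle remains. *)
Lemma cr_mul_jH a h l : cr a h ** jH l =
  dsw (fun h1 h2 => dsw (fun l1 l2 => cr (a * fc h1 l1) (h2 * l2)) l) h.
Proof.
rewrite mulE_cr -[RHS](@dsw_counitl _ (dsw _)); last first.
  apply: dsw_linear; split=> ?; apply: linear_big => p.
    by apply: (linear_comp (cr_linearr _)); apply: linear_mulr; apply: linear_id.
  apply: (linear_comp (cr_linearl _)); apply: linear_mull; exact: fc_linearl.
apply: eq_bigr => p _; rewrite /dsw scaler_sumr; apply: eq_bigr => q _.
rewrite scaler_sumr; apply: eq_bigr => t _.
by rewrite act_1 mulr_algr -scalerAl (linZ (cr_linearl _)).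
Qed.

Lemma lext_lmul (W : lmodType k) (F : A -> H -> W) a x : is_bilinear F ->
  tsum F (iA a ** x) = tsum (fun b h => F (a * b) h) x.
Proof.
move=> bF; move: x; apply: E_ext.
- exact: (linear_comp (tsum_linear bF) (mulE_linearr _)).
- apply: tsum_linear; split=> ?; first exact: bF.1.
  by apply: (linear_comp (bF.2 _)); apply: linear_mull; apply: linear_id.
move=> b h; rewrite iA_mul_cr !tsum_tens //.
split=> ?; first exact: bF.1.
by apply: (linear_comp (bF.2 _)); apply: linear_mull; apply: linear_id.
Qed.

(** * Balanced tensors over A *)

Implicit Types V W : lmodType k.

(* The normal forms (a', h_1 ... h_s) of e_1 (x)_A ... (x)_A e_s a, when E (x)_A M is
   identified with H (x) M for every left A-module M. *)
Fixpoint nrm (es : seq E) (a : A) : seq (A * seq H) :=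
  if es is e :: es' then
    [seq (u.1, u.2 :: p.2) | p <- nrm es' a, u <- texpr (e ** iA p.1)]
  else [:: (a, [::])].

Definition N (es : seq E) (a : A) (W : lmodType k) (G : A -> seq H -> W) : W :=
  \sum_(p <- nrm es a) G p.1 p.2.

Lemma N_nil a W (G : A -> seq H -> W) : N [::] a G = G a [::].
Proof. exact: big_seq1. Qed.
Lemma N_cons e es a W (G : A -> seq H -> W) : N (e :: es) a G =
  N es a (fun a' hs => tsum (fun b h => G b (h :: hs)) (e ** iA a')).
Proof. by rewrite /N /= big_allpairs_dep. Qed.

Lemma size_nrm es a p : p \in nrm es a -> size p.2 = size es.
Proof.
elim: es p => [|e es IH] p /=; first by rewrite inE => /eqP->.
by case/allpairsPdep=> q [u [/IH q_es _ ->]] /=; rewrite q_es.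
Qed.

Lemma eq_N es a W (G G' : A -> seq H -> W) :
  (forall b hs, size hs = size es -> G b hs = G' b hs) -> N es a G = N es a G'.
Proof. by move=> GG'; apply: eq_big_seq => p /size_nrm; apply: GG'. Qed.

Lemma N_eq0 es a W (G : A -> seq H -> W) :
  (forall b hs, size hs = size es -> G b hs = 0) -> N es a G = 0.
Proof. by move=> G0; apply: big1_seq => p /andP[_ /size_nrm]; apply: G0. Qed.

Lemma lin_N es a V W (u : V -> W) (G : A -> seq H -> V) :
  linear u -> u (N es a G) = N es a (fun b hs => u (G b hs)).
Proof. by move=> lu; rewrite /N (lin_sum lu). Qed.

Lemma linear_N_fun es a V W (G : V -> A -> seq H -> W) :
  (forall b hs, linear (fun v => G v b hs)) -> linear (fun v => N es a (G v)).
Proof. by move=> lG; apply: linear_big => p; apply: lG. Qed.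

Record Nmul W (G : A -> seq H -> W) : Prop := {
  Nmul_l : forall hs, linear (G^~ hs);
  Nmul_r : forall a, mulin (G a) }.

Lemma Nmul_bil W (G : A -> seq H -> W) hs : Nmul G ->
  is_bilinear (fun b h => G b (h :: hs)).
Proof. by move=> mG; split=> ?; [apply: mulin_head; apply: Nmul_r | apply: Nmul_l]. Qed.

Lemma Nmul_step W (G : A -> seq H -> W) e : Nmul G ->
  Nmul (fun a' hs => tsum (fun b h => G b (h :: hs)) (e ** iA a')).
Proof.
move=> mG; split=> [hs|a l1 l2].
  apply: (linear_comp (tsum_linear (Nmul_bil hs mG))).
  exact: (linear_comp (mulE_linearr _) iA_linear).
by apply: linear_tsum_fun => b h; apply: (mulin_cons h (Nmul_r mG b)).
Qed.

Lemma N_linear es W (G : A -> seq H -> W) : Nmul G -> linear (fun a => N es a G).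
Proof.
elim: es G => [|e es IH] G mG.
  by apply: (linear_eq (u := G^~ [::])) (Nmul_l mG _) => a; rewrite N_nil.
apply: linear_eq (IH _ (Nmul_step e mG)) => a; exact: N_cons.
Qed.

Lemma N_mulin a W (G : A -> seq H -> W) : Nmul G -> mulin (fun es => N es a G).
Proof.
move=> mG l1 l2; elim: l1 G mG => [|e l1 IH] G mG /=.
  apply: (linear_eq (fun m => N_cons m l2 a G)); apply: linear_N_fun => b hs.
  exact: (linear_comp (tsum_linear (Nmul_bil hs mG)) (mulE_linearl _)).
exact: (linear_eq (fun m => N_cons e (l1 ++ m :: l2) a G) (IH _ (Nmul_step e mG))).
Qed.

(** A unit entry turns the incoming a' into a'#1, so it produces the entry 1 of H in the same
    place. *)
Lemma N_normd n a W (G : A -> seq H -> W) : Nmul G ->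
  (forall b, normd n 1 (G b)) -> normd n oneE (fun es => N es a G).
Proof.
move=> mG nG l1 l2 le_n; elim: l1 G mG nG => [|e l1 IH] G mG nG /=.
  rewrite N_cons; apply: N_eq0 => b hs sz.
  rewrite mul1E (tsum_tens (Nmul_bil hs mG)).
  by apply: (nG b [::]); rewrite sz.
rewrite N_cons IH //; first exact: Nmul_step.
move=> b l l' le_n'; apply: big1 => p _.
exact: (nG p.1 (p.2 :: l)).
Qed.

Lemma N_jH hs W (G : A -> seq H -> W) : Nmul G -> N (map jH hs) 1 G = G 1 hs.
Proof.
elim: hs G => [|h hs IH] G mG /=; first exact: N_nil.
rewrite N_cons IH; last exact: Nmul_step.
by rewrite mulE1 (tsum_tens (Nmul_bil hs mG)).
Qed.

(** Origin of the iterated actions in [mu], [d0] and [bd]: pushing [a] to the left through the h_i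
    applies one Sweedler leg of each to it. The sums are exchanged because [nrm] enumerates the tail
    of the list first. *)
Lemma N_sws hs a W (G : A -> seq H -> W) : Nmul G ->
  N (map jH hs) a G = \sum_(p <- sws hH hs) G (acts act a p.1) p.2.
Proof.
elim: hs G => [|h hs IH] G mG /=; first by rewrite N_nil big_seq1.
rewrite N_cons IH; last exact: Nmul_step.
rewrite big_allpairs_dep exchange_big /=; apply: eq_bigr => q _.
rewrite jH_mul_iA (lin_sum (tsum_linear (Nmul_bil q.2 mG))); apply: eq_bigr => p _.
by rewrite (tsum_tens (Nmul_bil q.2 mG)).
Qed.

(** Once the normal form of what follows e is a sum of c#h, both sides hand e a c on to the left. So
    the normal form depends only on the tensor over A. *)
Lemma N_balanced l1 l2 e e' a b W (G : A -> seq H -> W) : Nmul G ->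
  N (l1 ++ (e ** iA a) :: e' :: l2) b G = N (l1 ++ e :: (iA a ** e') :: l2) b G.
Proof.
move=> mG; elim: l1 G mG => [|x l1 IH] G mG /=.
  rewrite !N_cons; apply: eq_bigr => p _.
  rewrite -mulEA lext_lmul; last first.
    split=> ?.
      by apply: linear_tsum_fun => *; apply: (mulin_head _ (mulin_cons _ (Nmul_r mG
        _))).
    apply: (linear_comp (tsum_linear (Nmul_bil _ mG))).
    exact: (linear_comp (mulE_linearr _) iA_linear).
  by apply: eq_tsum => c h; rewrite -mulEA iAM.
by rewrite !N_cons IH //; apply: Nmul_step.
Qed.

Definition balanced W (Q : seq E -> W) := forall l1 l2 e e' a,
  Q (l1 ++ (e ** iA a) :: e' :: l2) = Q (l1 ++ e :: (iA a ** e') :: l2).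

Lemma balanced_cons W (Q : seq E -> W) e : balanced Q -> balanced (fun l => Q (e :: l)).
Proof. by move=> bQ l1 l2; apply: (bQ (e :: l1)). Qed.

(** A balanced function allows every A-component to be moved left inside its argument, so it is
    determined by its values on normal forms. This carries formulas checked on entries 1#h over to
    all entries of E. *)
Lemma N_balanced_eval W (Q : seq E -> W) e es : mulin Q -> balanced Q ->
  N es 1 (fun a hs => Q (e ** iA a :: map jH hs)) = Q (e :: es).
Proof.
elim: es Q e => [|e' es IH] Q e mQ bQ; first by rewrite N_nil mulE1.
rewrite -(IH _ e' (mulin_cons e mQ) (balanced_cons e bQ)) N_cons.
apply: eq_bigr => p _.
have bF : is_bilinear (fun b h => Q (e ** iA b :: jH h :: map jH p.2)).
  split=> ?; first exact: (linear_comp (mulin_head _ (mulin_cons _ mQ)) jH_linear).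
  apply: (linear_comp (mulin_head _ mQ)).
  exact: (linear_comp (mulE_linearr _) iA_linear).
have lQ := mulin_head (map jH p.2) (mulin_cons e mQ).
move: (e' ** iA p.1); apply: (E_ext _ lQ); first exact: tsum_linear.
by move=> b h; rewrite (tsum_tens bF) (bQ [::]) iA_jH.
Qed.

(* e_0 (x)_A e_1 (x)_A ... (x)_A e_(s+1), under Y_s = E (x)_A (E/A)^s (x)_A E. *)
Definition Theta s (l : seq E) : Y A H s :=
  if l is e :: es then N es 1 (fun a hs => Yt s (e ** iA a) hs) else 0.

Arguments Theta : simpl never.

Lemma Yt_mul s : Gmul 1 (@Yt k A H s). Proof. exact: Gt_mul. Qed.

Lemma Yt_Nmul s e : Nmul (fun a hs => Yt s (e ** iA a) hs).
Proof.
split=> *; last exact: (Gmul_r (Yt_mul s)).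
apply: (linear_comp (Gmul_l (Yt_mul s) _)).
exact: (linear_comp (mulE_linearr _) iA_linear).
Qed.

Lemma Theta_mulin s : mulin (Theta s).
Proof.
rewrite /Theta => -[|e l1] l2 /=; last exact: N_mulin (Yt_Nmul s e) _ _.
apply: linear_N_fun => a hs.
exact: (linear_comp (Gmul_l (Yt_mul s) _) (mulE_linearl _)).
Qed.

Lemma Theta_normd s e : normd 1 oneE (fun l => Theta s (e :: l)).
Proof.
by apply: N_normd (Yt_Nmul s e) _ => b; apply: (Gmul_1 (Yt_mul s)).
Qed.

Lemma Theta_balanced s : balanced (Theta s).
Proof.
rewrite /Theta => -[|x l1] l2 e e' a /=; last exact: N_balanced (Yt_Nmul s x).
rewrite !N_cons; apply: eq_bigr => p _.
rewrite -mulEA lext_lmul; last exact: Nmul_bil (Yt_Nmul s e).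
by apply: eq_tsum => c h; rewrite -mulEA iAM.
Qed.

Lemma Theta_jH s e hs : Theta s (e :: map jH hs) = Yt s e hs.
Proof. by rewrite /Theta N_jH ?mulE1 //; apply: Yt_Nmul. Qed.

Lemma Theta_size s l : size l != s.+2 -> Theta s l = 0.
Proof.
rewrite /Theta; case: l => [|e es] //= sz; apply: N_eq0 => b hs szh.
by apply: Gt_size; rewrite szh.
Qed.

Lemma lin_Theta s W (u : Y A H s -> W) e es : linear u ->
  u (Theta s (e :: es)) = N es 1 (fun a hs => u (Yt s (e ** iA a) hs)).
Proof. exact: lin_N. Qed.

(** * The column Y *)

Local Notation mulE := (mulE hH act f).
Local Notation bd := (@bd k A H hH act f).
Local Notation sigmam1 := (@sigmam1 k A H).

Lemma mulE_bilinear : is_bilinear mulE.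
Proof. by split=> ?; [apply: mulE_linearr | apply: mulE_linearl]. Qed.

(** A merge at the seam is balanced by associativity of E; any other merge leaves the seam
    intact. *)
Lemma altl_balanced W (G : seq E -> W) : balanced G -> balanced (altl mulE G).
Proof.
move=> bG l1 l2 e e' a; elim: l1 G bG => [|x [|y l1] IH] G bG /=.
- congr (_ - _); first by rewrite mulEA.
  case: l2 => //= z l2; congr (_ - _); first by rewrite (bG [::]) mulEA.
  by apply: eq_alt => t _; apply: (bG [::]).
- congr (_ - _); first by rewrite mulEA (bG [::]).
  exact: (IH _ (balanced_cons x bG)).
congr (_ - _); first exact: (bG (_ :: _)).
exact: (IH _ (balanced_cons x bG)).
Qed.

Lemma N_cat es1 es2 a W (G : A -> seq H -> W) : N (es1 ++ es2) a G =
  N es2 a (fun b hs2 => N es1 b (fun c hs1 => G c (hs1 ++ hs2))).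
Proof.
elim: es1 G => [|e es1 IH] G /=; first by apply: eq_bigr => p _; rewrite N_nil.
by rewrite N_cons IH; apply: eq_bigr => p _; rewrite N_cons.
Qed.

Lemma size_sws hs p : p \in sws hH hs -> size p.2 = size hs.
Proof.
elim: hs p => [|h hs IH] p /=; first by rewrite inE => /eqP->.
by case/allpairsPdep=> q [u [_ /IH sz ->]] /=; rewrite sz.
Qed.

Lemma N_sws_head hs b a0 h0 W (K : E -> seq H -> W) :
    (forall l, linear (K^~ l)) -> (forall e, mulin (K e)) ->
  N (map jH hs) b (fun a l => K (cr a0 h0 ** iA a) l) =
  \sum_(p <- sws hH (h0 :: hs)) K (cr (a0 * acts act b p.1) p.2`_0) (behead p.2).
Proof.
move=> lK mK; rewrite N_sws; last first.
  split=> [l|a]; last exact: mK.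
  apply: (linear_comp (lK l)); exact: (linear_comp (mulE_linearr _) iA_linear).
rewrite /= big_allpairs_dep exchange_big /=; apply: eq_bigr => q _.
by rewrite cr_mul_iA (lin_sum (lK _)).
Qed.

Lemma Y_el_Yt s a hs : size hs = s.+2 -> Y_el s a hs = Yt s (cr a hs`_0) (behead hs).
Proof. by case: hs => //= h hs [sz]; rewrite /Y_el /Yt /Gt sz eqxx. Qed.

(** Entries after b#h are already normal, so only b travels, past [hs1] and then [h0]. Both the
    formula of [mu] and the terms of [bd] are instances. *)
Lemma Theta_sws s a0 h0 hs1 b h hs2 : (size hs1 + size hs2)%N = s ->
  Theta s (cr a0 h0 :: map jH hs1 ++ cr b h :: map jH hs2) =
  \sum_(p <- sws hH (h0 :: hs1)) Y_el s (a0 * acts act b p.1) (p.2 ++ h :: hs2).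
Proof.
move=> sz; have mT := Yt_Nmul s (cr a0 h0).
rewrite /Theta N_cat N_cons (N_jH hs2); last first.
  have mN : Nmul (fun b hs2 => N (map jH hs1) b (fun c hs1 => Yt s (cr a0 h0 ** iA c)
    (hs1 ++ hs2))).
    split=> [l|c l1 l2].
      apply: N_linear; split=> [?|? l1' l2']; first exact: (Nmul_l mT).
      apply: (linear_eq _ (Nmul_r mT _ l1' (l2' ++ l))) => m.
      by rewrite -catA.
    apply: linear_N_fun => d l'.
    apply: (linear_eq _ (Nmul_r mT d (l' ++ l1) l2)) => m.
    by rewrite catA.
  exact: Nmul_step mN.
rewrite mulE1 tsum_tens; last first.
  split=> [c|h'].
    apply: linear_N_fun => d l; exact: (Nmul_r mT d l hs2).
  apply: N_linear; split=> [?|? l1' l2']; first exact: (Nmul_l mT).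
  apply: (linear_eq _ (Nmul_r mT _ l1' (l2' ++ h' :: hs2))) => m.
  by rewrite -catA.
rewrite (@N_sws_head hs1 b a0 h0 _ (fun e l => Yt s e (l ++ h :: hs2))).
- apply: eq_big_seq => p /size_sws szp.
  rewrite Y_el_Yt; last by rewrite size_cat szp /= addnS addSn sz.
  by case: p szp => q [|h' l].
- by move=> l; apply: (Gmul_l (Yt_mul s)).
move=> e l1 l2; apply: (linear_eq _ (Gmul_r (Yt_mul s) e l1 (l2 ++ h :: hs2))) => m.
by rewrite -catA.
Qed.

Lemma merge_cat (T : Type) i (l : seq T) x y (op : T -> T -> T) l1 l2 x0 :
    size l1 = i -> l = l1 ++ x :: y :: l2 ->
  take i l ++ op (nth x0 l i) (nth x0 l i.+1) :: drop i.+2 l = l1 ++ op x y :: l2.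
Proof.
move=> <- ->; rewrite take_size_cat // !nth_cat ltnn subnn ltnNge leqnSn /= subSnn /=.
by rewrite drop_cat ltnNge -addn2 leq_addr /= addKn /= drop0.
Qed.

Lemma split2 (T : Type) i (l : seq T) : (i.+1 < size l)%N ->
  exists l1 x y l2, size l1 = i /\ l = l1 ++ x :: y :: l2.
Proof.
move=> lt_i; exists (take i l).
have : (1 < size (drop i l))%N by rewrite size_drop ltn_subRL addn1.
case: (drop i l) (cat_take_drop i l) => [|x [|y l2]] //= E _.
exists x, y, l2; split=> //; rewrite size_takel //.
exact: ltnW (ltnW lt_i).
Qed.

Lemma Theta_altl_mul s : Gmul 1 (fun e hs => - alt mulE (Theta s) e (map jH hs)).
Proof.
have mG := altl_mulin mulE_bilinear (@Theta_mulin s).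
split=> [hs|e|e].
- exact: linear_opp (mG [::] (map jH hs)).
- move=> l1 l2; apply: linear_opp.
  exact: (mulin_map (F := altl mulE (Theta s) \o cons e) jH_linear (mulin_cons e mG)).
move=> l1 l2 l2P; rewrite map_cat /= (@alt_unit _ _ _ oneE) ?oppr0 ?size_map //.
- exact: mul1E.
- exact: mulE1.
by move=> e' l l' l'P; apply: Theta_normd.
Qed.

(** The product of 1#h_i and 1#h_(i+1) has the cocycle as its A-component; normalizing moves it to
    the far left, which is exactly the i-th term of [bd]. *)
Lemma bd_spec s : linear (@bd s.+1 s) /\
  forall e hs, bd s (Yt s.+1 e hs) = - alt mulE (Theta s) e (map jH hs).
Proof.
apply: Y_linext; first exact: Theta_altl_mul.
  move=> e hs sz; rewrite alt_eq0 ?oppr0 // => t szt _; apply: Theta_size.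
  by rewrite szt size_map.
move=> a0 h0 hs sh /=; rewrite (alt_sum _ _ 0) size_map -sumrN.
have szh : size hs = s.+2 by case/eqP: (sh).
rewrite szh; apply: eq_bigr => -[i /= lti] _.
rewrite exprS mulN1r !scaleNr; congr (- (_ *: _)).
have [|l1 [x [y [l2 [sz1 E]]]]] := @split2 _ i (h0 :: hs); first by rewrite /= szh ltnS.
have e1 : take i (h0 :: hs) = l1 by rewrite E take_size_cat.
have e2 : (h0 :: hs)`_i = x by rewrite E nth_cat sz1 ltnn subnn.
have e3 : hs`_i = y.
  by rewrite -[LHS]/((h0 :: hs)`_i.+1) E nth_cat sz1 ltnNge leqnSn /= subSnn.
have e4 : drop i.+1 hs = l2.
  by rewrite -[LHS]/(drop i.+2 (h0 :: hs)) E drop_cat sz1 ltnNge -addn2 -sz1 leq_addr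
    /= addKn /= drop0.
rewrite e1 e2 e3 e4.
(* For i = 0 the cocycle already stands next to a_0 and nothing has to be moved; for i > 0
   [Theta_sws] moves it. *)
case: l1 sz1 E {e1 e2 e3 e4} => [|h1 l1] /= sz1 [Eh E].
  rewrite -sz1 big_seq1 /= E /= drop0 -Eh cr_mul_jH.
  rewrite /dsw (lin_sum (mulin_head _ (@Theta_mulin s))).
  apply: eq_bigr => p _; rewrite (lin_sum (mulin_head _ (@Theta_mulin s))).
  apply: eq_bigr => q _; rewrite Theta_jH Y_el_Yt //=.
  by move: szh; rewrite E /= => -[->].
have El : cr a0 h0 :: map jH hs = (cr a0 h0 :: map jH l1) ++ jH x :: jH y :: map jH l2.
  by rewrite E map_cat.
have szl : size (cr a0 h0 :: map jH l1) = i by rewrite /= size_map.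
have := @merge_cat _ i _ _ _ mulE _ _ 0 szl El; rewrite [drop _ _]/= => ->.
have lT := @Theta_mulin s (cr a0 h0 :: map jH l1) (map jH l2).
rewrite /jH -/(jH y) cr_mul_jH /dsw (lin_sum lT) exchange_big /=; apply: eq_bigr => p _.
rewrite (lin_sum lT) exchange_big /=; apply: eq_bigr => q _.
rewrite Theta_sws ?mul1r -?Eh //.
by move: szh; rewrite E size_cat /= !addnS => -[].
Qed.

Lemma bd_linear s : linear (@bd s.+1 s). Proof. by case: (bd_spec s). Qed.

(** Both sides are balanced, so the case of entries 1#h extends to arbitrary entries of E. *)
Lemma bd_Theta s e es : bd s (Theta s.+1 (e :: es)) = - alt mulE (Theta s) e es.
Proof.
rewrite (lin_Theta _ _ (@bd_linear s)).
have mG := altl_mulin mulE_bilinear (@Theta_mulin s).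
rewrite -[alt _ _ _ _]/(altl mulE (Theta s) (e :: es)).
rewrite -(N_balanced_eval _ _ mG (altl_balanced (@Theta_balanced s))).
rewrite (lin_N _ _ _ (linear_opp (@linear_id _ _))).
by apply: eq_N => b hs _; rewrite (bd_spec s).2.
Qed.

Lemma Y_lact_ex s e : exists u : Y A H s -> Y A H s, linear u /\
  forall x hs, u (Yt s x hs) = Yt s (e ** x) hs.
Proof.
have [|u lu uE] := @Gt_lift k E H 1 s _ (fun x hs => Yt s (e ** x) hs).
  split=> *; [|exact: (Gmul_r (Yt_mul s))|exact: (Gmul_1 (Yt_mul s))].
  exact: (linear_comp (Gmul_l (Yt_mul s) _) (mulE_linearr _)).
exists u; split=> // x hs.
have [sz|sz] := eqVneq (size hs) s.+1; first exact: uE.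
by rewrite /Yt !Gt_size // (lin0 lu).
Qed.

Definition Y_lact s e : Y A H s -> Y A H s := projT1 (cid (Y_lact_ex s e)).
Lemma Y_lact_linear s e : linear (@Y_lact s e).
Proof. by rewrite /Y_lact; case: cid => ? []. Qed.
Lemma Y_lactE s e x hs : Y_lact e (Yt s x hs) = Yt s (e ** x) hs.
Proof. by rewrite /Y_lact; case: cid => ? [] /=. Qed.

Lemma Y_lact_Theta s e x es : Y_lact e (Theta s (x :: es)) = Theta s (e ** x :: es).
Proof.
rewrite lin_Theta; last exact: Y_lact_linear.
by apply: eq_N => b hs _; rewrite Y_lactE mulEA.
Qed.

Lemma Theta_last_mulin s e :
  mulin (onlast (fun l z => Theta s (rcons l (z ** e)))).
Proof.
apply: onlast_mulin => [z l1 l2|l].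
  apply: (linear_eq _ (@Theta_mulin s l1 (rcons l2 (z ** e)))) => m.
  by rewrite rcons_cat rcons_cons.
have lr : linear (fun z => Theta s (rcons l z)).
  by apply: (linear_eq _ (@Theta_mulin s l [::])) => m; rewrite cats1.
exact: (linear_comp lr (mulE_linearl e)).
Qed.

Lemma Theta_last_balanced s e :
  balanced (onlast (fun l z => Theta s (rcons l (z ** e)))).
Proof.
move=> l1 l2 e1 e2 a; case/lastP: l2 => [|l2 z].
  have E x y : l1 ++ [:: x; y] = rcons (rcons l1 x) y by rewrite -!cats1 -catA.
  by rewrite !E !onlast_rcons -!E Theta_balanced mulEA.
have E x y : l1 ++ x :: y :: rcons l2 z = rcons (l1 ++ x :: y :: l2) z.
  by rewrite rcons_cat !rcons_cons.
by rewrite !E !onlast_rcons !rcons_cat !rcons_cons Theta_balanced.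
Qed.

(** Over A the right action multiplies the last factor. The map is lifted from its values on normal
    forms; balancedness then gives it on all lists. *)
Lemma Y_ract_ex s e : exists u : Y A H s -> Y A H s, linear u /\
  forall l z, u (Theta s (rcons l z)) = Theta s (rcons l (z ** e)).
Proof.
pose Q := onlast (fun l z => Theta s (rcons l (z ** e))).
have mQ : mulin Q by apply: Theta_last_mulin.
have [|u lu uE] := @Gt_lift k E H 1 s _ (fun x hs => Q (x :: map jH hs)).
  split=> [hs|x|x]; first exact: (mQ [::]).
    exact: (mulin_map (F := Q \o cons x) jH_linear (mulin_cons x mQ)).
  move=> l1; case/lastP=> // l2 h _.
  have -> : x :: map jH (l1 ++ 1 :: rcons l2 h) =
      rcons (x :: map jH l1 ++ oneE :: map jH l2) (jH h).
    by rewrite map_cat /= map_rcons rcons_cat.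
  rewrite /Q onlast_rcons rcons_cons rcons_cat rcons_cons Theta_normd //.
  by rewrite size_rcons.
exists u; split=> // l z.
have [sz|sz] := eqVneq (size (rcons l z)) s.+2; last first.
  by rewrite !Theta_size ?(lin0 lu) // size_rcons; move: sz; rewrite size_rcons.
case: l sz => [|x l] //= sz.
rewrite lin_Theta // -rcons_cons -[RHS](onlast_rcons (fun l z => Theta s (rcons l (z **
  e)))).
rewrite rcons_cons -/Q -(N_balanced_eval _ _ mQ (@Theta_last_balanced s e)).
by apply: eq_N => b hs szh; apply: uE; rewrite szh; case: sz.
Qed.

Definition Y_ract s e : Y A H s -> Y A H s := projT1 (cid (Y_ract_ex s e)).
Lemma Y_ract_linear s e : linear (@Y_ract s e).
Proof. by rewrite /Y_ract; case: cid => ? []. Qed.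
Lemma Y_ract_Theta s e l z :
  Y_ract e (Theta s (rcons l z)) = Theta s (rcons l (z ** e)).
Proof. by rewrite /Y_ract; case: cid => ? [] /=. Qed.

Lemma Y_ext s W (u v : Y A H s -> W) : linear u -> linear v ->
    (forall e hs, size hs = s.+1 -> u (Yt s e hs) = v (Yt s e hs)) ->
  u =1 v.
Proof. exact: Gt_ext. Qed.

Lemma bd_lact s e (y : Y A H s.+1) : bd s (Y_lact e y) = Y_lact e (bd s y).
Proof.
move: y; apply: Y_ext => [||x hs _].
- exact: (linear_comp (@bd_linear s) (@Y_lact_linear _ e)).
- exact: (linear_comp (@Y_lact_linear _ e) (@bd_linear s)).
rewrite Y_lactE !(bd_spec s).2 (linN (@Y_lact_linear _ e)).
rewrite (lin_alt _ _ _ _ (@Y_lact_linear _ e)); congr (- _).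
apply/esym/alt_lmul; first by move=> *; apply: mulEA.
by move=> y t; apply: Y_lact_Theta.
Qed.

Lemma bd_ract s e (y : Y A H s.+1) : bd s (Y_ract e y) = Y_ract e (bd s y).
Proof.
move: y; apply: Y_ext => [||x hs].
- exact: (linear_comp (@bd_linear s) (@Y_ract_linear _ e)).
- exact: (linear_comp (@Y_ract_linear _ e) (@bd_linear s)).
case/lastP: hs => // hs h _.
rewrite -Theta_jH map_rcons -rcons_cons Y_ract_Theta rcons_cons !bd_Theta.
rewrite (linN (@Y_ract_linear _ e)) (lin_alt _ _ _ _ (@Y_ract_linear _ e)).
congr (- _); apply/esym/alt_rcons_mul; first by move=> *; apply: mulEA.
exact: Y_ract_Theta.
Qed.

Lemma sigmam1_spec s : linear (@sigmam1 s) /\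
  forall e hs, sigmam1 (Yt s e hs) = (-1) ^+ s *: Yt s.+1 e (rcons hs 1).
Proof.
apply: Y_linext => [|e hs sz|a0 h0 hs sh] /=.
- apply: (Gmul_comp (linear_scale _ (@linear_id _ _))); split=> [hs|e|e l1 l2 l2P].
  + exact: (Gmul_l (Yt_mul s.+1)).
  + move=> l1 l2; apply: (linear_eq _ (Gmul_r (Yt_mul s.+1) e l1 (rcons l2 1))).
    by move=> m; rewrite rcons_cat.
  by rewrite rcons_cat rcons_cons (Gmul_1 (Yt_mul s.+1)) // size_rcons.
- by rewrite /Yt Gt_size ?scaler0 // size_rcons.
by rewrite Y_el_Yt //= size_rcons; case/eqP: sh => ->.
Qed.

Lemma sigmam1_linear s : linear (@sigmam1 s). Proof. by case: (sigmam1_spec s). Qed.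

Lemma sigmam1_Theta s l : sigmam1 (Theta s l) = (-1) ^+ s *: Theta s.+1 (rcons l oneE).
Proof.
case: l => [|e es].
  by rewrite (lin0 (@sigmam1_linear s)) Theta_size ?scaler0.
rewrite lin_Theta; last exact: sigmam1_linear.
have lZ : linear (fun y : Y A H s.+1 => (-1) ^+ s *: y) by exact: (linear_scale _
  (@linear_id _ _)).
rewrite rcons_cons /Theta -cats1 N_cat N_cons N_nil mulE1 tsum_tens; last first.
  split=> [c|h].
    apply: linear_N_fun => b l; exact: (Nmul_r (Yt_Nmul s.+1 e) b l [::]).
  apply: N_linear; split=> [l|b l1 l2]; first exact: (Nmul_l (Yt_Nmul s.+1 e)).
  apply: (linear_eq _ (Nmul_r (Yt_Nmul s.+1 e) b l1 (l2 ++ [:: h]))) => m.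
  by rewrite -catA.
rewrite (lin_N _ _ _ lZ); apply: eq_N => b hs _.
by rewrite (sigmam1_spec s).2 cats1.
Qed.

(** Appending 1 commutes with every merge up to sign, except the merge with the appended 1, which
    returns y. *)
Lemma bd_sigmam1 s (y : Y A H s.+1) :
  bd s.+1 (sigmam1 y) + sigmam1 (bd s y) = y.
Proof.
move: y; apply: Y_ext => [||e hs sz].
- apply: linear_add.
    exact: (linear_comp (@bd_linear s.+1) (@sigmam1_linear _)).
  exact: (linear_comp (@sigmam1_linear _) (@bd_linear s)).
- exact: linear_id.
rewrite -Theta_jH sigmam1_Theta (linZ (@bd_linear _)) rcons_cons !bd_Theta.
rewrite alt_rcons_unit; last exact: mulE1.
rewrite (linN (@sigmam1_linear _)) (lin_alt _ _ _ _ (@sigmam1_linear s)).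
have -> : alt mulE (fun t => sigmam1 (Theta s t)) e (map jH hs) =
    alt mulE (fun t => (-1) ^+ s *: Theta s.+1 (rcons t oneE)) e (map jH hs).
  by apply: eq_alt => t _; rewrite sigmam1_Theta.
rewrite -(lin_alt _ _ _ _ (linear_scale _ (@linear_id _ _))).
have -> : (-1) ^+ size (map jH hs) = (-1) ^+ s :> k.
  by rewrite size_map sz !exprS !mulN1r opprK.
rewrite exprS mulN1r scaleNr scalerN opprK scalerDr scalerA -expr2 sqrr_sign scale1r.
by rewrite addrAC subrr add0r.
Qed.

Lemma bd_sigmam1_0 e z : Theta 0 [:: e; z] - bd 0 (sigmam1 (Theta 0 [:: e; z])) =
  Theta 0 [:: e ** z; oneE].
Proof.
by rewrite sigmam1_Theta scale1r bd_Theta /= mulE1 subr0 opprK addrC subrK.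
Qed.

(** The augmentation Y_0 -> E followed by sigma^(-1)_0, sending e (x) z to ez (x) 1; written as 1 -
    ∂ sigma^(-1), it needs no separate module E in degree -1. *)
Definition Y0_aug (y : Y A H 0) := y - bd 0 (sigmam1 y).

Lemma Y0_aug_linear : linear Y0_aug.
Proof.
apply: linear_sub; first exact: linear_id.
exact: (linear_comp (@bd_linear 0) (@sigmam1_linear 0)).
Qed.

Lemma Y0_aug_bd (y : Y A H 1) : Y0_aug (bd 0 y) = 0.
Proof.
move: y; apply: Y_ext => [||e hs sz].
- exact: (linear_comp Y0_aug_linear (@bd_linear 0)).
- exact: linear_zero.
case: hs sz => [|h [|h' []]] // _.
rewrite -Theta_jH bd_Theta /= subr0 opprB (linB Y0_aug_linear) /Y0_aug.
by rewrite !bd_sigmam1_0 mulEA subrr.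
Qed.

(* Every element of Y_(s+1) is a sum of elements sigmam1 y . e, and bd is right linear. *)
Lemma bd_bd s (y : Y A H s.+2) : bd s (bd s.+1 y) = 0.
Proof.
have lbb t : linear (fun y => @bd t.+1 t (@bd t.+2 t.+1 y)).
  exact: (linear_comp (@bd_linear t) (@bd_linear t.+1)).
suff gen t : (forall y : Y A H t.+1, bd t (bd t.+1 (sigmam1 y)) = 0) ->
    forall y : Y A H t.+2, bd t (bd t.+1 y) = 0.
  (* Replacing ∂ sigma by 1 - sigma ∂, the base becomes (1 - ∂ sigma) ∂ y, killed by the
     augmentation, and the step becomes sigma ∂ ∂ y, zero by induction. *)
  elim: s y => [|s IH] y; apply: gen => {}y.
    by rewrite -[bd 1 _](addrK (sigmam1 (bd 0 y))) (bd_sigmam1 y) (linB (@bd_linear 0))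
      -/(Y0_aug _) Y0_aug_bd.
  rewrite -[bd _ (sigmam1 y)](addrK (sigmam1 (bd s.+1 y))) (bd_sigmam1 y).
  rewrite (linB (@bd_linear _)) -[X in X - _](bd_sigmam1 (bd s.+1 y)).
  by rewrite addrAC subrr add0r IH (lin0 (@sigmam1_linear _)).
move=> bbs {y}; apply: Y_ext => [||e hs]; [exact: lbb|exact: linear_zero|].
case/lastP: hs => // hs h _.
have -> : Yt t.+2 e (rcons hs h) =
    Y_ract (jH h) (sigmam1 ((-1) ^+ t.+1 *: Yt t.+1 e hs)).
  rewrite (linZ (@sigmam1_linear _)) (sigmam1_spec _).2 scalerA -expr2 sqrr_sign
    scale1r.
  by rewrite -!Theta_jH !map_rcons -!rcons_cons Y_ract_Theta mul1E.
by rewrite !bd_ract bbs (lin0 (@Y_ract_linear _ _)).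
Qed.

(** * The rows of the double complex *)

Local Notation mu := (@mu k A H hH act).
Local Notation d0 := (@d0 k A H hH act).
Local Notation sigma0Y := (@sigma0Y k A H).
Local Notation sigma0 := (@sigma0 k A H).
Local Notation X_lact := (@X_lact k A H hH act f).
Local Notation X_ract := (@X_ract k A H hH act f).
Local Notation Xt := (@X_gt k A H).
Local Notation Xmul_t r s := (@Xt_mul k A H r s).

Lemma Xt_size r s e hs as_ z : (size hs == s) && (size as_ == r) = false ->
  Xt r s e hs as_ z = 0.
Proof. by rewrite /X_gt => ->. Qed.

Lemma X_lact_spec r s e : linear (@X_lact r s e) /\
  forall x hs as_ z, X_lact e (Xt r s x hs as_ z) = Xt r s (e ** x) hs as_ z.
Proof.
apply: X_linext => [|x hs as_ z|a0 h0 hs as_ a h sh sa] /=.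
- split=> *.
  + exact: (linear_comp (Xmul_l (Xmul_t r s) _ _ _) (mulE_linearr _)).
  + exact: (Xmul_H (Xmul_t r s)).
  + exact: (Xmul_H1 (Xmul_t r s)).
  + exact: (Xmul_A (Xmul_t r s)).
  + exact: (Xmul_A1 (Xmul_t r s)).
  exact: (Xmul_r (Xmul_t r s)).
- exact: Xt_size.
case/eqP: (sh) (sa) => <-; rewrite size_rcons => /eqP[<-].
rewrite /X_gt !eqxx /= nth_rcons ltnn eqxx /X_tens.
by rewrite map_rcons -cats1 tpow_el_cat ?size_map.
Qed.

Lemma X_ract_spec r s e : linear (fun x => @X_ract r s x e) /\
  forall x hs as_ z, X_ract (Xt r s x hs as_ z) e = Xt r s x hs as_ (z ** e).
Proof.
apply: X_linext => [|x hs as_ z|a0 h0 hs as_ a h sh sa] /=.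
- split=> *.
  + exact: (Xmul_l (Xmul_t r s)).
  + exact: (Xmul_H (Xmul_t r s)).
  + exact: (Xmul_H1 (Xmul_t r s)).
  + exact: (Xmul_A (Xmul_t r s)).
  + exact: (Xmul_A1 (Xmul_t r s)).
  exact: (linear_comp (Xmul_r (Xmul_t r s) _ _ _) (mulE_linearl _)).
- exact: Xt_size.
case/eqP: (sh) (sa) => <-; rewrite size_rcons => /eqP[<-].
rewrite /X_gt !eqxx /= nth_rcons ltnn eqxx /X_tens.
by rewrite map_rcons -cats1 tpow_el_cat ?size_map.
Qed.

Lemma X_el_Xt r s a h0 hs as_ b h : size hs = s -> size as_ = r ->
  X_el r s a (h0 :: hs) (rcons as_ b) h = Xt r s (cr a h0) hs as_ (cr b h).
Proof.
move=> <- <-; rewrite /X_gt !eqxx /= /X_el nth_rcons ltnn eqxx /X_tens.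
by rewrite map_rcons -cats1 tpow_el_cat ?size_map.
Qed.

Definition mu_fun s e hs (as_ : seq A) z : Y A H s :=
  if as_ is [::] then Theta s (e :: rcons (map jH hs) z) else 0.

(** Through [Theta], [mu] merely passes from tensors over k to tensors over A; its formula is the
    normalization of the right factor. *)
Lemma mu_spec s : linear (@mu 0 s) /\
  forall e hs as_ z, mu (Xt 0 s e hs as_ z) = mu_fun s e hs as_ z.
Proof.
apply: X_linext => [|e hs as_ z|a0 h0 hs as_ a h sh sa].
- split.
  + move=> hs [|a as_] z /=; last exact: linear_zero.
    exact: mulin_head (@Theta_mulin s).
  + move=> e [|a as_] z /= l1 l2; last exact: linear_zero.
    apply: (linear_eq _ (linear_comp (@Theta_mulin s (e :: map jH l1) (rcons (map jH
      l2) z)) jH_linear)).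
    by move=> m; rewrite map_cat rcons_cat.
  + move=> e [|a as_] z //= l1 l2 _.
    by rewrite map_cat rcons_cat rcons_cons Theta_normd // size_rcons.
  + by move=> e hs z [|a l1] l2 /=; apply: linear_zero.
  + by move=> e hs z [|a l1] l2.
  move=> e hs [|a as_] /=; last exact: linear_zero.
  apply: (linear_eq _ (@Theta_mulin s (e :: map jH hs) [::])) => m.
  by rewrite /= cats1.
- case: as_ => [|a as_] //= szh; apply: Theta_size.
  by rewrite /= size_rcons size_map !eqSS; rewrite andbT in szh; rewrite szh.
case: as_ sa => [|a' as_] sa; last by move: (sa); rewrite /= size_rcons.
rewrite /mu_fun /= -cats1.
have szh : size hs = s by case/eqP: (sh).
have /= -> := @Theta_sws s a0 h0 hs a h [::]; last by rewrite addn0.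
by apply: eq_bigr => p _; rewrite cats1.
Qed.

Lemma mu_linear s : linear (@mu 0 s). Proof. by case: (mu_spec s). Qed.

Lemma mu_Xt s e hs z : mu (Xt 0 s e hs [::] z) = Theta s (e :: rcons (map jH hs) z).
Proof. by rewrite (mu_spec s).2. Qed.

Lemma sigma0Y_spec s : linear (@sigma0Y s 0 s) /\
  forall e hs, sigma0Y 0 s (Yt s e hs) =
    onlast (fun l h => Xt 0 s e l [::] (jH h)) hs.
Proof.
apply: Y_linext => [|e hs sz|a0 h0 hs sh] /=.
- split.
  + case=> [|h hs] /=; [exact: linear_zero|exact: (Xmul_l (Xmul_t 0 s))].
  + move=> e; apply: onlast_mulin => [h|l]; first exact: (Xmul_H (Xmul_t 0 s)).
    exact: (linear_comp (Xmul_r (Xmul_t 0 s) _ _ _) jH_linear).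
  by move=> e; apply: onlast_normd => h; apply: (Xmul_H1 (Xmul_t 0 s)).
- case/lastP: hs sz => // hs h; rewrite size_rcons eqSS onlast_rcons => sz.
  by rewrite Xt_size // (negbTE sz).
case/lastP: hs sh => // hs h sh; rewrite onlast_rcons.
have szh : size hs = s by move: (sh); rewrite /= size_rcons => /eqP[].
have := @X_el_Xt 0 s a0 h0 hs [::] 1 h szh erefl => /= <-.
by rewrite -szh -cats1 take_size_cat // cats1 nth_rcons ltnn eqxx.
Qed.

Lemma sigma0Y_linear s : linear (@sigma0Y s 0 s). Proof. by case: (sigma0Y_spec s). Qed.

Lemma sigma0Y_Yt s e hs h :
  sigma0Y 0 s (Yt s e (rcons hs h)) = Xt 0 s e hs [::] (jH h).
Proof. by rewrite (sigma0Y_spec s).2 onlast_rcons. Qed.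

(** Splits the right factor a#h: [a] becomes a new entry of the list over A and 1#h stays on the
    right. *)
Definition sigma0_fun r s e hs as_ z : X A H r.+1 s :=
  (-1) ^+ r.+1 *: tsum (fun a h => Xt r.+1 s e hs (rcons as_ a) (jH h)) z.

Lemma sigma0_bil r s e hs as_ :
  is_bilinear (fun a h => Xt r.+1 s e hs (rcons as_ a) (jH h)).
Proof.
split=> ?.
  exact: (linear_comp (Xmul_r (Xmul_t r.+1 s) _ _ _) jH_linear).
apply: (linear_eq _ (Xmul_A (Xmul_t r.+1 s) e hs _ as_ [::])) => m.
by rewrite cats1.
Qed.

Lemma sigma0_spec r s : linear (@sigma0 r s r.+1 s) /\
  forall e hs as_ z, sigma0 r.+1 s (Xt r s e hs as_ z) = sigma0_fun r s e hs as_ z.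
Proof.
apply: X_linext => [|e hs as_ z sz|a0 h0 hs as_ a h sh sa].
- apply: (Xmul_comp (linear_scale _ (@linear_id _ _))); split.
  + move=> hs as_ z; apply: linear_tsum_fun => a h; exact: (Xmul_l (Xmul_t r.+1 s)).
  + move=> e as_ z l1 l2; apply: linear_tsum_fun => a h; exact: (Xmul_H (Xmul_t r.+1
    s)).
  + move=> e as_ z l1 l2 l2P; apply: big1 => p _; exact: (Xmul_H1 (Xmul_t r.+1 s)).
  + move=> e hs z l1 l2; apply: linear_tsum_fun => a h.
    apply: (linear_eq _ (Xmul_A (Xmul_t r.+1 s) e hs _ l1 (rcons l2 a))) => m.
    by rewrite rcons_cat.
  + move=> e hs z l1 l2 l2P; apply: big1 => p _.
    by rewrite rcons_cat rcons_cons (Xmul_A1 (Xmul_t r.+1 s)).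
  move=> e hs as_; exact: tsum_linear (sigma0_bil _ _ _ _ _).
- rewrite /sigma0_fun /tsum big1 ?scaler0 // => p _; rewrite Xt_size //.
  by rewrite size_rcons eqSS.
rewrite /sigma0_fun (tsum_tens (sigma0_bil _ _ _ _ _)) /= X_el_Xt //.
  by case/eqP: sh.
by apply/eqP.
Qed.

Lemma sigma0_linear r s : linear (@sigma0 r s r.+1 s). Proof. by case: (sigma0_spec r
  s). Qed.

Lemma sigma0_cr r s e hs as_ a h :
  sigma0 r.+1 s (Xt r s e hs as_ (cr a h)) =
  (-1) ^+ r.+1 *: Xt r.+1 s e hs (rcons as_ a) (jH h).
Proof. by rewrite (sigma0_spec r s).2 /sigma0_fun (tsum_tens (sigma0_bil _ _ _ _ _)).
  Qed.

Definition d0_tail r s e hs z : seq A -> X A H r s :=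
  onlast (fun t a => Xt r s e hs t (iA a ** z)).

Arguments d0_tail : simpl never.

(** The final 1 is a slot for the right factor: merging a_r into it makes [d0_tail] multiply a_r
    into z, while after any other merge the last entry is 1 and z is unchanged. *)
Definition d0_fun r s e hs as_ z : X A H r s :=
  if as_ is a :: l then
    N (map jH hs) a (fun b hs' => Xt r s (e ** iA b) hs' l z)
    - alt *%R (d0_tail r s e hs z) a (rcons l 1)
  else 0.

Lemma Xt_Nmul r s e l z : Nmul (fun b hs => Xt r s (e ** iA b) hs l z).
Proof.
split=> *; last exact: (Xmul_H (Xmul_t r s)).
apply: (linear_comp (Xmul_l (Xmul_t r s) _ _ _)).
exact: (linear_comp (mulE_linearr _) iA_linear).
Qed.

Lemma iA_mul_linear z : linear (fun a => iA a ** z).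
Proof. exact: (linear_comp (mulE_linearl _) iA_linear). Qed.

Lemma d0_tail_mulin r s e hs z : mulin (d0_tail r s e hs z).
Proof.
apply: onlast_mulin => [a|l]; first exact: (Xmul_A (Xmul_t r s)).
exact: (linear_comp (Xmul_r (Xmul_t r s) _ _ _) (iA_mul_linear _)).
Qed.

Lemma d0_tail_normd r s e hs z : normd 1 1 (d0_tail r s e hs z).
Proof. by apply: onlast_normd => a; apply: (Xmul_A1 (Xmul_t r s)). Qed.

Lemma mul_bilinear : @is_bilinear k A A A *%R.
Proof.
by split=> ?; [apply: linear_mull|apply: linear_mulr]; apply: linear_id.
Qed.

Lemma d0_tail_rcons r s e hs z l a : d0_tail r s e hs z (rcons l a) =
  Xt r s e hs l (iA a ** z).
Proof. exact: onlast_rcons. Qed.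

Lemma d0_fun_mul r s : Xmul (d0_fun r s).
Proof.
split.
- move=> hs [|a l] z /=; first exact: linear_zero.
  apply: linear_sub.
    apply: linear_N_fun => b hs'.
    exact: (linear_comp (Xmul_l (Xmul_t r s) _ _ _) (mulE_linearl _)).
  apply: (linear_alt_fun _ _ _ (G := fun e => d0_tail r s e hs z)) => -[|x t].
    exact: linear_zero.
  exact: (Xmul_l (Xmul_t r s)).
- move=> e [|a l] z l1 l2 /=; first exact: linear_zero.
  apply: linear_sub.
    exact: (mulin_map jH_linear (N_mulin a (Xt_Nmul r s e l z))).
  apply: (linear_alt_fun _ _ _ (G := fun h => d0_tail r s e (l1 ++ h :: l2) z)) => -[|x
    t].
    exact: linear_zero.
  exact: (Xmul_H (Xmul_t r s)).
- move=> e [|a l] z l1 l2 _ //=.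
  rewrite alt_eq0 ?subr0.
    by rewrite map_cat (@N_normd 0 _ _ _ (Xt_Nmul r s e l z)) // => b; apply: (Xmul_H1
      (Xmul_t r s)).
  by case=> //= x t _ _; apply: (Xmul_H1 (Xmul_t r s)).
- move=> e hs z [|a l1] l2 /=.
    apply: linear_sub; first exact: N_linear (Xt_Nmul _ _ _ _ _).
    exact: (altl_mulin mul_bilinear (@d0_tail_mulin r s e hs z) [::] (rcons l2 1)).
  apply: linear_sub.
    apply: linear_N_fun => b hs'; exact: (Xmul_A (Xmul_t r s)).
  apply: (linear_eq _ (altl_mulin mul_bilinear (@d0_tail_mulin r s e hs z) (a :: l1)
    (rcons l2 1))).
  by move=> m; rewrite rcons_cat.
(* A unit at a_1 makes the term that moves a_1 to the left cancel the first merge. Units further on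
   are treated by [alt_unit]. *)
- move=> e hs z [|a l1] l2 _ /=.
    rewrite N_jH; last exact: Xt_Nmul.
    case: l2 => [|b l2] /=.
      rewrite /d0_tail /= mulr1 mulE1 subr0.
      by rewrite mul1E subrr.
    rewrite mul1r [alt _ _ _ _]alt_eq0; last first.
      by move=> t _ tP; apply: (@d0_tail_normd r s e hs z [::]).
    by rewrite subr0 -rcons_cons d0_tail_rcons mulE1 mul1E subrr.
  rewrite N_eq0; last by move=> *; apply: (Xmul_A1 (Xmul_t r s)).
  rewrite rcons_cat rcons_cons (@alt_unit _ _ _ 1) ?subrr ?size_rcons //.
  - exact: mul1r.
  - exact: mulr1.
  by move=> b l l' l'P; apply: (@d0_tail_normd r s e hs z (b :: l)).
move=> e hs [|a l] /=; first exact: linear_zero.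
apply: linear_sub.
  apply: linear_N_fun => b hs'; exact: (Xmul_r (Xmul_t r s)).
apply: (linear_alt_fun _ _ _ (G := fun z => d0_tail r s e hs z)) => -[|x t].
  exact: linear_zero.
exact: (linear_comp (Xmul_r (Xmul_t r s) _ _ _) (mulE_linearr _)).
Qed.

Lemma d0_spec r s : linear (@d0 r.+1 s r s) /\
  forall e hs as_ z, d0 r s (Xt r.+1 s e hs as_ z) = d0_fun r s e hs as_ z.
Proof.
apply: X_linext; first exact: d0_fun_mul.
  move=> e hs [|a l] z //= sz; rewrite N_eq0 ?alt_eq0 ?subrr //.
    case/lastP=> // t x; rewrite !size_rcons => -[szt] _.
    by rewrite d0_tail_rcons Xt_size // szt -eqSS.
  by move=> b hs' szh; apply: Xt_size; rewrite szh size_map -[size l == r]eqSS.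
move=> a0 h0 hs as_ b h sh sa /=.
have szh : size hs = s by case/eqP: (sh).
case: as_ sa => [|a l] sa; first by move: (sa) => /eqP.
have sza : size l = r by move: (sa); rewrite size_rcons => /eqP[].
rewrite /d0_fun (@N_sws_head _ _ _ _ _ (fun e hs' => Xt r s e hs' l (cr b h))); first
  last.
- by move=> e; apply: (Xmul_H (Xmul_t r s)).
- by move=> t; apply: (Xmul_l (Xmul_t r s)).
congr (_ + _).
  apply: eq_big_seq => p /(@size_sws (h0 :: hs)); case: p => p1 [|h' hs'] //= [sz].
  by rewrite X_el_Xt // sz.
(* The A-component b of the right factor b#h is moved into the final slot, so the merges become
   those of the defining formula. *)
rewrite (@alt_rcons_mul _ _ _ _ (d0_tail r s (cr a0 h0) hs (jH h)) _ b); first last.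
- by move=> t y; rewrite !d0_tail_rcons -iAM -mulEA iA_jH.
- by move=> *; apply: mulrA.
rewrite mul1r (alt_sum _ _ 0) -sumrN size_rcons sza; apply: eq_bigr => i _.
rewrite exprS mulN1r scaleNr; congr (- (_ *: _)).
rewrite -[take i _ ++ _]/(merge_at i (rcons (a :: l) b)).
have : size (merge_at i (rcons (a :: l) b)) = r.+1.
  have le_ir : (i <= r)%N by rewrite -ltnS.
  rewrite size_cat size_takel /= ?size_drop !size_rcons sza; last exact: leqW (leqW
    le_ir).
  by rewrite subSS addnS subnKC.
case/lastP: (merge_at _ _) => // t y; rewrite size_rcons => -[szt].
by rewrite d0_tail_rcons iA_jH X_el_Xt.
Qed.

Lemma d0_linear r s : linear (@d0 r.+1 s r s). Proof. by case: (d0_spec r s). Qed.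

Record bimodule V (lV : E -> V -> V) (rV : V -> E -> V) : Prop := {
  bim_l : forall e, linear (lV e);
  bim_r : forall e, linear (rV^~ e);
  bim_ll : forall x, linear (lV^~ x);
  bim_rr : forall x, linear (rV x);
  bim_lA : forall a b x, lV (a ** b) x = lV a (lV b x);
  bim_rA : forall x a b, rV x (a ** b) = rV (rV x a) b;
  bim_lr : forall a x b, rV (lV a x) b = lV a (rV x b);
  bim_l1 : forall x, lV oneE x = x;
  bim_r1 : forall x, rV x oneE = x }.

Lemma X_lact_linear r s e : linear (@X_lact r s e). Proof. by case: (X_lact_spec r s
  e). Qed.
Lemma X_ract_linear r s e : linear (fun x => @X_ract r s x e).
Proof. by case: (X_ract_spec r s e). Qed.
Lemma X_lactE r s e x hs as_ z : X_lact e (Xt r s x hs as_ z) = Xt r s (e ** x) hs as_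
  z.
Proof. by rewrite (X_lact_spec r s e).2. Qed.
Lemma X_ractE r s e x hs as_ z : X_ract (Xt r s x hs as_ z) e = Xt r s x hs as_ (z **
  e).
Proof. by rewrite (X_ract_spec r s e).2. Qed.

Lemma X_bimodule r s : bimodule (@X_lact r s) (@X_ract r s).
Proof.
have lL e := @X_lact_linear r s e; have lR e := @X_ract_linear r s e.
split=> //.
- move=> x c a b; move: x; apply: X_ext => // [|e hs as_ z _ _].
    by apply: linear_add => //; apply: linear_scale.
  rewrite !X_lactE mulE_linearl; exact: (Xmul_l (Xmul_t r s)).
- move=> x c a b; move: x; apply: X_ext => // [|e hs as_ z _ _].
    exact: (linear_add (linear_scale _ (lR a)) (lR b)).
  rewrite !X_ractE mulE_linearr; exact: (Xmul_r (Xmul_t r s)).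
- move=> a b; apply: X_ext => // [|e hs as_ z _ _]; first exact: linear_comp (lL a) (lL
  b).
  by rewrite !X_lactE mulEA.
- move=> x a b; move: x; apply: X_ext => [||e hs as_ z _ _] //.
    exact: (linear_comp (lR b) (lR a)).
  by rewrite !X_ractE mulEA.
- move=> a x b; move: x; apply: X_ext => [||e hs as_ z _ _].
  + exact: (linear_comp (lR b) (lL a)).
  + exact: (linear_comp (lL a) (lR b)).
  by rewrite !(X_lactE, X_ractE).
- apply: X_ext => // e hs as_ z _ _; by rewrite X_lactE mul1E.
by apply: X_ext => // e hs as_ z _ _; rewrite X_ractE mulE1.
Qed.

Lemma mu_sigma0Y s (y : Y A H s) : mu (sigma0Y 0 s y) = y.
Proof.
move: y; apply: Y_ext => [||e hs]; last (case/lastP: hs => // hs h _).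
- exact: (linear_comp (@mu_linear s) (@sigma0Y_linear s)).
- exact: linear_id.
by rewrite sigma0Y_Yt mu_Xt -map_rcons Theta_jH.
Qed.

(** After sigma^0 the list has one entry, so d^0 has two terms: absorbing it on the right restores
    x, and moving it to the left gives the normal form, which is sigma^0 mu x. *)
Lemma sigma0Y_mu s (x : X A H 0 s) :
  sigma0Y 0 s (mu x) + d0 0 s (sigma0 1 s x) = x.
Proof.
move: x; apply: X_ind => [|x y Ex Ey|a0 h0 hs as_ a h szh sza].
- rewrite (lin0 (@mu_linear s)) (lin0 (@sigma0Y_linear s)) (lin0 (@sigma0_linear _ s)).
  by rewrite (lin0 (@d0_linear _ s)) addr0.
- rewrite (linD (@mu_linear s)) (linD (@sigma0Y_linear s)) (linD (@sigma0_linear _ s)).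
  by rewrite (linD (@d0_linear _ s)) addrACA Ex Ey.
case: as_ sza => // _; rewrite mu_Xt sigma0_cr (linZ (@d0_linear _ s)) (d0_spec _ _).2.
rewrite /d0_fun /= subr0 mulr1 -[[:: a]]/(rcons [::] a) d0_tail_rcons iA_jH expr1
  scaleN1r opprB.
rewrite -cats1 /Theta N_cat N_cons N_nil mulE1 tsum_tens; last first.
  split=> [c|?].
    apply: linear_N_fun => b l; exact: (Nmul_r (Yt_Nmul s _) b l [::]).
  apply: N_linear; split=> [l|b l1 l2]; first exact: (Nmul_l (Yt_Nmul s _)).
  apply: (linear_eq _ (Nmul_r (Yt_Nmul s _) b l1 (l2 ++ [:: _]))) => m.
  by rewrite -catA.
rewrite (lin_N _ _ _ (@sigma0Y_linear s)) addrC -addrA [X in _ + X](_ : _ = 0) ?addr0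
  //.
apply/eqP; rewrite addrC subr_eq0; apply/eqP/eq_N => b l szl.
by rewrite cats1 sigma0Y_Yt.
Qed.

(** Absorbing the appended entry on the right restores x; every other term of d^0 commutes with
    sigma^0 up to sign. *)
Lemma d0_sigma0 r s (x : X A H r.+1 s) :
  sigma0 r.+1 s (d0 r s x) + d0 r.+1 s (sigma0 r.+2 s x) = x.
Proof.
move: x; apply: X_ind => [|x y Ex Ey|a0 h0 hs as_ a h szh sza].
- rewrite (lin0 (@d0_linear _ s)) (lin0 (@sigma0_linear r s)) (lin0 (@sigma0_linear
  r.+1 s)).
  by rewrite (lin0 (@d0_linear _ s)) addr0.
- rewrite (linD (@d0_linear _ s)) (linD (@sigma0_linear r s)) (linD (@sigma0_linear
  r.+1 s)).
  by rewrite (linD (@d0_linear _ s)) addrACA Ex Ey.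
case: as_ sza => // b l [szl]; rewrite sigma0_cr (linZ (@d0_linear _ s)) !(d0_spec _
  _).2.
set e := cr a0 h0; pose c : k := (-1) ^+ r.
have cc : c * c = 1 by rewrite -expr2 sqrr_sign.
have -> : (-1) ^+ r.+2 = c by rewrite !exprS !mulN1r opprK.
rewrite /d0_fun /= (alt_rcons_unit _ _ (rcons l a) (@mulr1 A)) -rcons_cons
  d0_tail_rcons iA_jH.
rewrite size_rcons szl opprD addrA scalerBr exprS mulN1r -/c scaleNr scalerN opprK
  scalerA cc scale1r.
rewrite addrA -[RHS]add0r; congr (_ + _).
have lS := @sigma0_linear r s; rewrite (linB lS) (lin_N _ _ _ lS) (lin_alt _ _ _ _ lS).
have -> : alt *%R (fun t => sigma0 r.+1 s (d0_tail r s e hs (cr a h) t)) b (rcons l 1) =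
    alt *%R (fun t => (- c) *: d0_tail r.+1 s e hs (jH h) (rcons t 1)) b (rcons l a).
  rewrite -[a in RHS]mul1r; apply: alt_rcons_mul => [|t y]; first exact: mulrA.
  by rewrite !d0_tail_rcons iA_mul_cr sigma0_cr iA_jH exprS mulN1r.
rewrite -(lin_alt _ _ _ _ (linear_scale _ (@linear_id _ _))) scaleNr opprK.
rewrite scalerBr addrACA subrr addr0 (lin_N _ _ _ (linear_scale c (@linear_id _ _))).
apply/eqP; rewrite addr_eq0 (lin_N _ _ _ (linear_opp (@linear_id _ _))).
by apply/eqP/eq_N => d l' _; rewrite sigma0_cr exprS mulN1r scaleNr.
Qed.

Lemma mu_lact s e (x : X A H 0 s) : mu (X_lact e x) = Y_lact e (mu x).
Proof.
have lL := @X_lact_linear 0 s e; move: x; apply: X_ext => [||x hs as_ z _].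
- exact: (linear_comp (@mu_linear s) lL).
- exact: (linear_comp (@Y_lact_linear s e) (@mu_linear s)).
by case: as_ => // _; rewrite X_lactE !mu_Xt Y_lact_Theta.
Qed.

Lemma mu_ract s e (x : X A H 0 s) : mu (X_ract x e) = Y_ract e (mu x).
Proof.
have lL := @X_ract_linear 0 s e; move: x; apply: X_ext => [||x hs as_ z _].
- exact: (linear_comp (@mu_linear s) lL).
- exact: (linear_comp (@Y_ract_linear s e) (@mu_linear s)).
case: as_ => // _; rewrite X_ractE !mu_Xt -!rcons_cons.
by rewrite Y_ract_Theta.
Qed.

Lemma sigma0Y_lact s e (y : Y A H s) :
  sigma0Y 0 s (Y_lact e y) = X_lact e (sigma0Y 0 s y).
Proof.
have lL := @X_lact_linear 0 s e; move: y; apply: Y_ext => [||x hs].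
- exact: (linear_comp (@sigma0Y_linear s) (@Y_lact_linear s e)).
- exact: (linear_comp lL (@sigma0Y_linear s)).
by case/lastP: hs => // hs h _; rewrite Y_lactE !sigma0Y_Yt X_lactE.
Qed.

Lemma sigma0_lact r s e (x : X A H r s) :
  sigma0 r.+1 s (X_lact e x) = X_lact e (sigma0 r.+1 s x).
Proof.
have lL t := @X_lact_linear t s e; move: x; apply: X_ext => [||x hs as_ z _ _].
- exact: (linear_comp (@sigma0_linear r s) (lL _)).
- exact: (linear_comp (lL _) (@sigma0_linear r s)).
rewrite X_lactE !(sigma0_spec _ _).2 (linZ (lL _)) (lin_tsum _ _ (lL _)).
by congr (_ *: _); apply: eq_tsum => a h; rewrite X_lactE.
Qed.

Lemma d0_lact r s e (x : X A H r.+1 s) : d0 r s (X_lact e x) = X_lact e (d0 r s x).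
Proof.
have lL t := @X_lact_linear t s e; move: x; apply: X_ext => [||x hs as_ z _ _].
- exact: (linear_comp (@d0_linear r s) (lL _)).
- exact: (linear_comp (lL _) (@d0_linear r s)).
rewrite X_lactE !(d0_spec _ _).2; case: as_ => [|a l] /=; first by rewrite (lin0 (lL
  _)).
rewrite (linB (lL _)) (lin_N _ _ _ (lL _)) (lin_alt _ _ _ _ (lL _)); congr (_ - _).
  by apply: eq_N => b hs' _; rewrite X_lactE mulEA.
apply: eq_alt => t _; case/lastP: t => [|t y]; first by rewrite (lin0 (lL _)).
by rewrite !d0_tail_rcons X_lactE.
Qed.

Lemma d0_ract r s e (x : X A H r.+1 s) : d0 r s (X_ract x e) = X_ract (d0 r s x) e.
Proof.
have lL t := @X_ract_linear t s e; move: x; apply: X_ext => [||x hs as_ z _ _].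
- exact: (linear_comp (@d0_linear r s) (lL _)).
- exact: (linear_comp (lL _) (@d0_linear r s)).
rewrite X_ractE !(d0_spec _ _).2; case: as_ => [|a l] /=; first by rewrite (lin0 (lL
  _)).
rewrite (linB (lL _)) (lin_N _ _ _ (lL _)) (lin_alt _ _ _ _ (lL _)); congr (_ - _).
  by apply: eq_N => b hs' _; rewrite X_ractE.
apply: eq_alt => t _; case/lastP: t => [|t y]; first by rewrite (lin0 (lL _)).
by rewrite !d0_tail_rcons X_ractE mulEA.
Qed.

(* X_(r+1,s) is generated by the image of sigma0 as a right E-module. *)
Lemma X_ext_sigma0 r s W (u v : X A H r.+1 s -> W) : linear u -> linear v ->
    (forall (x : X A H r s) e, u (X_ract (sigma0 r.+1 s x) e) = v (X_ract (sigma0 r.+1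
      s x) e)) ->
  u =1 v.
Proof.
move=> lu lv uv; apply: X_ext => // e hs as_ z szh.
case/lastP: as_ => // as_ b _.
have -> : Xt r.+1 s e hs (rcons as_ b) z =
    X_ract (sigma0 r.+1 s ((-1) ^+ r.+1 *: Xt r s e hs as_ (iA b))) z; last exact: uv.
rewrite (linZ (@sigma0_linear _ _)) sigma0_cr scalerA -expr2 sqrr_sign scale1r.
by rewrite X_ractE mul1E.
Qed.

(** On the image of sigma^0: mu d^0 sigma^0 = mu (1 - sigma^0 mu) = 0. *)
Lemma mu_d0 s (x : X A H 1 s) : mu (d0 0 s x) = 0.
Proof.
move: x; apply: X_ext_sigma0 => [||x e].
- exact: (linear_comp (@mu_linear s) (@d0_linear 0 s)).
- exact: linear_zero.
rewrite d0_ract mu_ract; have /(canRL (addKr _)) -> := sigma0Y_mu x.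
by rewrite (linD (@mu_linear s)) (linN (@mu_linear s)) mu_sigma0Y addNr (lin0
  (@Y_ract_linear s e)).
Qed.

(** On the image of sigma^0: d^0 d^0 sigma^0 = d^0 - d^0 sigma^0 d^0 = sigma^0 d^0 d^0, zero by
    induction; at the bottom mu takes the place of the next d^0. *)
Lemma d0_d0 r s (x : X A H r.+2 s) : d0 r s (d0 r.+1 s x) = 0.
Proof.
elim: r x => [|r IH]; apply: X_ext_sigma0 => [||x e].
- exact: (linear_comp (@d0_linear 0 s) (@d0_linear 1 s)).
- exact: linear_zero.
- rewrite !d0_ract; have /(canRL (addKr _)) -> := d0_sigma0 x.
  rewrite (linD (@d0_linear _ _)) (linN (@d0_linear _ _)).
  have /(canRL (addKr _)) -> := sigma0Y_mu (d0 0 s x).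
  rewrite mu_d0 (lin0 (@sigma0Y_linear s)) oppr0 add0r addNr.
  exact: lin0 (@X_ract_linear 0 s e).
- exact: (linear_comp (@d0_linear _ s) (@d0_linear _ s)).
- exact: linear_zero.
rewrite !d0_ract; have /(canRL (addKr _)) -> := d0_sigma0 x.
rewrite (linD (@d0_linear _ _)) (linN (@d0_linear _ _)).
have /(canRL (addKr _)) -> := d0_sigma0 (d0 r.+1 s x).
rewrite IH (lin0 (@sigma0_linear _ s)) oppr0 add0r addNr.
exact: lin0 (@X_ract_linear _ s e).
Qed.

(** The A-component 1 dies in Abar. This is why [sigmabar] vanishes on elements x (x) 1. *)
Lemma sigma0_unit r s e hs as_ : sigma0 r.+1 s (Xt r s e hs as_ oneE) = 0.
Proof.
by rewrite -[oneE]/(cr 1 1) sigma0_cr -cats1 (Xmul_A1 (Xmul_t r.+1 s)) ?scaler0.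
Qed.

Lemma sigmam1_mu_unit s e hs : sigmam1 (mu (Xt 0 s e hs [::] oneE)) = 0.
Proof.
have E l : rcons (e :: rcons l oneE) oneE = e :: l ++ oneE :: [:: oneE].
  by rewrite -!cats1 /= -catA.
by rewrite mu_Xt sigmam1_Theta E Theta_normd ?scaler0.
Qed.

Lemma sigma0Y_aug (x : E) z hs : hs = [::] ->
  sigma0Y 0 0 (Y0_aug (mu (Xt 0 0 x hs [::] z))) = Xt 0 0 (x ** z) [::] [::] oneE.
Proof.
move=> ->; rewrite mu_Xt /= /Y0_aug bd_sigmam1_0.
by rewrite -[[:: x ** z; oneE]]/((x ** z) :: map jH [:: 1]) Theta_jH (@sigma0Y_Yt 0 _
  [::] 1).
Qed.

(** * The maps d^l *)

Local Notation dl l r s r' s' := (@Defs.dl k A H hH act f l r s r' s').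
Local Notation X_biext := (@X_biext k A H hH act f).

Record X_bimap r s r' s' (u : X A H r s -> X A H r' s') : Prop := {
  bim_lin : linear u;
  bim_lact : forall e x, u (X_lact e x) = X_lact e (u x);
  bim_ract : forall x e, u (X_ract x e) = X_ract (u x) e }.

Section Biextension.
Variables (r s r' s' : nat) (u : X A H r s -> X A H r' s') (lu : linear u).
Let F e hs as_ z := X_lact e (X_ract (u (Xt r s oneE hs as_ oneE)) z).

Lemma biext_spec : linear (X_biext u) /\
  forall e hs as_ z, X_biext u (Xt r s e hs as_ z) = F e hs as_ z.
Proof.
have bX := X_bimodule r' s'.
have lin1 e z : linear (fun x => X_lact e (X_ract (u x) z)).
  exact: (linear_comp (bim_l bX e) (linear_comp (bim_r bX z) lu)).
have mu1 e z := Xmul_comp (lin1 e z) (Xmul_t r s).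
apply: X_linext => [|e hs as_ z sz|a0 h0 hs as_ a h sh sa] /=.
- split=> *.
  + exact: (bim_ll bX).
  + exact: (Xmul_H (mu1 _ _)).
  + exact: (Xmul_H1 (mu1 _ _)).
  + exact: (Xmul_A (mu1 _ _)).
  + exact: (Xmul_A1 (mu1 _ _)).
  exact: (linear_comp (bim_l bX _) (bim_rr bX _)).
- by rewrite /F Xt_size // (lin0 (lin1 _ _)).
have szh : size hs = s by case/eqP: (sh).
have sza : size as_ = r by move: (sa); rewrite size_rcons => /eqP[].
rewrite nth_rcons sza ltnn eqxx /F; congr (X_lact _ (X_ract (u _) _)).
rewrite /X_gt szh sza !eqxx /= /X_tens map_rcons -cats1 tpow_el_cat //.
by rewrite size_map.
Qed.

Lemma biext_bimap : X_bimap (X_biext u).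
Proof.
have [lb bE] := biext_spec; have bX := X_bimodule.
split=> // [e x|x e]; move: x; apply: X_ext => [||x hs as_ z _ _].
- exact: (linear_comp lb (bim_l (bX _ _) e)).
- exact: (linear_comp (bim_l (bX _ _) e) lb).
- by rewrite X_lactE !bE /F (bim_lA (bX _ _)).
- exact: (linear_comp lb (bim_r (bX _ _) e)).
- exact: (linear_comp (bim_r (bX _ _) e) lb).
by rewrite X_ractE !bE /F (bim_rA (bX _ _)) (bim_lr (bX _ _)).
Qed.

(** The extension evaluates u at 1 (x) x (x) 1 only; left linearity of u restores an arbitrary left
    factor, so the recursion can be used on all e (x) x (x) 1. *)
Lemma biext_unit e hs as_ : (forall e x, u (X_lact e x) = X_lact e (u x)) ->
  X_biext u (Xt r s e hs as_ oneE) = u (Xt r s e hs as_ oneE).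
Proof.
move=> ul; rewrite biext_spec.2 /F (bim_r1 (X_bimodule _ _)) -ul X_lactE.
by rewrite mulE1.
Qed.
End Biextension.

Lemma dl_0 r s r' s' : dl 0 r s r' s' = @Defs.d0 k A H hH act r s r' s'.
Proof. by []. Qed.

Lemma dl_r0 l s r' s' : dl l.+1 0 s r' s' = X_biext (fun x : X A H 0 s =>
  if l == 0%N then - sigma0Y r' s' (bd s' (mu x)) else
  - \sum_(1 <= j < l.+1) sigma0 r' s'
      (dl (l.+1 - j) j.-1 (s - j) r'.-1 s' (dl j 0 s j.-1 (s - j) x))).
Proof.
rewrite {1}/Defs.dl srecE /=.
apply: (congr1 (@Defs.X_biext k A H hH act f 0 s r' s')); apply/funext => x.
rewrite eqSS; case: (l == 0%N) => //; congr (- _).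
apply: eq_big_nat => j /andP[j1 jl].
by rewrite jl ltn_subrL j1.
Qed.

Lemma dl_rS l r s r' s' : dl l.+1 r.+1 s r' s' = X_biext (fun x : X A H r.+1 s =>
  - (sigma0 r' s' (dl l.+1 r s r'.-1 s' (d0 r s x))
     + \sum_(1 <= j < l.+1) sigma0 r' s'
        (dl (l.+1 - j) (r + j) (s - j) r'.-1 s' (dl j r.+1 s (r + j) (s - j) x)))).
Proof.
rewrite {1}/Defs.dl srecE /=.
apply: (congr1 (@Defs.X_biext k A H hH act f r.+1 s r' s')); apply/funext => x.
congr (- (_ + _)); first by rewrite /Defs.dl srecE.
apply: eq_big_nat => j /andP[j1 jl].
by rewrite jl ltn_subrL j1.
Qed.

(* The composites defining d^l on generators; for j = 0 the composite only occurs
   when r > 0. *)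
Definition dl_comp l r s r' s' j (x : X A H r s) : X A H r' s' :=
  sigma0 r' s' (dl (l - j) (r + j).-1 (s - j) r'.-1 s' (dl j r s (r + j).-1 (s - j) x)).

(** Unites the recursions for r = 0 and r > 0: the filter 0 < r + j drops j = 0 exactly when r = 0,
    where the map starting the row is mu and not d^0. *)
Definition dl_inner l r s r' s' (x : X A H r s) : X A H r' s' :=
  if (r == 0%N) && (l == 1%N) then
    - sigma0Y r' s' (bd s' (mu x))
  else - \sum_(0 <= j < l | (0 < r + j)%N) dl_comp l r' s' j x.

Lemma dlE l r s r' s' :
  dl l.+1 r s r' s' = X_biext (dl_inner l.+1 r' s').
Proof.
case: r => [|r].
  rewrite dl_r0; congr Defs.X_biext; apply/funext => x; rewrite /dl_inner eqSS /=.
  case: (l == 0%N) => //; congr (- _); rewrite [RHS]big_mkcond /= [RHS]big_nat_recl //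
    addn0 ltnn add0r.
  by rewrite big_add1 /=; apply: eq_bigr.
rewrite dl_rS; congr Defs.X_biext; apply/funext => x; rewrite /dl_inner.
congr (- _); rewrite [RHS]big_nat_recl //= {1}/dl_comp subn0 addn0 dl_0 subn0; congr (_
  + _).
by rewrite big_add1; apply: eq_bigr => j _; rewrite /dl_comp addSn.
Qed.

Lemma X_bimap_comp r s r1 s1 r2 s2 (u : X A H r s -> X A H r1 s1)
    (v : X A H r1 s1 -> X A H r2 s2) :
  X_bimap u -> X_bimap v -> X_bimap (fun x => v (u x)).
Proof.
move=> bu bv; split=> [|e x|x e].
- exact: (linear_comp (bim_lin bv) (bim_lin bu)).
- by rewrite (bim_lact bu) (bim_lact bv).
by rewrite (bim_ract bu) (bim_ract bv).
Qed.

Record X_lmap r s r' s' (u : X A H r s -> X A H r' s') : Prop := {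
  lm_lin : linear u;
  lm_lact : forall e x, u (X_lact e x) = X_lact e (u x) }.

Lemma dl_comp_lmap l r s r' s' j :
    (forall i, (i < l.+1)%N -> forall r s r' s', (r + i = r'.+1)%N -> s = (s' + i)%N ->
       X_bimap (dl i r s r' s')) ->
    ((j = 0)%N -> X_bimap (dl l.+1 r.-1 s r'.-1 s')) ->
    (r + l = r')%N -> s = (s' + l.+1)%N -> (j < l.+1)%N -> (0 < r + j)%N ->
  X_lmap (@dl_comp l.+1 r s r' s' j).
Proof.
move=> IH IH0 Er Es jl rj.
have b1 : X_bimap (dl j r s (r + j).-1 (s - j)) by apply: IH => //; lia.
have b2 : X_bimap (dl (l.+1 - j) (r + j).-1 (s - j) r'.-1 s').
  have [j0|j0] := posnP j; last by apply: IH; lia.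
  by move: rj; rewrite j0 !subn0 addn0 => _; apply: IH0.
case: r' b2 Er {IH0} => [|r''] b2 Er.
  by exfalso; lia.
split.
- exact: (linear_comp (@sigma0_linear _ _) (bim_lin (X_bimap_comp b1 b2))).
by move=> e x; rewrite /dl_comp (bim_lact (X_bimap_comp b1 b2)) sigma0_lact.
Qed.

Lemma dl_inner_lmap l r s r' s' :
    (forall i, (i < l.+1)%N -> forall r s r' s', (r + i = r'.+1)%N -> s = (s' + i)%N ->
       X_bimap (dl i r s r' s')) ->
    ((0 < r)%N -> X_bimap (dl l.+1 r.-1 s r'.-1 s')) ->
    (r + l = r')%N -> s = (s' + l.+1)%N ->
  X_lmap (@dl_inner l.+1 r s r' s').
Proof.
move=> IH IH0 Er Es; rewrite /dl_inner; case rl: ((r == 0%N) && (l.+1 == 1%N)).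
  case/andP: rl => /eqP r0; rewrite eqSS => /eqP l0; move: Er; rewrite r0 l0 /= => <-;
    move: Es; rewrite l0 addn1.
  move=> -> {IH IH0}.
  have lin1 := linear_comp (@sigma0Y_linear s') (linear_comp (@bd_linear s')
    (@mu_linear s'.+1)).
  split; first exact: linear_opp lin1.
  by move=> e x; rewrite mu_lact bd_lact sigma0Y_lact (linN (@X_lact_linear _ _ e)).
have lm j : (j < l.+1)%N -> (0 < r + j)%N -> X_lmap (@dl_comp l.+1 r s r' s' j).
  by move=> jl rj; apply: dl_comp_lmap => // j0; apply: IH0; lia.
split=> [c x y|e x].
  rewrite scalerN -opprD scaler_sumr -big_split; congr (- _) => /=.
  rewrite big_nat_cond [RHS]big_nat_cond; apply: eq_bigr => j /andP[/andP[_ jl] rj].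
  exact: (lm_lin (lm j jl rj)).
rewrite (linN (@X_lact_linear _ _ e)) (lin_sum (@X_lact_linear _ _ e)); congr (- _).
rewrite big_nat_cond [RHS]big_nat_cond; apply: eq_bigr => j /andP[/andP[_ jl] rj].
exact: (lm_lact (lm j jl rj)).
Qed.

(** Induction on l and then on r: the summand j = 0 contains d^l again, but at r - 1. *)
Lemma dl_bimap l r s r' s' : (r + l = r'.+1)%N -> s = (s' + l)%N ->
  X_bimap (dl l r s r' s').
Proof.
elim/ltn_ind: l r s r' s' => -[|l] IHl r s r' s'.
  rewrite addn0 => -> ; rewrite addn0 => ->; rewrite dl_0; split=> *.
  - exact: d0_linear.
  - exact: d0_lact.
  exact: d0_ract.
elim: r s r' s' => [|r IHr] s r' s' Er Es; rewrite dlE; apply: biext_bimap.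
  apply: (lm_lin (dl_inner_lmap IHl _ _ _)) => //; lia.
apply: (lm_lin (dl_inner_lmap IHl _ _ _)) => //; last lia.
by move=> _; apply: IHr => /=; lia.
Qed.

Lemma dl_unit l r s r' s' e hs as_ : (r + l = r')%N -> s = (s' + l.+1)%N ->
  dl l.+1 r s r' s' (Xt r s e hs as_ oneE) = dl_inner l.+1 r' s' (Xt r s e hs as_ oneE).
Proof.
move=> Er Es; have lm : X_lmap (@dl_inner l.+1 r s r' s').
  apply: dl_inner_lmap => // [i _ *|r0]; apply: dl_bimap => //=; lia.
rewrite dlE; apply: biext_unit; first exact: lm_lin lm.
exact: lm_lact lm.
Qed.

(** * The total operator and its square *)

Definition XY r s : lmodType k := if r is r'.+1 then X A H r' s else Y A H s.

(* All the modules X_(r,s), shifted by one in r so that Y_s sits in the column r = 0; this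
   product makes sums of maps of different bidegrees into single operators. *)
Definition XYprod : Type := forall r s, XY r s.
HB.instance Definition _ := gen_eqMixin XYprod.
HB.instance Definition _ := gen_choiceMixin XYprod.

Implicit Types t : XYprod.

Lemma XYP t t' : (forall r s, t r s = t' r s) -> t = t'.
Proof. by move=> E; apply/functional_extensionality_dep => r;
  apply/functional_extensionality_dep => s. Qed.

Definition XYadd t t' : XYprod := fun r s => t r s + t' r s.
Definition XYzero : XYprod := fun r s => 0.
Definition XYopp t : XYprod := fun r s => - t r s.
Definition XYscale (c : k) t : XYprod := fun r s => c *: t r s.

Fact XYaddA : associative XYadd.
Proof. by move=> *; apply: XYP => r s; apply: addrA. Qed.
Fact XYaddC : commutative XYadd.
Proof. by move=> *; apply: XYP => r s; apply: addrC. Qed.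
Fact XYadd0 : left_id XYzero XYadd.
Proof. by move=> *; apply: XYP => r s; apply: add0r. Qed.
Fact XYaddN : left_inverse XYzero XYopp XYadd.
Proof. by move=> *; apply: XYP => r s; apply: addNr. Qed.
HB.instance Definition _ := GRing.isZmodule.Build XYprod XYaddA XYaddC XYadd0 XYaddN.

Fact XYscaleA a b t : XYscale a (XYscale b t) = XYscale (a * b) t.
Proof. by apply: XYP => r s; apply: scalerA. Qed.
Fact XYscale1 : left_id 1 XYscale.
Proof. by move=> *; apply: XYP => r s; apply: scale1r. Qed.
Fact XYscaleDr : right_distributive XYscale +%R.
Proof. by move=> *; apply: XYP => r s; apply: scalerDr. Qed.
Fact XYscaleDl t : {morph XYscale^~ t : a b / a + b}.
Proof. by move=> *; apply: XYP => r s; apply: scalerDl. Qed.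
HB.instance Definition _ := GRing.Zmodule_isLmodule.Build k XYprod
  XYscaleA XYscale1 XYscaleDr XYscaleDl.

Lemma XYprodD t t' r s : (t + t') r s = t r s + t' r s. Proof. by []. Qed.
Lemma XYprodN t r s : (- t) r s = - t r s. Proof. by []. Qed.
Lemma XYprodZ c t r s : (c *: t) r s = c *: t r s. Proof. by []. Qed.
Lemma XYprod0 r s : (0 : XYprod) r s = 0. Proof. by []. Qed.

Definition mkXY (x : forall r s, X A H r s) (y : forall s, Y A H s) : XYprod :=
  fun r => if r is r'.+1 return forall s, XY r s then x r' else y.

Definition opd t : XYprod :=
  mkXY (fun r s => d0 r s (t r.+2 s : X A H r.+1 s)) (fun s => mu (t 1%N s : X A H 0
    s)).

(** For the target X_(r,s') the sources are the X_(r+s'+1-s, s) with s > s', all of total degree one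
    higher; l is s - s'. *)
Definition opdelta t : XYprod :=
  mkXY (fun r s' => \sum_(s < (r + s').+2 | (s' < s)%N)
          dl (s - s') (r + s'.+1 - s) s r s' (t (r + s'.+1 - s).+1 s))
       (fun s => bd s (t 0%N s.+1)).

Definition oph t : XYprod :=
  mkXY (fun r s => if r is r'.+1 then sigma0 r'.+1 s (t r'.+1 s : X A H r' s)
                   else sigma0Y 0 s (t 0%N s))
       (fun s => 0).

Definition sg0 p s : forall r' s', XY p s -> X A H r' s' :=
  if p is q.+1 return forall r' s', XY p s -> X A H r' s' then @Defs.sigma0 k A H q s
  else @Defs.sigma0Y k A H s.

Definition sg p s l r' s' : XY p s -> X A H r' s' :=
  @sigmal k A H hH act f (XY p s) p s (sg0 (p := p) (s := s)) l r' s'.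

(** The sum of the sigma^l with l = s - s'. In the shifted numbering the source column is r + s' -
    s, which is Y_s when it is 0. *)
Definition oph' t : XYprod :=
  mkXY (fun r s' => \sum_(s < (r + s').+1 | (s' <= s)%N)
          sg (s - s') r s' (t (r + s' - s)%N s))
       (fun s => 0).

Definition opD t := opd t + opdelta t.

Definition lactXY r s e : XY r s -> XY r s :=
  if r is r'.+1 return XY r s -> XY r s then X_lact e else Y_lact e.
Definition ractXY r s e : XY r s -> XY r s :=
  if r is r'.+1 return XY r s -> XY r s then (fun x => X_ract x e) else Y_ract e.
Definition lactT e t : XYprod := fun r s => lactXY e (t r s).
Definition ractT e t : XYprod := fun r s => ractXY e (t r s).

Lemma lactXY_linear r s e : linear (@lactXY r s e).
Proof. by case: r => [|r]; [apply: Y_lact_linear|apply: X_lact_linear]. Qed.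
Lemma ractXY_linear r s e : linear (@ractXY r s e).
Proof. by case: r => [|r]; [apply: Y_ract_linear|apply: X_ract_linear]. Qed.

Lemma opd_linear : linear opd.
Proof.
move=> c t t'; apply: XYP => -[|r] s /=; rewrite XYprodD XYprodZ /=.
  exact: mu_linear.
exact: d0_linear.
Qed.

Lemma opdelta_linear : linear opdelta.
Proof.
move=> c t t'; apply: XYP => -[|r] s /=; rewrite XYprodD XYprodZ /=.
  exact: bd_linear.
rewrite scaler_sumr -big_split; apply: eq_bigr => s1 /= ss1.
have lt_s1 := ltn_ord s1; rewrite (bim_lin (dl_bimap _ _)) //; lia.
Qed.

Lemma oph_linear : linear oph.
Proof.
move=> c t t'; apply: XYP => -[|[|r]] s /=; rewrite XYprodD XYprodZ /=.
- by rewrite scaler0 addr0.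
- exact: sigma0Y_linear.
exact: sigma0_linear.
Qed.

Lemma opd_lact e t : opd (lactT e t) = lactT e (opd t).
Proof. by apply: XYP => -[|r] s; [apply: mu_lact|apply: d0_lact]. Qed.
Lemma opd_ract e t : opd (ractT e t) = ractT e (opd t).
Proof. by apply: XYP => -[|r] s; [apply: mu_ract|apply: d0_ract]. Qed.
Lemma opdelta_ract e t : opdelta (ractT e t) = ractT e (opdelta t).
Proof.
apply: XYP => -[|r] s; first exact: bd_ract.
rewrite /ractT /= (lin_sum (@X_ract_linear _ _ e)); apply: eq_bigr => s1 /= ss1.
by have lt_s1 := ltn_ord s1; apply: (bim_ract (dl_bimap _ _)); lia.
Qed.

Lemma opd_opd t : opd (opd t) = 0.
Proof. by apply: XYP => -[|r] s; [apply: mu_d0|apply: d0_d0]. Qed.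

Lemma oph_opd t : oph (opd t) + opd (oph t) = t.
Proof.
apply: XYP => -[|[|r]] s; rewrite XYprodD /=.
- by rewrite add0r mu_sigma0Y.
- exact: sigma0Y_mu.
exact: d0_sigma0.
Qed.

Lemma opD_linear : linear opD.
Proof. exact: linear_add opd_linear opdelta_linear. Qed.
Lemma opD_ract e t : opD (ractT e t) = ractT e (opD t).
Proof.
rewrite /opD opd_ract opdelta_ract; apply: XYP => r s.
by rewrite XYprodD /ractT -(linD (@ractXY_linear r s e)).
Qed.

(* h delta strictly raises r. *)
Lemma oph_opdelta_inj t : t = - oph (opdelta t) -> t = 0.
Proof.
move=> Et; apply: XYP => r; elim/ltn_ind: r => r IH s; rewrite Et XYprodN XYprod0.
apply/eqP; rewrite oppr_eq0; apply/eqP; case: r IH => [|[|r]] IH //=.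
  by rewrite IH // (lin0 (@bd_linear s)) (lin0 (@sigma0Y_linear s)).
rewrite big1 ?(lin0 (@sigma0_linear r s)) // => s1 /= ss1.
have lt_s1 := ltn_ord s1; rewrite IH; last lia.
by rewrite (lin0 (bim_lin (dl_bimap _ _))) //; lia.
Qed.

(** The element concentrated at (r,s). The casts are unavoidable since the type of a component
    depends on the bidegree; [dirac_same] removes them by uniqueness of equality proofs on nat. *)
Definition dirac r s (y : XY r s) : XYprod := fun r' s' =>
  match @eqP _ r r', @eqP _ s s' with
  | ReflectT e1, ReflectT e2 => ecast i (XY i s') e1 (ecast j (XY r j) e2 y)
  | _, _ => 0
  end.

Lemma dirac_same r s (y : XY r s) : dirac y r s = y.
Proof.
rewrite /dirac; case: eqP => // e1; case: eqP => // e2.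
by rewrite (eq_axiomK e1) (eq_axiomK e2).
Qed.

Lemma dirac_neq r s (y : XY r s) r' s' : (r, s) != (r', s') -> dirac y r' s' = 0.
Proof.
by rewrite /dirac xpair_eqE; case: eqP => // e1; case: eqP.
Qed.

Lemma dirac_linear r s : linear (@dirac r s).
Proof.
move=> c x y; apply: XYP => r' s'; rewrite XYprodD XYprodZ.
have [[<- <-]|rs] := eqVneq (r, s) (r', s'); first by rewrite !dirac_same.
by rewrite !dirac_neq // scaler0 addr0.
Qed.

Lemma dirac_ract r s e (y : XY r s) : dirac (ractXY e y) = ractT e (dirac y).
Proof.
apply: XYP => r' s'; rewrite /ractT.
have [[<- <-]|rs] := eqVneq (r, s) (r', s'); first by rewrite !dirac_same.
by rewrite !dirac_neq // (lin0 (@ractXY_linear _ _ _)).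
Qed.

Lemma opD_agree n t t' : (forall r s, (r + s <= n.+1)%N -> t r s = t' r s) ->
  forall r s, (r + s <= n)%N -> opD t r s = opD t' r s.
Proof.
move=> tt' [|r] s rs; rewrite /opD !XYprodD /=.
  by rewrite (tt' 1%N s) ?(tt' 0%N s.+1) //; lia.
rewrite (tt' r.+2 s); last by lia.
congr (_ + _); apply: eq_bigr => s1 /= ss1.
by have lt_s1 := ltn_ord s1; rewrite tt'; last by lia.
Qed.

(** An element of the infinite product is not a finite sum of [dirac]s, but each component of D D t
    depends on finitely many components of t, so t can be truncated to a box. *)
Lemma opDD_eq0 t : (forall r s, opD (opD (dirac (t r s))) = 0) -> opD (opD t) = 0.
Proof.
move=> t0; apply: XYP => r s.
(* Each application of D reads one total degree further. *)
pose n := (r + s).+2.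
rewrite (@opD_agree (r + s) _ (opD (\sum_(i < n.+1) \sum_(j < n.+1) dirac (t i j)))) //.
  rewrite (lin_sum opD_linear) (lin_sum opD_linear) big1 // => i _.
  by rewrite (lin_sum opD_linear) (lin_sum opD_linear) big1.
apply: opD_agree => i j ij.
have ev (F : nat -> XYprod) i' j' m :
    (\sum_(l < m) F l) i' j' = \sum_(l < m) F l i' j'.
  exact: (big_morph (fun t : XYprod => t i' j') (id1 := 0) (op1 := +%R)).
rewrite (ev (fun i => \sum_(j < n.+1) dirac (t i j))).
have lti : (i < n.+1)%N by rewrite /n; lia.
have ltj : (j < n.+1)%N by rewrite /n; lia.
rewrite (bigD1 (Ordinal lti)) //= [X in _ + X]big1 => [|i' ni]; last first.
  rewrite (ev (fun j => dirac (t i' j))) big1 // => j' _; rewrite dirac_neq //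
    xpair_eqE.
  by case: eqP => // E; case/eqP: ni; apply: val_inj.
rewrite addr0 (ev (fun j => dirac (t i j))) (bigD1 (Ordinal ltj)) //= dirac_same.
rewrite big1 ?addr0 // => j' nj.
rewrite dirac_neq // xpair_eqE eqxx /=.
by apply: contraNneq nj => E; apply/eqP/val_inj.
Qed.

Lemma opdelta_dirac r s (y : X A H r s) r' s' :
  opdelta (@dirac r.+1 s y) r'.+1 s' =
  if (s' < s)%N && (r' + s'.+1 == r + s)%N then dl (s - s') r s r' s' y else 0.
Proof.
have z s1 : (s' < s1)%N -> (s1 < (r' + s').+2)%N ->
    (r.+1, s) != ((r' + s'.+1 - s1).+1, s1) ->
  dl (s1 - s') (r' + s'.+1 - s1) s1 r' s' (@dirac r.+1 s y (r' + s'.+1 - s1).+1 s1) = 0.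
  by move=> ? ? ne; rewrite dirac_neq // (lin0 (bim_lin (dl_bimap _ _))) //; lia.
case: ifP => [/andP[lt_s /eqP Er]|cond] /=.
  have lt_s2 : (s < (r' + s').+2)%N by lia.
  rewrite (bigD1 (Ordinal lt_s2)) //= big1 ?addr0 => [|s1 /andP[s1P ns1]].
    have -> : (r' + s'.+1 - s = r)%N by lia.
    by rewrite dirac_same.
  apply: z => //; rewrite xpair_eqE negb_and orbC; apply/orP; left.
  by rewrite eq_sym.
apply: big1 => s1 s1P; apply: z => //; rewrite xpair_eqE eqSS.
apply/negP => /andP[/eqP E1 /eqP E2]; have := ltn_ord s1; lia.
Qed.

Lemma opD_dirac r s (y : X A H r s) p q :
  opD (@dirac r.+1 s y) p.+1 q =
  if (q <= s)%N && (p + q.+1 == r + s)%N then dl (s - q) r s p q y else 0.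
Proof.
have z : (r.+1, s) != (p.+2, q) -> d0 p q (@dirac r.+1 s y p.+2 q) = 0.
  by move=> ne; rewrite dirac_neq // (lin0 (@d0_linear p q)).
rewrite /opD XYprodD opdelta_dirac [(q <= s)%N]leq_eqVlt /=.
have [eq_q|ne_q] := eqVneq q s; last first.
  by rewrite z ?add0r //; rewrite xpair_eqE (eq_sym s q) (negbTE ne_q) andbF.
subst q; rewrite ltnn andFb addr0 andTb subnn dl_0 addnS -addSn eqn_add2r.
case: (eqVneq p.+1 r) => [e|ne]; last first.
  by rewrite z //; rewrite xpair_eqE eqSS eq_sym (negbTE ne).
by move: y {z}; rewrite -e => y; rewrite dirac_same.
Qed.

Lemma opD_Y t : (forall r s, t r.+1 s = 0) ->
  (forall r s, opD t r.+1 s = 0) /\ (forall s, opD t 0%N s = bd s (t 0%N s.+1)).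
Proof.
move=> t0; split=> [r s|s]; rewrite /opD XYprodD /=; last first.
  by rewrite t0 (lin0 (@mu_linear s)) add0r.
rewrite t0 (lin0 (@d0_linear r s)) add0r big1 // => s1 /= ss1.
have lt_s1 := ltn_ord s1; rewrite t0 (lin0 (bim_lin (dl_bimap _ _))) //; lia.
Qed.

Lemma opDD_Y s (y : Y A H s) : opD (opD (@dirac 0%N s y)) = 0.
Proof.
have [|E1 E2] := @opD_Y (@dirac 0%N s y).
  by move=> r' s'; rewrite dirac_neq.
have [E3 E4] := opD_Y E1; apply: XYP => -[|r] s'; first by rewrite E4 E2 (@bd_bd s').
exact: E3.
Qed.

(** Turns the sums over j of the recursions into sums over the intermediate row i = s' + l - j, the
    index used by [opdelta]. *)
Lemma rev_sum W (F : nat -> W) n s' l :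
  \sum_(0 <= j < l | (s' + l - j < n)%N) F j =
  \sum_(i < n | (s' < i <= s' + l)%N) F (s' + l - i)%N.
Proof.
elim: l s' => [|l IH] s'.
  rewrite big_geq // big_pred0 // => i; lia.
rewrite big_mkcond big_nat_recr //= -big_mkcond /=.
rewrite addnS -addSn IH; have -> : (s'.+1 + l - l = s'.+1)%N by lia.
case: ifP => lt_s; last first.
  by rewrite addr0; apply: eq_bigl => i; have := ltn_ord i; lia.
rewrite [RHS](bigD1 (Ordinal lt_s)) /=; last by lia.
rewrite addrC; congr (_ + _); first by congr F; lia.
by apply: eq_bigl => i; rewrite -val_eqE /=; lia.
Qed.

(** This is the recursive definition of all the d^l at once, available because [dl_unit] holds for
    any left factor. The hypothesis on y is kept as an equation so that r and s can be
    substituted. *)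
Lemma opdelta_unit r s e hs as_ (y : X A H r s) : y = Xt r s e hs as_ oneE ->
  opdelta (@dirac r.+1 s y) = - oph (opdelta (opD (@dirac r.+1 s y))).
Proof.
move=> yE.
apply: XYP => -[|r'] s'; rewrite XYprodN.
  by rewrite /= oppr0 dirac_neq // (lin0 (@bd_linear s')).
rewrite opdelta_dirac; case: r' => [|r'] /=.
  rewrite /opD XYprodD /= [@dirac r.+1 s y 0%N _]dirac_neq // (lin0 (@bd_linear _))
    addr0.
  case: ifP => [/andP[lt_s /eqP Er]|cond].
    have [r0 s0] : r = 0%N /\ s = s'.+1 by lia.
    subst r s; rewrite dirac_same subSn // subnn.
    by rewrite yE dl_unit ?addn1.
  rewrite [dirac _ _ _]dirac_neq ?(lin0 (@mu_linear _)) ?(lin0 (@bd_linear _)) ?(lin0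
    (@sigma0Y_linear _)) ?oppr0 //.
  rewrite xpair_eqE; lia.
have lS := @sigma0_linear r' s'.
case: ifP => [/andP[lt_s /eqP Er]|cond]; last first.
  rewrite big1 ?(lin0 lS) ?oppr0 // => s2 s2P; have lt2 := ltn_ord s2.
  rewrite opD_dirac; case: ifP => [|_]; first by lia.
  by rewrite (lin0 (bim_lin (dl_bimap _ _))) //; lia.
have [l El] : exists l, (s - s' = l.+1)%N by exists (s - s').-1; lia.
rewrite El yE dl_unit; [|lia|lia].
rewrite /dl_inner; case: ifP => [/andP[/eqP r0 /eqP l0]|_]; first by lia.
congr (- _); rewrite (lin_sum lS).
have En : ((r' + s').+2 = r + s)%N by lia.
have Es : s = (s' + l.+1)%N by lia.
rewrite -yE.
transitivity (\sum_(0 <= j < l.+1 | (s' + l.+1 - j < (r' + s').+2)%N)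
    dl_comp l.+1 r'.+1 s' j y).
  rewrite big_nat_cond [RHS]big_nat_cond; apply: eq_bigl => j.
  by case: (ltnP j l.+1) => // jl; rewrite andTb; lia.
(* D never raises the row, so rows i > s contribute nothing. *)
rewrite rev_sum [RHS](bigID (fun i : 'I__ => (i <= s)%N)) /= [X in _ + X]big1 ?addr0.
  rewrite -Es; apply: eq_bigr => i /andP[lt_i le_i].
  rewrite /dl_comp opD_dirac le_i.
  have -> : (l.+1 - (s - i) = i - s')%N by lia.
  have -> : ((r + (s - i)).-1 = r' + s'.+1 - i)%N by lia.
  have -> : (s - (s - i) = i)%N by lia.
  by have lt_i2 := ltn_ord i; case: eqP => //; lia.
move=> i /andP[lt_i le_i]; rewrite opD_dirac (negbTE le_i).
have lt2 := ltn_ord i.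
by rewrite (lin0 (bim_lin (dl_bimap _ _))) ?(lin0 lS) //; lia.
Qed.

(** As d d = 0, d D t = d delta t = - d h delta D t = - delta D t + h d delta D t, so w = h d delta
    D t. Moreover delta D t = w - d D t and D w = 0 give d delta D t = d w = - delta w. *)
Lemma opDD_step t : opdelta t = - oph (opdelta (opD t)) -> opD (opD (opD t)) = 0 ->
  opD (opD t) = 0.
Proof.
move=> Et D3; set w := opD (opD t); apply: oph_opdelta_inj.
have lh := oph_linear; have ld := opd_linear.
have dw : opd w = - opdelta w by apply/eqP; rewrite -addr_eq0 -/(opD w) D3.
have E1 : opd (opD t) = - opdelta (opD t) + oph (opd (opdelta (opD t))).
  rewrite {1}/opD (linD ld) opd_opd add0r Et (linN ld).
  have /(canRL (addKr _)) -> := oph_opd (opdelta (opD t)).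
  by rewrite opprD opprK addrC.
have wE : w = oph (opd (opdelta (opD t))).
  by rewrite /w -[LHS]/(opd (opD t) + opdelta (opD t)) E1 addrC addNKr.
have E2 : opdelta (opD t) = w - opd (opD t) by rewrite /w -[opD (opD t)]/(opd (opD t) +
  opdelta (opD t)) addrC addKr.
by rewrite {1}wE E2 (linB ld) opd_opd subr0 dw (linN lh).
Qed.

(** Induction on s and then on r: the X-components of D y lie in rows below s or in row s one column
    to the left, which yields the hypothesis D D D = 0 of [opDD_step]. Right linearity reduces to
    elements ending in 1. *)
Lemma opDD_dirac r s (y : XY r s) : opD (opD (dirac y)) = 0.
Proof.
elim/ltn_ind: s r y => s IHs; elim=> [|r IHr] y; first exact: opDD_Y.
have lin1 : linear (fun y : XY r.+1 s => opD (opD (dirac y))).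
  exact: (linear_comp opD_linear (linear_comp opD_linear (@dirac_linear r.+1 s))).
have lin0' : linear (fun _ : X A H r s => 0 : XYprod) by exact: linear_zero.
move: y; apply: (X_ext lin1 lin0') => e hs as_ z _ _.
have -> : Xt r s e hs as_ z = ractXY (r := r.+1) z (Xt r s e hs as_ oneE).
  by rewrite /= X_ractE mul1E.
rewrite dirac_ract !opD_ract.
suff -> : opD (opD (@dirac r.+1 s (Xt r s e hs as_ oneE))) = 0.
  by apply: XYP => r' s'; rewrite /ractT (lin0 (@ractXY_linear _ _ _)).
apply: opDD_step; first exact: opdelta_unit.
apply: opDD_eq0 => -[|p] q; first exact: opDD_Y.
rewrite opD_dirac; case: ifP => [/andP[]|_]; last first.
  by rewrite (lin0 (@dirac_linear _ _)) !(lin0 opD_linear).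
rewrite leq_eqVlt => /orP[/eqP -> /eqP E|lt_q _]; last exact: IHs.
have Ep : p.+1 = r by lia.
by subst r; apply: IHr.
Qed.

Lemma opD_opD t : opD (opD t) = 0.
Proof. by apply: opDD_eq0 => r s; apply: opDD_dirac. Qed.

(** * The contraction of the total complex *)

Lemma sg_0 p s r' s' x : @sg p s 0 r' s' x = sg0 r' s' x.
Proof. by rewrite /sg /sigmal srecE. Qed.

Lemma sg_S p s l r' s' x : @sg p s l.+1 r' s' x =
  - \sum_(0 <= i < l.+1) sigma0 r' s'
      (dl (l.+1 - i) (p + i) (s - i) r'.-1 s' (@sg p s i (p + i) (s - i) x)).
Proof.
rewrite /sg {1}/sigmal srecE /=; congr (- _).
by apply: eq_big_nat => i /andP[_ ->].
Qed.

Lemma sg0_lmap p s : linear (@sg0 p s p s) /\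
  forall e x, sg0 p s (lactXY e x) = X_lact e (@sg0 p s p s x).
Proof.
case: p => [|q]; split=> [|e x].
- exact: sigma0Y_linear.
- exact: sigma0Y_lact.
- exact: sigma0_linear.
exact: sigma0_lact.
Qed.

Lemma sg_lmap p s l r' s' : (p + l)%N = r' -> s = (s' + l)%N ->
  linear (@sg p s l r' s') /\
  forall e x, sg l r' s' (lactXY e x) = X_lact e (@sg p s l r' s' x).
Proof.
elim/ltn_ind: l r' s' => -[|l] IH r' s' Er Es.
  rewrite -Er addn0; move: Es; rewrite addn0 => <-.
  split=> [c x y|e x]; rewrite !sg_0; first exact: (sg0_lmap p s).1.
  exact: (sg0_lmap p s).2.
case: r' Er => [|r'] Er; first by exfalso; lia.
have lm i (lt_i : (i < l.+1)%N) :
    [/\ linear (@sg p s i (p + i) (s - i)),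
        forall e x, sg i (p + i) (s - i) (lactXY e x) = X_lact e (@sg p s i (p + i) (s
          - i) x)
      & X_bimap (dl (l.+1 - i) (p + i) (s - i) r' s')].
  have [|l1 l2] := IH i lt_i (p + i)%N (s - i)%N erefl; first by lia.
  by split=> //; apply: dl_bimap; lia.
split=> [c x y|e x]; rewrite !sg_S /=.
  rewrite scalerN -opprD scaler_sumr -big_split; congr (- _).
  apply: eq_big_nat => i /andP[_ lt_i]; have [l1 l2 l3] := lm i lt_i.
  by rewrite l1 (bim_lin l3) (@sigma0_linear r' s').
rewrite (linN (@X_lact_linear _ _ e)) (lin_sum (@X_lact_linear _ _ e)); congr (- _).
apply: eq_big_nat => i /andP[_ lt_i]; have [l1 l2 l3] := lm i lt_i.
by rewrite l2 (bim_lact l3) (@sigma0_lact r' s').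
Qed.

Lemma oph'_linear : linear oph'.
Proof.
move=> c t t'; apply: XYP => -[|r] s'; rewrite XYprodD XYprodZ /=.
  by rewrite scaler0 addr0.
rewrite scaler_sumr -big_split; apply: eq_bigr => s /= ss'.
have lt_s := ltn_ord s; have [||l1 _] := @sg_lmap (r + s' - s) s (s - s') r s'; last
  exact: l1.
  lia.
lia.
Qed.

Lemma oph'_lact e t : oph' (lactT e t) = lactT e (oph' t).
Proof.
apply: XYP => -[|r] s'; first by rewrite /lactT /= (lin0 (@Y_lact_linear _ e)).
rewrite /lactT /= (lin_sum (@X_lact_linear _ _ e)).
apply: eq_bigr => s /= ss'.
have lt_s := ltn_ord s; have [||_ l2] := @sg_lmap (r + s' - s) s (s - s') r s'; last
  exact: l2.
  lia.
lia.
Qed.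

(** The term l = 0 is h; in every sigma^l with l > 0 the recursion exhibits a last factor h delta
    applied to some sigma^i with i < l. *)
Lemma oph'E t : oph' t = oph t - oph (opdelta (oph' t)).
Proof.
apply: XYP => -[|r] s'; first by rewrite XYprodD XYprodN subr0.
rewrite XYprodD XYprodN [LHS]/=.
have lt_s' : (s' < (r + s').+1)%N by lia.
rewrite (bigD1 (Ordinal lt_s')) //= subnn sg_0 addnK; congr (_ + _); first by case: (r).
case: r lt_s' => [|r] lt_s'.
  rewrite big_pred0 ?(lin0 (@bd_linear s')) ?(lin0 (@sigma0Y_linear s')) ?oppr0 // => i.
  have := ltn_ord i; rewrite -val_eqE /=; lia.
have lS := @sigma0_linear r s'.
rewrite (lin_sum lS).
transitivity (- \sum_(s < (r.+1 + s').+1 | (s' <= s)%N && (s != Ordinal lt_s'))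
  \sum_(i < (r + s').+2 | (s' < i <= s)%N) sigma0 r.+1 s' (dl (i - s') (r + s'.+1 - i)
    i r s'
    (sg (s - i) (r + s'.+1 - i) i (t (r.+1 + s' - s)%N s)))).
  rewrite -sumrN; apply: eq_bigr => s; rewrite -val_eqE /= => /andP[le_s ne_s].
  have lt_s := ltn_ord s; have [l El] : exists l, (s - s' = l.+1)%N by exists (s -
    s').-1; lia.
  rewrite El sg_S; congr (- _) => /=.
  transitivity (\sum_(0 <= i < l.+1 | (s' + l.+1 - i < (r + s').+2)%N)
    sigma0 r.+1 s' (dl (l.+1 - i) (r.+1 + s' - s + i) (s - i) r s'
     (sg i (r.+1 + s' - s + i) (s - i) (t (r.+1 + s' - s)%N s)))).
    rewrite big_nat_cond [RHS]big_nat_cond; apply: eq_bigl => i.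
    by case: (ltnP i l.+1) => //= _; lia.
  have Es : (s' + l.+1 = s)%N by lia.
  rewrite rev_sum Es; apply: eq_bigr => i /andP[lt_i le_i].
  have -> : (r.+1 + s' - s + (s - i) = r + s'.+1 - i)%N by lia.
  have -> : (s - (s - i) = i)%N by lia.
  by have -> : (l.+1 - (s - i) = i - s')%N by lia.
(* With the intermediate row i outside, the inner sum over sources is the component of h' in row
   i. *)
congr (- _); rewrite (exchange_big_dep (fun i : 'I__ => (s' < i)%N)) /=; last first.
  by move=> s i _ /andP[].
apply: eq_bigr => i lt_i; have lt_i2 := ltn_ord i.
have En : (r + s'.+1 - i + i = r.+1 + s')%N by lia.
rewrite En -(lin_sum lS); congr (@Defs.sigma0 k A H r s' r.+1 s' _).
rewrite (lin_sum (bim_lin (dl_bimap _ _))); [|lia|lia].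
apply: eq_bigl => s; rewrite -val_eqE /=; have := ltn_ord s; lia.
Qed.

(** Put z = h' t. From h delta h' = h - h' and D D = 0, h delta u = - h d delta z + h d t - h' D t.
    From t = h d t + d h t and h t = z + h delta z, u = h' D t - h d t + h d delta z. Hence u = - h
    delta u. *)
Lemma oph'_contraction t : opD (oph' t) + oph' (opD t) = t.
Proof.
apply/eqP; rewrite -subr_eq0; set u := _ - t; apply/eqP/oph_opdelta_inj.
have lh := oph_linear; have ld := opd_linear; have le := opdelta_linear.
have hde x : oph (opdelta (oph' x)) = oph x - oph' x.
  by apply/eqP; rewrite eq_sym subr_eq addrC -subr_eq -oph'E.
apply/eqP; rewrite -addr_eq0; apply/eqP.
rewrite {2}/u (linB le) (linB lh) (linD le) (linD lh) hde.
set z := oph' t in u *.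
have hdDz : oph (opdelta (opD z)) = - oph (opd (opdelta z)).
  have := opD_opD z; rewrite {1}/opD => /eqP; rewrite addrC addr_eq0 => /eqP ->.
  by rewrite {1}/opD (linD ld) opd_opd add0r (linN lh).
have tE : t = oph (opd t) + (opd z + opdelta z - oph (opd (opdelta z))).
  have dhz : opd (oph (opdelta z)) = opdelta z - oph (opd (opdelta z)).
    by rewrite -{2}[opdelta z]oph_opd addrC addKr.
  rewrite -addrA -dhz -(linD ld) -{1}[t]oph_opd; congr (_ + opd _).
  by apply/eqP; rewrite -subr_eq; apply/eqP/esym/oph'E.
rewrite hdDz /u {1}/opD [X in _ - X + _]tE {1 3}/opD (linD lh).
move: (opd z + opdelta z) (oph (opd (opdelta z))) (oph (opd t)) (oph (opdelta t)) (oph'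
  _).
move=> g w m n v; have -> : g + v - (m + (g - w)) = v - m + w.
  by rewrite opprD opprB (addrA (- m)) (addrA (g + v)) [g + v]addrC (addrAC (v + g))
    addrK addrA.
have -> : - w + (m + n - v) - n = - w + (m - v) by rewrite [m + n - v]addrAC addrA
  addrK.
by rewrite addrA addrK addrA subrK subrr.
Qed.

(** * The Hochschild resolution *)

Local Notation B_lact := (@B_lact k A H hH act f).
Local Notation B_ract := (@B_ract k A H hH act f).
Local Notation b' := (@b' k A H hH act f).
Local Notation xi := (@xi k A H).
Local Notation Bt := (@B_gt k A H).

Arguments B_gt : simpl never.

Lemma Bt_mulin n : mulin (Bt n).
Proof.
case=> [|x l1] l2; first exact: (Gmul_l (@Gt_mul k E E oneE n) l2).
exact: (Gmul_r (@Gt_mul k E E oneE n) x l1 l2).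
Qed.

Lemma Bt_normd n x : normd 1 oneE (fun l => Bt n (x :: l)).
Proof. exact: (Gmul_1 (@Gt_mul k E E oneE n) x). Qed.

Lemma Bt_size n es : size es != n.+2 -> Bt n es = 0.
Proof. by case: es => // x es sz; apply: Gt_size. Qed.

Lemma Bt_el n es : size es = n.+2 -> B_el n es = Bt n es.
Proof. by case: es => //= x es [sz]; rewrite /B_el /B_gt /Gt sz eqxx. Qed.

Lemma B_lact_spec n e : linear (@B_lact n e) /\
  forall es, B_lact e (Bt n es) = if es is x :: l then Bt n (e ** x :: l) else 0.
Proof.
apply: B_linext => [|[|x l] sz|[[|x l] sz]] //=.
- split=> [l|x|x].
  + exact: (linear_comp (mulin_head l (@Bt_mulin n)) (mulE_linearr e)).
  + exact: mulin_cons (@Bt_mulin n).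
  exact: Bt_normd.
- exact: Bt_size.
by rewrite Bt_el //; apply/eqP.
Qed.

Lemma B_ract_spec n e : linear (fun x => @B_ract n x e) /\
  forall es, B_ract (Bt n es) e = onlast (fun l z => Bt n (rcons l (z ** e))) es.
Proof.
have mQ : mulin (onlast (fun l z => Bt n (rcons l (z ** e)))).
  apply: onlast_mulin => [z l1 l2|l].
    apply: (linear_eq _ (@Bt_mulin n l1 (rcons l2 (z ** e)))) => m.
    by rewrite rcons_cat rcons_cons.
  apply: (linear_eq _ (linear_comp (@Bt_mulin n l [::]) (mulE_linearl e))) => m.
  by rewrite cats1.
apply: B_linext => [|es|[es sz]].
- split=> [l|x|x]; first exact: (mQ [::] l).
    exact: mulin_cons mQ.
  move=> l1; case/lastP=> // l2 z _.
  rewrite -rcons_cons -rcons_cat -rcons_cons onlast_rcons rcons_cons rcons_cat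
    rcons_cons.
  by rewrite Bt_normd // size_rcons.
- case/lastP: es => // es z; rewrite size_rcons onlast_rcons => sz.
  by rewrite Bt_size // size_rcons.
case/lastP: es sz => // es z sz /=; rewrite onlast_rcons.
have sze : size es = n.+1 by move: (sz); rewrite size_rcons => /eqP[].
by rewrite -sze nth_rcons ltnn eqxx -[rcons es z]cats1 take_size_cat // Bt_el //
  size_rcons sze.
Qed.

Lemma B_lact_linear n e : linear (@B_lact n e). Proof. by case: (B_lact_spec n e). Qed.
Lemma B_ract_linear n e : linear (fun x => @B_ract n x e).
Proof. by case: (B_ract_spec n e). Qed.
Lemma B_lactE n e x l : B_lact e (Bt n (x :: l)) = Bt n (e ** x :: l).
Proof. by rewrite (B_lact_spec n e).2. Qed.
Lemma B_ractE n e l z : B_ract (Bt n (rcons l z)) e = Bt n (rcons l (z ** e)).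
Proof. by rewrite (B_ract_spec n e).2 onlast_rcons. Qed.

Lemma B_ext2 n W (u v : B A H n -> W) : linear u -> linear v ->
    (forall x l z, size l = n ->
       u (Bt n (x :: rcons l z)) = v (Bt n (x :: rcons l z))) ->
  u =1 v.
Proof.
move=> lu lv uv; apply: B_ext => // -[|x l] //; case/lastP: l => // l z.
by rewrite /= size_rcons => -[sz]; apply: uv.
Qed.

Lemma B_bimodule n : bimodule (@B_lact n) (@B_ract n).
Proof.
have lL e := @B_lact_linear n e; have lR e := @B_ract_linear n e.
have rE e x l z : B_ract (Bt n (x :: rcons l z)) e = Bt n (x :: rcons l (z ** e)).
  by rewrite -rcons_cons B_ractE.
split=> //.
- move=> x c a b; move: x; apply: B_ext2 => // [|x l z _].
    by apply: linear_add => //; apply: linear_scale.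
  rewrite !B_lactE mulE_linearl; exact: (@Bt_mulin n [::]).
- move=> x c a b; move: x; apply: B_ext2 => // [|x l z _].
    exact: (linear_add (linear_scale _ (lR a)) (lR b)).
  by rewrite !rE mulE_linearr -!cats1 -!cat_cons (@Bt_mulin n (x :: l) [::]).
- move=> a b; apply: B_ext2 => // [|x l z _]; first exact: linear_comp (lL a) (lL b).
  by rewrite !B_lactE mulEA.
- move=> x a b; move: x; apply: B_ext2 => [||x l z _] //.
    exact: (linear_comp (lR b) (lR a)).
  by rewrite !rE mulEA.
- move=> a x b; move: x; apply: B_ext2 => [||x l z _].
  + exact: (linear_comp (lR b) (lL a)).
  + exact: (linear_comp (lL a) (lR b)).
  by rewrite !(B_lactE, rE).
- by apply: B_ext2 => // x l z _; rewrite B_lactE mul1E.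
by apply: B_ext2 => // x l z _; rewrite rE mulE1.
Qed.

Lemma b'_spec n : linear (@b' n) /\
  forall es, b' (Bt n.+1 es) = altl mulE (Bt n) es.
Proof.
have mG := altl_mulin mulE_bilinear (@Bt_mulin n).
apply: B_linext => [|[|x l] sz|[[|x l] sz]] //=.
- split=> [l|x|x]; first exact: (mG [::] l).
    exact: mulin_cons mG.
  move=> l1 l2 l2P; apply: (@alt_unit _ _ _ oneE) => //.
  + exact: mul1E.
  + exact: mulE1.
  by move=> e l l' l'P; apply: Bt_normd.
- by apply: alt_eq0 => t szt _; apply: Bt_size; rewrite szt -eqSS.
have szl : size l = n.+2 by case/eqP: (sz).
rewrite (alt_sum _ _ 0) szl; apply: eq_bigr => i _; congr (_ *: _).
rewrite -[take i _ ++ _]/(mergeE hH act f i (x :: l)) Bt_el //.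
have lt_i := ltn_ord i; rewrite /mergeE size_cat size_takel /= ?size_drop ?szl //; lia.
Qed.

Lemma b'_linear n : linear (@b' n). Proof. by case: (b'_spec n). Qed.
Lemma b'_Bt n x l : b' (Bt n.+1 (x :: l)) = alt mulE (Bt n) x l.
Proof. by rewrite (b'_spec n).2. Qed.

Lemma xi_spec n : linear (@xi n) /\
  forall es, xi (Bt n es) = (-1) ^+ n.+1 *: Bt n.+1 (rcons es oneE).
Proof.
apply: B_linext => [|es sz|[es sz]].
- apply: (Gmul_comp (linear_scale _ (@linear_id _ _))); split=> [l|x l1 l2|x l1 l2 l2P].
  + exact: (@Bt_mulin n.+1 [::] (rcons l oneE)).
  + apply: (linear_eq _ (@Bt_mulin n.+1 (x :: l1) (rcons l2 oneE))) => m.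
    by rewrite rcons_cons rcons_cat.
  by rewrite rcons_cons rcons_cat rcons_cons Bt_normd // size_rcons.
- by rewrite Bt_size ?scaler0 // size_rcons.
by rewrite Bt_el // size_rcons (eqP sz).
Qed.

Lemma xi_linear n : linear (@xi n). Proof. by case: (xi_spec n). Qed.
Lemma xi_Bt n es : xi (Bt n es) = (-1) ^+ n.+1 *: Bt n.+1 (rcons es oneE).
Proof. by rewrite (xi_spec n).2. Qed.

Lemma xi_lact n e (x : B A H n) : xi (B_lact e x) = B_lact e (xi x).
Proof.
move: x; apply: B_ext2 => [||x l z _].
- exact: (linear_comp (@xi_linear n) (@B_lact_linear n e)).
- exact: (linear_comp (@B_lact_linear _ e) (@xi_linear n)).
by rewrite B_lactE !xi_Bt (linZ (@B_lact_linear _ e)) rcons_cons B_lactE.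
Qed.

Lemma b'_lact n e (x : B A H n.+1) : b' (B_lact e x) = B_lact e (b' x).
Proof.
move: x; apply: B_ext2 => [||x l z _].
- exact: (linear_comp (@b'_linear n) (@B_lact_linear _ e)).
- exact: (linear_comp (@B_lact_linear _ e) (@b'_linear n)).
rewrite B_lactE !b'_Bt (lin_alt _ _ _ _ (@B_lact_linear _ e)).
apply/esym/alt_lmul; first by move=> *; apply: mulEA.
by move=> y t; apply: B_lactE.
Qed.

Lemma b'_ract n (x : B A H n.+1) e : b' (B_ract x e) = B_ract (b' x) e.
Proof.
move: x; apply: B_ext2 => [||x l z _].
- exact: (linear_comp (@b'_linear n) (@B_ract_linear _ e)).
- exact: (linear_comp (@B_ract_linear _ e) (@b'_linear n)).
rewrite -rcons_cons B_ractE rcons_cons !b'_Bt (lin_alt _ _ _ _ (@B_ract_linear _ e)).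
apply/esym/alt_rcons_mul; first by move=> *; apply: mulEA.
exact: B_ractE.
Qed.

Lemma b'_xi n (x : B A H n.+1) : b' (xi x) + xi (b' x) = x.
Proof.
move: x; apply: B_ext2 => [||x l z sz].
- apply: linear_add.
    exact: (linear_comp (@b'_linear _) (@xi_linear _)).
  exact: (linear_comp (@xi_linear _) (@b'_linear _)).
- exact: linear_id.
rewrite xi_Bt (linZ (@b'_linear _)) rcons_cons !b'_Bt.
rewrite alt_rcons_unit; last exact: mulE1.
rewrite (lin_alt _ _ _ _ (@xi_linear n)).
have -> : alt mulE (fun y => xi (Bt n y)) x (rcons l z) =
    alt mulE (fun y => (-1) ^+ n.+1 *: Bt n.+1 (rcons y oneE)) x (rcons l z).
  by apply: eq_alt => t _; rewrite xi_Bt.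
rewrite -(lin_alt _ _ _ _ (linear_scale _ (@linear_id _ _))) size_rcons sz scalerDr
  scalerA.
rewrite -expr2 sqrr_sign scale1r exprS mulN1r scaleNr.
by rewrite addrAC addNr add0r.
Qed.

(** Multiplication B_0 -> E followed by xi_0, that is x (x) z to xz (x) 1. *)
Definition B0_aug (x : B A H 0) := x - b' (xi x).

Lemma B0_aug_linear : linear B0_aug.
Proof.
apply: linear_sub; first exact: linear_id.
exact: (linear_comp (@b'_linear 0) (@xi_linear 0)).
Qed.

Lemma B0_augE x z : B0_aug (Bt 0 [:: x; z]) = Bt 0 [:: x ** z; oneE].
Proof.
rewrite /B0_aug xi_Bt (linZ (@b'_linear 0)) b'_Bt expr1 scaleN1r opprK /= mulE1 subr0.
by rewrite addrC subrK.
Qed.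

Lemma B0_aug_b' (x : B A H 1) : B0_aug (b' x) = 0.
Proof.
move: x; apply: B_ext2 => [||x l z].
- exact: (linear_comp B0_aug_linear (@b'_linear 0)).
- exact: linear_zero.
case: l => [|y []] //= _.
by rewrite b'_Bt /= subr0 (linB B0_aug_linear) !B0_augE mulEA subrr.
Qed.

Lemma B_ract_unit n x l z :
  Bt n (x :: rcons l z) = B_ract (Bt n (x :: rcons l oneE)) z.
Proof. by rewrite -!rcons_cons B_ractE mul1E. Qed.

Lemma xi_unit n x l : Bt n.+1 (x :: rcons l oneE) = xi ((-1) ^+ n.+1 *: Bt n (x :: l)).
Proof.
by rewrite (linZ (@xi_linear n)) xi_Bt scalerA -expr2 sqrr_sign scale1r.
Qed.

(** Elements ending in 1 lie in the image of xi and generate on the right; there b' xi = 1 - xi b'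
    reduces to lower degree, and at the bottom to the augmentation. *)
Lemma b'_b' n (x : B A H n.+2) : b' (b' x) = 0.
Proof.
have lbb m : linear (fun x : B A H m.+2 => b' (b' x)).
  exact: (linear_comp (@b'_linear m) (@b'_linear m.+1)).
elim: n x => [|n IH]; apply: B_ext2 => [||x l z _] //; try exact: linear_zero.
  rewrite B_ract_unit !b'_ract xi_unit; set y := _ *: _.
  have /(canRL (addrK _)) -> := b'_xi y.
  rewrite (linB (@b'_linear _)) -/(B0_aug (b' y)) B0_aug_b'.
  exact: lin0 (@B_ract_linear _ z).
rewrite B_ract_unit !b'_ract xi_unit; set y := _ *: _.
have /(canRL (addrK _)) -> := b'_xi y.
rewrite (linB (@b'_linear _)); have /(canRL (addrK _)) -> := b'_xi (b' y).
rewrite IH (lin0 (@xi_linear n)) subr0 subrr.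
exact: lin0 (@B_ract_linear _ z).
Qed.

(** * The complex X *)

Local Notation Xn := (Xn A H).
Local Notation dX := (@dX k A H hH act f).
Local Notation sigmabar := (@sigmabar k A H hH act f).
Local Notation dsummand := (@dsummand k A H hH act f).
Local Notation Xn_lact := (@Xn_lact k A H hH act f).
Local Notation Xn_ract := (@Xn_ract k A H hH act f).

Lemma opdelta_lact e t : opdelta (lactT e t) = lactT e (opdelta t).
Proof.
apply: XYP => -[|r] s; first exact: bd_lact.
rewrite /lactT /= (lin_sum (@X_lact_linear _ _ e)); apply: eq_bigr => s1 /= ss1.
by have lt_s1 := ltn_ord s1; apply: (bim_lact (dl_bimap _ _)); lia.
Qed.
Lemma opD_lact e t : opD (lactT e t) = lactT e (opD t).
Proof.
rewrite /opD opd_lact opdelta_lact; apply: XYP => r s.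
by rewrite XYprodD /lactT -(linD (@lactXY_linear r s e)).
Qed.
Lemma dirac_lact r s e (y : XY r s) : dirac (lactXY e y) = lactT e (dirac y).
Proof.
apply: XYP => r' s'; rewrite /lactT.
have [[<- <-]|rs] := eqVneq (r, s) (r', s'); first by rewrite !dirac_same.
by rewrite !dirac_neq // (lin0 (@lactXY_linear _ _ _)).
Qed.

(** [prX] and [emX] pass between X_n and the product, so that [dX] and [sigmabar] inherit their
    identities from D and h'. The column is shifted by one as column 0 holds Y. *)
Definition prX n t : Xn n := [ffun s : 'I_n.+1 => (t (n - s).+1 s : X A H (n - s) s)].
Definition emX n (x : Xn n) : XYprod := \sum_(s < n.+1) @dirac (n - s).+1 s (x s).

Lemma XnP n (x y : Xn n) : (forall s, x s = y s) -> x = y.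
Proof. by move=> E; apply/ffunP. Qed.
Lemma XnD n (x y : Xn n) s : (x + y) s = x s + y s. Proof. exact: ffunE. Qed.
Lemma XnZ n c (x : Xn n) s : (c *: x) s = c *: x s. Proof. exact: ffunE. Qed.
Lemma Xn0 n s : (0 : Xn n) s = 0. Proof. exact: ffunE. Qed.
Lemma Xn_sum n m (F : 'I_m -> Xn n) s : (\sum_i F i) s = \sum_i F i s.
Proof. exact: (big_morph (fun x : Xn n => x s) (fun x y => XnD x y s) (Xn0 s)). Qed.
Lemma XYprod_sum m (F : 'I_m -> XYprod) r s : (\sum_i F i) r s = \sum_i F i r s.
Proof. exact: (big_morph (fun t : XYprod => t r s) (id1 := 0) (op1 := +%R)). Qed.

Lemma prXE n t s : prX n t s = t (n - s).+1 s. Proof. exact: ffunE. Qed.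

Lemma prX_linear n : linear (@prX n).
Proof. by move=> c t t'; apply: XnP => s; rewrite XnD XnZ !prXE. Qed.

Lemma prX_lact n e t : prX n (lactT e t) = Xn_lact e (prX n t).
Proof. by apply: XnP => s; rewrite !ffunE. Qed.
Lemma prX_ract n e t : prX n (ractT e t) = Xn_ract (prX n t) e.
Proof. by apply: XnP => s; rewrite !ffunE. Qed.

Lemma emX_linear n : linear (@emX n).
Proof.
apply: linear_big => s c x y; rewrite XnD XnZ; exact: dirac_linear.
Qed.

Lemma emXK n (x : Xn n) : prX n (emX x) = x.
Proof.
apply: XnP => s; rewrite prXE /emX XYprod_sum (bigD1 s) //= dirac_same.
rewrite big1 ?addr0 // => s1 ns1; rewrite dirac_neq // xpair_eqE negb_and orbC.
by rewrite -val_eqE in ns1; rewrite ns1.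
Qed.

Lemma lactT_linear e : linear (lactT e).
Proof. by move=> c t t'; apply: XYP => r s; apply: lactXY_linear. Qed.
Lemma ractT_linear e : linear (ractT e).
Proof. by move=> c t t'; apply: XYP => r s; apply: ractXY_linear. Qed.

Lemma emX_lact n e (x : Xn n) : emX (Xn_lact e x) = lactT e (emX x).
Proof.
rewrite /emX (lin_sum (@lactT_linear e)); apply: eq_bigr => s _.
by rewrite ffunE -dirac_lact.
Qed.
Lemma emX_ract n e (x : Xn n) : emX (Xn_ract x e) = ractT e (emX x).
Proof.
rewrite /emX (lin_sum (@ractT_linear e)); apply: eq_bigr => s _.
by rewrite ffunE -dirac_ract.
Qed.

Lemma Xn_bimodule n : bimodule (@Xn_lact n) (@Xn_ract n).
Proof.
split.
- move=> e c x y; apply: XnP => s; rewrite XnD XnZ !ffunE; exact: X_lact_linear.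
- move=> e c x y; apply: XnP => s; rewrite XnD XnZ !ffunE; exact: X_ract_linear.
- move=> x c a b; apply: XnP => s; rewrite XnD XnZ !ffunE; exact: (bim_ll (X_bimodule _
  _)).
- move=> x c a b; apply: XnP => s; rewrite XnD XnZ !ffunE; exact: (bim_rr (X_bimodule _
  _)).
- move=> a b x; apply: XnP => s; rewrite !ffunE; exact: (bim_lA (X_bimodule _ _)).
- move=> x a b; apply: XnP => s; rewrite !ffunE; exact: (bim_rA (X_bimodule _ _)).
- move=> a x b; apply: XnP => s; rewrite !ffunE; exact: (bim_lr (X_bimodule _ _)).
- move=> x; apply: XnP => s; rewrite !ffunE; exact: (bim_l1 (X_bimodule _ _)).
move=> x; apply: XnP => s; rewrite !ffunE; exact: (bim_r1 (X_bimodule _ _)).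
Qed.

(** No Y-component feeds an X-component of D, so the projection to degree n discards nothing that
    matters. *)
Lemma dX_prX n t : dX (prX n.+1 t) = prX n (opD t).
Proof.
apply: XnP => s'; rewrite /Defs.dX Xn_sum prXE /opD XYprodD /=.
have lt_s' := ltn_ord s'.
have lt_s2 : (s' < n.+2)%N by lia.
rewrite (bigD1 (Ordinal lt_s2)) //=; congr (_ + _).
  rewrite ffunE /= leqnn subnn dl_0 prXE /=.
  by have -> : (n.+1 - s' = (n - s').+1)%N by lia.
have -> : (n - s' + s' = n)%N by lia.
rewrite (bigID (fun i : 'I__ => (s' < i)%N)) /= [X in _ + X]big1 ?addr0 => [|i].
  apply: eq_big => [i|i /andP[_ lt_i]]; first by rewrite -val_eqE /=; lia.
  rewrite ffunE prXE (ltnW lt_i).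
  by have -> : (n - s' + s'.+1 - i = n.+1 - i)%N by lia.
rewrite -val_eqE /= ffunE => /andP[ne le].
by case: leqP => //; lia.
Qed.

Lemma dsummand_prX n (s : 'I_n.+2) (x : X A H (n.+1 - s) s) :
  dsummand x = prX n (opD (@dirac (n.+1 - s).+1 s x)).
Proof.
apply: XnP => s'; rewrite ffunE prXE opD_dirac.
have lt_s := ltn_ord s; have lt_s' := ltn_ord s'.
have -> : (n - s' + s'.+1 == n.+1 - s + s)%N by apply/eqP; lia.
by rewrite andbT.
Qed.

Lemma dX_emX n (x : Xn n.+1) : dX x = prX n (opD (emX x)).
Proof. by rewrite -{1}(emXK x) dX_prX. Qed.

Lemma dX_linear n : linear (@dX n).
Proof.
apply: (linear_eq (u := fun x : Xn n.+1 => prX n (opD (emX x)))).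
  by move=> x; rewrite dX_emX.
exact: (linear_comp (@prX_linear n) (linear_comp opD_linear (@emX_linear n.+1))).
Qed.

Lemma dX_ract n (x : Xn n.+1) e : dX (Xn_ract x e) = Xn_ract (dX x) e.
Proof. by rewrite !dX_emX emX_ract opD_ract prX_ract. Qed.

Lemma dX_dX n (x : Xn n.+2) : dX (dX x) = 0.
Proof.
by rewrite (dX_emX x) dX_prX opD_opD (lin0 (@prX_linear n)).
Qed.

(* Without the column Y, the identity D h' + h' D = 1 leaves a term h' mu; opV is the
   correction that removes it. *)
Definition opV t : XYprod :=
  mkXY (fun r s => 0)
    (fun s => if s is s'.+1 return Y A H s then sigmam1 (mu (t 1%N s' : X A H 0 s'))
      else 0).
Definition cutY t : XYprod := mkXY (fun r s => t r.+1 s) (fun s => 0).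

Lemma opV_linear : linear opV.
Proof.
move=> c t t'; apply: XYP => -[|r] [|s]; rewrite XYprodD XYprodZ /= ?scaler0 ?addr0 //.
exact: (linear_comp (@sigmam1_linear s) (@mu_linear s)).
Qed.
Lemma cutY_linear : linear cutY.
Proof. by move=> c t t'; apply: XYP => -[|r] s; rewrite XYprodD XYprodZ /= ?scaler0
  ?addr0. Qed.

Lemma sigmam1_lact s e (y : Y A H s) : sigmam1 (Y_lact e y) = Y_lact e (sigmam1 y).
Proof.
move: y; apply: Y_ext => [||x hs _].
- exact: (linear_comp (@sigmam1_linear s) (@Y_lact_linear s e)).
- exact: (linear_comp (@Y_lact_linear _ e) (@sigmam1_linear s)).
by rewrite Y_lactE !(sigmam1_spec _).2 (linZ (@Y_lact_linear _ e)) Y_lactE.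
Qed.

Lemma opV_lact e t : opV (lactT e t) = lactT e (opV t).
Proof.
apply: XYP => -[|r] s; rewrite /lactT /=; last by rewrite (lin0 (@X_lact_linear _ _ e)).
case: s => [|s]; first by rewrite (lin0 (@Y_lact_linear _ e)).
by rewrite mu_lact sigmam1_lact.
Qed.
Lemma cutY_lact e t : cutY (lactT e t) = lactT e (cutY t).
Proof.
by apply: XYP => -[|r] s; rewrite /lactT //= (lin0 (@Y_lact_linear _ e)).
Qed.

Lemma sigmabar_prX n t : sigmabar (prX n t) = prX n.+1 (oph' (cutY t - opV t)).
Proof.
apply: XnP => s'; rewrite ffunE [RHS]prXE /=.
have lt_s' := ltn_ord s'.
have -> : (n.+1 - s' + s' = n.+1)%N by lia.
have le_s' : (s' <= n.+1)%N by lia.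
(* The top index s = n+1 is the column Y, where [cutY] vanishes and -[opV] supplies - sigma^(-1) mu;
   the other indices are columns of X. *)
rewrite [RHS]big_mkcond big_ord_recr /= -big_mkcond le_s' [RHS]addrC; congr (_ + _).
  have [||l1 _] := @sg_lmap 0 n.+1 (n.+1 - s') (n.+1 - s') s'; [by []|lia|].
  rewrite prXE !subnn; transitivity (- @sg 0 n.+1 (n.+1 - s') (n.+1 - s') s'
    (sigmam1 (mu (t 1%N n : X A H 0 n)))); first by [].
  rewrite -(linN l1); congr (@sg 0 n.+1 (n.+1 - s') (n.+1 - s') s' _).
  by rewrite XYprodD XYprodN /= sub0r.
apply: eq_bigr => s le_s; have lt_s := ltn_ord s; rewrite prXE.
have -> : (n.+1 - s = (n - s).+1)%N by lia.
by rewrite XYprodD XYprodN /= subr0.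
Qed.

Lemma sigmabar_emX n (x : Xn n) :
  sigmabar x = prX n.+1 (oph' (cutY (emX x) - opV (emX x))).
Proof. by rewrite -{1}(emXK x) sigmabar_prX. Qed.

Lemma sigmabar_linear n : linear (@sigmabar n).
Proof.
apply: (linear_eq (u := fun x : Xn n => prX n.+1 (oph' (cutY (emX x) - opV (emX x))))).
  by move=> x; rewrite sigmabar_emX.
apply: (linear_comp (@prX_linear n.+1) (linear_comp oph'_linear _)).
exact: linear_sub (linear_comp cutY_linear (@emX_linear n))
  (linear_comp opV_linear (@emX_linear n)).
Qed.

Lemma sigmabar_lact n e (x : Xn n) : sigmabar (Xn_lact e x) = Xn_lact e (sigmabar x).
Proof.
rewrite !sigmabar_emX emX_lact cutY_lact opV_lact -(linB (@lactT_linear e)).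
by rewrite oph'_lact prX_lact.
Qed.

Lemma opV_Y t r s : opV t r.+1 s = 0. Proof. by []. Qed.

(** This is the Y-component of D D = 0 at the part of t outside Y. *)
Lemma mu_opD t s : mu (opD t 1%N s : X A H 0 s) = - bd s (mu (t 1%N s.+1 : X A H 0
  s.+1)).
Proof.
have /eqP : opD (opD (cutY t)) 0%N s = 0 by rewrite opD_opD.
rewrite {1}/opD XYprodD /= addr_eq0 => /eqP ->.
by rewrite /opD XYprodD /= (lin0 (@bd_linear _)) addr0.
Qed.

(** [tV] commutes with D on X-components, and on Y_s with s > 0 because ∂ sigma^(-1) + sigma^(-1) ∂
    = 1. In Y_0 the second term is missing, which leaves the augmentation. *)
Lemma opD_sbar t (tV := fun t => cutY t - opV t) :
  opD (oph' (tV t)) + oph' (tV (opD t)) =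
  tV t - oph' (@dirac 0%N 0%N (Y0_aug (mu (t 1%N 0%N : X A H 0 0)))).
Proof.
have /(canRL (addrK _)) -> := oph'_contraction (tV t).
rewrite -addrA; congr (_ + _); rewrite -(linN oph'_linear) -(linD oph'_linear) -(linN
  oph'_linear).
congr oph'; rewrite /tV (linB opD_linear); have [V1 V2] := @opD_Y (opV t) (@opV_Y t).
apply: XYP => -[|r] s; rewrite !(XYprodD, XYprodN) ?V1 ?V2; last first.
  by rewrite dirac_neq // !subr0 /= oppr0 addNr.
have E : opD (cutY t) 0%N s = mu (t 1%N s : X A H 0 s).
  by rewrite /opD XYprodD /= (lin0 (@bd_linear _)) addr0.
rewrite E; case: s E => [|s] _ /=; first by rewrite dirac_same subrr addr0.
rewrite dirac_neq // mu_opD (linN (@sigmam1_linear s)) opprK add0r oppr0 opprB.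
set m := mu _; by rewrite -[X in _ - X + _](bd_sigmam1 m) opprD addrA subrr add0r addNr.
Qed.

(** sigma^l lowers the row by l, so from Y_0 only sigma^0 into X_00 is possible. *)
Lemma oph'_dirac00 (y : Y A H 0) r s : (0 < r + s)%N -> oph' (@dirac 0%N 0%N y) r.+1 s
  = 0.
Proof.
move=> rs; apply: big1 => s1 le_s; have lt_s := ltn_ord s1.
have [||l1 _] := @sg_lmap (r + s - s1) s1 (s1 - s) r s; [lia|lia|].
by rewrite dirac_neq ?(lin0 l1) // xpair_eqE; lia.
Qed.

Lemma dX_sigmabar n (x : Xn n.+1) : dX (sigmabar x) + sigmabar (dX x) = x.
Proof.
rewrite {1}sigmabar_emX dX_prX dX_emX sigmabar_prX -(linD (@prX_linear _)) opD_sbar.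
rewrite -[RHS]emXK; apply: XnP => s; rewrite !prXE !(XYprodD, XYprodN).
rewrite oph'_dirac00 ?oppr0 ?addr0 ?subr0 //.
by have := ltn_ord s; lia.
Qed.

Lemma dX_sigmabar0 (x : Xn 0) :
  dX (sigmabar x) ord0 = x ord0 - sigma0Y 0 0 (Y0_aug (mu (x ord0 : X A H 0 0))).
Proof.
have z y : oph' y 1%N 0%N = sigma0Y 0 0 (y 0%N 0%N).
  by rewrite [LHS]big_ord_recl big_ord0 addr0; apply: sg_0.
have E := congr1 (fun t : XYprod => t 1%N 0%N) (opD_sbar (emX x)).
rewrite sigmabar_emX dX_prX prXE; move: E; rewrite !(XYprodD, XYprodN) !z dirac_same.
rewrite XYprodD XYprodN /= subr0 (lin0 (@sigma0Y_linear 0)) addr0 subr0 => ->.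
by have /= -> := esym (prXE (emX x) (@ord0 0)); rewrite emXK.
Qed.

Definition inX n (s : 'I_n.+1) (y : X A H (n - s) s) : Xn n :=
  prX n (@dirac (n - s).+1 s y).

Lemma inX_linear n s : linear (@inX n s).
Proof.
by move=> c x y; rewrite /inX (@dirac_linear (n - s).+1 s c x y) (@prX_linear n).
Qed.

Lemma inX_sum n (x : Xn n) : x = \sum_s @inX n s (x s).
Proof. by rewrite -{1}[x]emXK /emX (lin_sum (@prX_linear n)). Qed.

Lemma inX_lact n (s : 'I_n.+1) e (y : X A H (n - s) s) :
  @inX n s (X_lact e y) = Xn_lact e (@inX n s y).
Proof. by rewrite /inX -prX_lact -dirac_lact. Qed.
Lemma inX_ract n (s : 'I_n.+1) e (y : X A H (n - s) s) :
  @inX n s (X_ract y e) = Xn_ract (@inX n s y) e.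
Proof. by rewrite /inX -prX_ract -dirac_ract. Qed.

Lemma inX_neq n (s s' : 'I_n.+1) (y : X A H (n - s) s) : s' != s -> @inX n s y s' = 0.
Proof.
move=> ne; rewrite prXE dirac_neq // xpair_eqE negb_and orbC.
by rewrite eq_sym in ne; rewrite -val_eqE in ne; rewrite ne.
Qed.
Lemma inX_same n (s : 'I_n.+1) (y : X A H (n - s) s) : @inX n s y s = y.
Proof. by rewrite prXE dirac_same. Qed.

Lemma dsummandE n (s : 'I_n.+2) (y : X A H (n.+1 - s) s) : dsummand y = dX (@inX n.+1 s
  y).
Proof. by rewrite dsummand_prX dX_prX. Qed.

Lemma Xn_ext n W (u v : Xn n -> W) : linear u -> linear v ->
    (forall (s : 'I_n.+1) e hs as_ z,
       u (@inX n s (Xt (n - s) s e hs as_ z)) = v (@inX n s (Xt (n - s) s e hs as_ z)))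
         ->
  u =1 v.
Proof.
move=> lu lv uv x; rewrite (inX_sum x) (lin_sum lu) (lin_sum lv); apply: eq_bigr => s _.
move: (x s); apply: X_ext => [||e hs as_ z _ _]; last exact: uv.
- exact: (linear_comp lu (@inX_linear n s)).
exact: (linear_comp lv (@inX_linear n s)).
Qed.

(** Unfolded, every sigma^l applies sigma^0 to x first. *)
Lemma sg_eq0 p s l r' s' (x : XY p s) : sg0 p s x = 0 ->
  (p + l)%N = r' -> s = (s' + l)%N -> @sg p s l r' s' x = 0.
Proof.
move=> x0; elim/ltn_ind: l r' s' => -[|l] IH r' s' Er Es.
  by move: Er Es; rewrite sg_0 !addn0 => <- <-.
rewrite sg_S; case: r' Er => [|r'] Er; first by exfalso; lia.
rewrite big_nat big1 ?oppr0 // => i /andP[_ lt_i].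
rewrite IH //; last by lia.
rewrite (lin0 (bim_lin (dl_bimap _ _))) ?(lin0 (@sigma0_linear r' s')) //=; lia.
Qed.

(** * The comparison maps *)

Local Notation phi := (@phi k A H hH act f).
Local Notation psi := (@psi k A H hH act f).
Local Notation omega := (@omega k A H hH act f).

Record lmap V W (lV : E -> V -> V) (lW : E -> W -> W) (u : V -> W) : Prop := {
  lmap_lin : linear u;
  lmap_lact : forall e x, u (lV e x) = lW e (u x) }.

Lemma lmap_comp V1 V2 V3 l1 l2 l3 (u : V1 -> V2) (v : V2 -> V3) :
  lmap l1 l2 u -> lmap l2 l3 v -> lmap l1 l3 (fun x => v (u x)).
Proof.
move=> [u1 u2] [v1 v2]; split; first exact: (linear_comp v1 u1).
by move=> e x; rewrite u2 v2.
Qed.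

Section RightExtension.
Variables (V : lmodType k) (lV : E -> V -> V) (rV : V -> E -> V).
Hypothesis bV : bimodule lV rV.

(** Elements ending in 1 generate freely on the right, so a left linear u prescribed on them extends
    to a bimodule map. [phi] is built in this way, and [psi] and [omega] by the analogue for B. *)
Lemma X_rext r s (u : X A H r s -> V)
    (v := linext (@X_of k A H r s) (fun g =>
       rV (u (X_tens r s (cr (xa0 g) (xhs g)`_0) (behead (xhs g)) (xas g) oneE))
          (cr (xas g)`_r (xh g)))) : lmap (@X_lact r s) lV u ->
  [/\ linear v, forall e x, v (X_lact e x) = lV e (v x),
      forall x e, v (X_ract x e) = rV (v x) e
    & forall e hs as_, v (Xt r s e hs as_ oneE) = u (Xt r s e hs as_ oneE)].
Proof.
move=> [lu ul].
have mu1 z := Xmul_comp (linear_comp (bim_r bV z) lu) (Xmul_t r s).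
have [|||lv vE] := @X_linext k A H r s V
    (fun e hs as_ z => rV (u (Xt r s e hs as_ oneE)) z)
    (fun g => rV (u (X_tens r s (cr (xa0 g) (xhs g)`_0) (behead (xhs g)) (xas g) oneE))
          (cr (xas g)`_r (xh g))).
- split=> *.
  + exact: (Xmul_l (mu1 _)).
  + exact: (Xmul_H (mu1 _)).
  + exact: (Xmul_H1 (mu1 _)).
  + exact: (Xmul_A (mu1 _)).
  + exact: (Xmul_A1 (mu1 _)).
  exact: (bim_rr bV).
- by move=> e hs as_ z sz; rewrite Xt_size // (lin0 lu) (lin0 (bim_r bV z)).
- move=> a0 h0 hs as_ a h sh sa /=.
  have szh : size hs = s by case/eqP: (sh).
  have sza : size as_ = r by move: (sa); rewrite size_rcons => /eqP[].
  rewrite nth_rcons sza ltnn eqxx; congr (rV (u _) _).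
  rewrite /X_gt szh sza !eqxx /= /X_tens map_rcons -cats1 tpow_el_cat //.
  by rewrite size_map.
rewrite -/v in lv vE; split=> //; last by move=> e hs as_; rewrite vE (bim_r1 bV).
  move=> e; apply: X_ext => [||x hs as_ z _ _].
  - exact: (linear_comp lv (@X_lact_linear r s e)).
  - exact: (linear_comp (bim_l bV e) lv).
  by rewrite X_lactE !vE -(bim_lr bV) -ul X_lactE.
move=> x e; move: x; apply: X_ext => [||x hs as_ z _ _].
- exact: (linear_comp lv (@X_ract_linear r s e)).
- exact: (linear_comp (bim_r bV e) lv).
by rewrite X_ractE !vE (bim_rA bV).
Qed.

Lemma B_rext n (u : B A H n -> V)
    (v := linext (@B_of k A H n) (fun xs =>
       rV (u (B_el n (rcons (take n.+1 xs) oneE))) xs`_n.+1)) :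
    lmap (@B_lact n) lV u ->
  [/\ linear v, forall e x, v (B_lact e x) = lV e (v x),
      forall x e, v (B_ract x e) = rV (v x) e
    & forall x l, v (Bt n (x :: rcons l oneE)) = u (Bt n (x :: rcons l oneE))].
Proof.
move=> [lu ul].
pose F := onlast (fun l z => rV (u (Bt n (rcons l oneE))) z).
have mF : mulin F.
  apply: onlast_mulin => [z l1 l2|l]; last exact: (bim_rr bV).
  apply: (linear_comp (bim_r bV z)); apply: (linear_comp lu).
  apply: (linear_eq _ (@Bt_mulin n l1 (rcons l2 oneE))) => m.
  by rewrite rcons_cat rcons_cons.
have [|||lv vE] := @B_linext k A H n V F
    (fun xs => rV (u (B_el n (rcons (take n.+1 xs) oneE))) xs`_n.+1).
- split=> [l|x|x]; first exact: (mF [::] l).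
    exact: mulin_cons mF.
  move=> l1; case/lastP=> // l2 z _.
  rewrite -rcons_cons -rcons_cat -rcons_cons /F onlast_rcons.
  rewrite rcons_cons rcons_cat rcons_cons Bt_normd ?size_rcons //.
  by rewrite (lin0 lu) (lin0 (bim_r bV _)).
- case/lastP=> // es z; rewrite size_rcons => sz; rewrite /F onlast_rcons.
  by rewrite Bt_size ?size_rcons // (lin0 lu) (lin0 (bim_r bV _)).
- case; case/lastP=> // es z sz /=; rewrite /F onlast_rcons.
  have sze : size es = n.+1 by move: (sz); rewrite size_rcons => /eqP[].
  rewrite -sze nth_rcons ltnn eqxx -[rcons es z]cats1 take_size_cat //.
  by rewrite Bt_el // size_rcons sze.
rewrite -/v in lv vE; have vE' x l z : v (Bt n (x :: rcons l z)) = rV (u (Bt n (x ::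
  rcons l oneE))) z.
  by rewrite vE -rcons_cons /F onlast_rcons.
split=> //; last by move=> x l; rewrite vE' (bim_r1 bV).
  move=> e; apply: B_ext2 => [||x l z _].
  - exact: (linear_comp lv (@B_lact_linear n e)).
  - exact: (linear_comp (bim_l bV e) lv).
  by rewrite B_lactE !vE' -(bim_lr bV) -ul B_lactE.
move=> x e; move: x; apply: B_ext2 => [||x l z _].
- exact: (linear_comp lv (@B_ract_linear n e)).
- exact: (linear_comp (bim_r bV e) lv).
by rewrite -rcons_cons B_ractE rcons_cons !vE' (bim_rA bV).
Qed.
End RightExtension.

(* X_(0,0) and B_0 are convertible. *)
Lemma Xt_Bt0 x z : Xt 0 0 x [::] [::] z = Bt 0 [:: x; z] :> B A H 0.
Proof. by []. Qed.

Lemma X_ext0 W (u v : B A H 0 -> W) : linear u -> linear v ->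
  (forall x z, u (Bt 0 [:: x; z]) = v (Bt 0 [:: x; z])) -> u =1 v.
Proof. by move=> lu lv uv; apply: B_ext2 => // x [] // z _; apply: uv. Qed.

Lemma X0_lact e (x : B A H 0) : @X_lact 0 0 e x = B_lact e x.
Proof.
move: x; apply: X_ext0 => [||x z].
- exact: (@X_lact_linear 0 0 e).
- exact: B_lact_linear.
by rewrite -Xt_Bt0 X_lactE !Xt_Bt0 B_lactE.
Qed.
Lemma X0_ract (x : B A H 0) e : @X_ract 0 0 x e = B_ract x e.
Proof.
move: x; apply: X_ext0 => [||x z].
- exact: (@X_ract_linear 0 0 e).
- exact: B_ract_linear.
by rewrite -Xt_Bt0 X_ractE !Xt_Bt0 (@B_ractE 0 e [:: x] z).
Qed.
Lemma X0_aug (x : B A H 0) : sigma0Y 0 0 (Y0_aug (mu (x : X A H 0 0))) = B0_aug x.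
Proof.
move: x; apply: X_ext0 => [||x z].
- apply: (linear_comp (@sigma0Y_linear 0)); exact: (linear_comp Y0_aug_linear
  (@mu_linear 0)).
- exact: B0_aug_linear.
by rewrite B0_augE -Xt_Bt0 sigma0Y_aug.
Qed.

Lemma dX_bim n : lmap (@Xn_lact n.+1) (@Xn_lact n) (@dX n).
Proof.
split; first exact: dX_linear.
by move=> e x; rewrite !dX_emX emX_lact opD_lact prX_lact.
Qed.

Lemma bimodule_mapP V W lV rV lW rW (u : V -> W) : bimodule_map lV rV lW rW u ->
  lmap lV lW u.
Proof. by case=> l1 l2 _; split. Qed.

Lemma phi_step n (s : 'I_n.+2) :
    bimodule_map (@Xn_lact n) (@Xn_ract n) (@B_lact n) (@B_ract n) (@phi n) ->
  lmap (@X_lact (n.+1 - s) s) (@B_lact n.+1) (fun x => xi (phi (dsummand x))).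
Proof.
move=> IH; apply: (@lmap_comp _ _ _ _ (@B_lact n) _ (fun x => phi (dsummand x)) (@xi
  n)).
  apply: (@lmap_comp _ _ _ _ (@Xn_lact n) _ (@dsummand n s) (@phi n)).
    split=> [c x y|e x]; rewrite !dsummandE.
      by rewrite (@inX_linear n.+1 s c x y) (@dX_linear n).
    by rewrite inX_lact (lmap_lact (dX_bim n)).
  exact: bimodule_mapP IH.
by split; [apply: xi_linear|apply: xi_lact].
Qed.

Lemma phi_bimodule_map n :
  bimodule_map (@Xn_lact n) (@Xn_ract n) (@B_lact n) (@B_ract n) (@phi n).
Proof.
elim: n => [|n IH].
  split=> [c x y|e x|e x] /=; first by rewrite XnD XnZ.
    by rewrite ffunE -X0_lact.
  by rewrite ffunE -X0_ract.
split=> [c x y|e x|e x] /=.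
- rewrite scaler_sumr -big_split; apply: eq_bigr => s _; rewrite XnD XnZ.
  by have [l1 _ _ _] := X_rext (B_bimodule n.+1) (phi_step s IH); apply: l1.
- rewrite (lin_sum (@B_lact_linear n.+1 e)); apply: eq_bigr => s _; rewrite ffunE.
  by have [_ l1 _ _] := X_rext (B_bimodule n.+1) (phi_step s IH); apply: l1.
rewrite (lin_sum (@B_ract_linear n.+1 e)); apply: eq_bigr => s _; rewrite ffunE.
by have [_ _ l1 _] := X_rext (B_bimodule n.+1) (phi_step s IH); apply: l1.
Qed.

Lemma phi_linear n : linear (@phi n). Proof. by case: (phi_bimodule_map n). Qed.
Lemma phi_lact n e x : @phi n (Xn_lact e x) = B_lact e (phi x).
Proof. by case: (phi_bimodule_map n). Qed.
Lemma phi_ract n x e : @phi n (Xn_ract x e) = B_ract (phi x) e.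
Proof. by case: (phi_bimodule_map n). Qed.

Lemma phi_unit n (s : 'I_n.+2) e hs as_ (y := @inX n.+1 s (Xt (n.+1 - s) s e hs as_
  oneE)) :
  phi y = xi (phi (dX y)).
Proof.
have lin (s' : 'I_n.+2) : linear (linext (@X_of k A H (n.+1 - s') s') (fun g =>
    B_ract (xi (phi (@Defs.dsummand k A H hH act f n s' (X_tens (n.+1 - s') s' (cr (xa0
      g) (xhs g)`_0)
      (behead (xhs g)) (xas g) oneE)))) (cr (xas g)`_(n.+1 - s') (xh g)))).
  by have [] := X_rext (B_bimodule n.+1) (phi_step s' (phi_bimodule_map n)).
rewrite /= (bigD1 s) //= big1 => [|s' ne]; last by rewrite inX_neq // (lin0 (lin s')).
rewrite addr0 inX_same -/y.
have [_ _ _ ->] := X_rext (B_bimodule n.+1) (phi_step s (phi_bimodule_map n)).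
by rewrite dsummandE.
Qed.

Lemma Xn_ext_unit n V rV (u v : Xn n -> V) :
    linear u -> linear v ->
    (forall x e, u (Xn_ract x e) = rV (u x) e) ->
    (forall x e, v (Xn_ract x e) = rV (v x) e) ->
    (forall (s : 'I_n.+1) e hs as_ (y := @inX n s (Xt (n - s) s e hs as_ oneE)), u y =
      v y) ->
  u =1 v.
Proof.
move=> lu lv ru rv uv; apply: Xn_ext => // s e hs as_ z.
have -> : Xt (n - s) s e hs as_ z = X_ract (Xt (n - s) s e hs as_ oneE) z.
  by rewrite X_ractE mul1E.
by rewrite inX_ract ru rv uv.
Qed.

Lemma B_ext_unit n V rV (u v : B A H n -> V) :
    linear u -> linear v ->
    (forall x e, u (B_ract x e) = rV (u x) e) ->
    (forall x e, v (B_ract x e) = rV (v x) e) ->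
    (forall x l, size l = n -> u (Bt n (x :: rcons l oneE)) = v (Bt n (x :: rcons l
      oneE))) ->
  u =1 v.
Proof.
move=> lu lv ru rv uv; apply: B_ext2 => // x l z sz.
by rewrite B_ract_unit ru rv uv.
Qed.

Lemma B0_aug_dX (x : Xn 1) : B0_aug (dX x ord0) = 0.
Proof.
rewrite -X0_aug dX_emX prXE.
by rewrite (mu_opD (emX x) 0) (linN Y0_aug_linear) Y0_aug_bd oppr0 (lin0
  (@sigma0Y_linear 0)).
Qed.

(** On elements ending in 1, b' xi phi d = phi d - xi b' phi d = phi d - xi phi d d = phi d. In
    degree 1, b' xi is 1 minus the augmentation, which kills the image of d. *)
Lemma b'_phi n (x : Xn n.+1) : b' (phi x) = phi (dX x).
Proof.
elim: n x => [|n IH].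
  apply: (Xn_ext_unit (rV := @B_ract 0)) => [||x e|x e|s e hs as_ y].
  - exact: (linear_comp (@b'_linear 0) (@phi_linear 1)).
  - exact: (linear_comp (@phi_linear 0) (@dX_linear 0)).
  - by rewrite phi_ract b'_ract.
  - by rewrite dX_ract phi_ract.
  rewrite phi_unit -/y; apply/eqP; rewrite eq_sym -subr_eq0.
  by rewrite -/(B0_aug _) B0_aug_dX.
apply: (Xn_ext_unit (rV := @B_ract n.+1)) => [||x e|x e|s e hs as_ y].
- exact: (linear_comp (@b'_linear _) (@phi_linear _)).
- exact: (linear_comp (@phi_linear _) (@dX_linear _)).
- by rewrite phi_ract b'_ract.
- by rewrite dX_ract phi_ract.
rewrite phi_unit -/y; have /(canRL (addrK _)) -> := b'_xi (phi (dX y)).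
by rewrite IH dX_dX (lin0 (@phi_linear n)) (lin0 (@xi_linear n)) subr0.
Qed.

Lemma psi0E (y : B A H 0) (x : Xn 0) : y = x ord0 -> psi y = x.
Proof.
move=> ->; apply: XnP => s; rewrite ffunE.
by move: (esym (ord1 s)) => e; case: _ / e.
Qed.

Lemma psi0_ord0 (y : B A H 0) : psi y ord0 = y.
Proof.
by rewrite (@psi0E y (@inX 0 ord0 y)) (@inX_same 0 ord0).
Qed.

Lemma psi_step n :
    bimodule_map (@B_lact n) (@B_ract n) (@Xn_lact n) (@Xn_ract n) (@psi n) ->
  lmap (@B_lact n.+1) (@Xn_lact n.+1) (fun x => sigmabar (psi (b' x))).
Proof.
move=> IH; apply: (@lmap_comp _ _ _ _ (@Xn_lact n) _ (fun x => psi (b' x)) (@sigmabar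
  n)).
  apply: (@lmap_comp _ _ _ _ (@B_lact n) _ (@b' n) (@psi n)); last exact: bimodule_mapP
    IH.
  by split; [apply: b'_linear|apply: b'_lact].
by split; [apply: sigmabar_linear|apply: sigmabar_lact].
Qed.

Lemma psi_bimodule_map n :
  bimodule_map (@B_lact n) (@B_ract n) (@Xn_lact n) (@Xn_ract n) (@psi n).
Proof.
elim: n => [|n IH].
  split=> [c x y|e x|x e].
  - by apply: psi0E; rewrite XnD XnZ !psi0_ord0.
  - by apply: psi0E; rewrite ffunE psi0_ord0 X0_lact.
  by apply: psi0E; rewrite ffunE psi0_ord0 X0_ract.
have [l1 l2 l3 _] := B_rext (Xn_bimodule n.+1) (psi_step IH).
by split; [exact: l1 | exact: l2 | move=> e x; apply: l3].
Qed.

Lemma psi_linear n : linear (@psi n). Proof. by case: (psi_bimodule_map n). Qed.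
Lemma psi_lact n e x : @psi n (B_lact e x) = Xn_lact e (psi x).
Proof. by case: (psi_bimodule_map n). Qed.
Lemma psi_ract n x e : @psi n (B_ract x e) = Xn_ract (psi x) e.
Proof. by case: (psi_bimodule_map n). Qed.

Lemma psi_unit n x l (y := Bt n.+1 (x :: rcons l oneE)) : psi y = sigmabar (psi (b' y)).
Proof. by have [_ _ _] := B_rext (Xn_bimodule n.+1) (psi_step (psi_bimodule_map n));
  apply. Qed.

(** The image of xi consists of elements ending in 1, so the recursion of psi applies to it without
    any extension. *)
Lemma psi_xi n (x : B A H n) : psi (xi x) = sigmabar (psi (b' (xi x))).
Proof.
move: x; apply: B_ext2 => [||x l z _].
- exact: (linear_comp (@psi_linear _) (@xi_linear n)).
- apply: (linear_comp (@sigmabar_linear n)); apply: (linear_comp (@psi_linear n)).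
  exact: (linear_comp (@b'_linear n) (@xi_linear n)).
rewrite xi_Bt rcons_cons !(linZ (@psi_linear _), linZ (@b'_linear _), linZ
  (@sigmabar_linear _)).
by rewrite psi_unit.
Qed.

Lemma dX_psi n (y : B A H n.+1) : dX (psi y) = psi (b' y).
Proof.
elim: n y => [|n IH].
  apply: (B_ext_unit (rV := @Xn_ract 0)) => [||x e|x e|x l sz].
  - exact: (linear_comp (@dX_linear 0) (@psi_linear 1)).
  - exact: (linear_comp (@psi_linear 0) (@b'_linear 0)).
  - by rewrite psi_ract dX_ract.
  - by rewrite b'_ract psi_ract.
  rewrite psi_unit; apply/esym/psi0E; rewrite dX_sigmabar0 psi0_ord0 X0_aug.
  by rewrite B0_aug_b' subr0.
apply: (B_ext_unit (rV := @Xn_ract n.+1)) => [||x e|x e|x l sz].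
- exact: (linear_comp (@dX_linear _) (@psi_linear _)).
- exact: (linear_comp (@psi_linear _) (@b'_linear _)).
- by rewrite psi_ract dX_ract.
- by rewrite b'_ract psi_ract.
rewrite psi_unit; have /(canRL (addrK _)) -> := dX_sigmabar (psi (b' (Bt n.+2 (x ::
  rcons l oneE)))).
by rewrite IH b'_b' (lin0 (@psi_linear n)) (lin0 (@sigmabar_linear n)) subr0.
Qed.

Lemma sigma0_dirac_unit r s e hs as_ q i :
  sigma0 q.+1 i (@dirac r.+1 s (Xt r s e hs as_ oneE) q.+1 i : X A H q i) = 0.
Proof.
have [[E1 E2]|ne] := eqVneq (r.+1, s) (q.+1, i).
  by subst q i; rewrite dirac_same sigma0_unit.
by rewrite dirac_neq // (lin0 (@sigma0_linear q i)).
Qed.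

(** sigma^(-1) mu would produce a unit in a normalized place, and every sigma^l begins with sigma^0,
    which sends the final 1 to a zero class in Abar. *)
Lemma sigmabar_unit n (s : 'I_n.+1) e hs as_ :
  sigmabar (@inX n s (Xt (n - s) s e hs as_ oneE)) = 0.
Proof.
set x := Xt _ _ _ _ _ _; rewrite sigmabar_prX.
have -> : opV (@dirac (n - s).+1 s x) = 0.
  apply: XYP => -[|r] [|s'] //=; rewrite XYprod0.
  have [[E1 E2]|ne] := eqVneq ((n - s).+1, nat_of_ord s) (1%N, s'); last first.
    by rewrite dirac_neq // (lin0 (@mu_linear s')) (lin0 (@sigmam1_linear s')).
  (* Generalizing n - s to a variable allows it to be replaced by 0 in the type of the element. *)
  suff G r : r = 0%N ->
      sigmam1 (mu (@dirac r.+1 s (Xt r s e hs as_ oneE) 1%N s : X A H 0 s)) = 0.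
    by rewrite -E2; apply: (G _ E1).
  move=> ->; rewrite dirac_same; case: as_ {x E1} => [|a as_]; first exact:
    sigmam1_mu_unit.
  by rewrite Xt_size ?andbF // (lin0 (@mu_linear s)) (lin0 (@sigmam1_linear s)).
rewrite subr0; apply: XnP => s'; rewrite prXE Xn0; apply: big1 => s1 le_s1.
have lt_s1 := ltn_ord s1; apply: sg_eq0; [|lia|lia].
case: (n.+1 - s' + s' - s1)%N => [|q]; first exact: lin0 (@sigma0Y_linear s1).

exact: sigma0_dirac_unit.
Qed.

Lemma psi_phi n (x : Xn n) : psi (phi x) = x.
Proof.
elim: n x => [|n IH]; first by move=> x; apply: psi0E.
apply: (Xn_ext_unit (rV := @Xn_ract n.+1)) => [||x e|x e|s e hs as_ y].
- exact: (linear_comp (@psi_linear _) (@phi_linear _)).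
- exact: linear_id.
- by rewrite phi_ract psi_ract.
- by [].
(* phi y lies in the image of xi, so psi phi y = sigmabar psi b' phi y = sigmabar d y. *)
have Ey : xi (phi (dX y)) = phi y by rewrite phi_unit.
rewrite -Ey psi_xi Ey b'_phi IH; have /(canRL (addKr _)) -> := dX_sigmabar y.
by rewrite sigmabar_unit (lin0 (@dX_linear _)) oppr0 add0r.
Qed.

Lemma omega_step n :
    bimodule_map (@B_lact n) (@B_ract n) (@B_lact n.+1) (@B_ract n.+1) (@omega n) ->
  lmap (@B_lact n.+1) (@B_lact n.+2) (fun x => xi (phi (psi x) - x - omega (b' x))).
Proof.
move=> [o1 o2 _].
apply: (@lmap_comp _ _ _ _ (@B_lact n.+1) _ (fun x => phi (psi x) - x - omega (b' x))
  (@xi _)).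
  split=> [|e x].
    apply: linear_sub; first apply: linear_sub.
    - exact: (linear_comp (@phi_linear _) (@psi_linear _)).
    - exact: linear_id.
    exact: (linear_comp o1 (@b'_linear n)).
  by rewrite psi_lact phi_lact b'_lact o2 -!(linB (@B_lact_linear _ e)).
by split; [apply: xi_linear|apply: xi_lact].
Qed.

Lemma omega_bimodule_map n :
  bimodule_map (@B_lact n) (@B_ract n) (@B_lact n.+1) (@B_ract n.+1) (@omega n).
Proof.
elim: n => [|n IH].
  split=> [|e x|e x] /=; first exact: linear_zero.
    by rewrite (lin0 (@B_lact_linear _ e)).
  by rewrite (lin0 (@B_ract_linear _ e)).
have [l1 l2 l3 _] := B_rext (B_bimodule n.+2) (omega_step IH).
by split; [exact: l1 | exact: l2 | move=> e x; apply: l3].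
Qed.

Lemma omega_linear n : linear (@omega n). Proof. by case: (omega_bimodule_map n). Qed.
Lemma omega_ract n x e : @omega n (B_ract x e) = B_ract (omega x) e.
Proof. by case: (omega_bimodule_map n). Qed.

Lemma omega_unit n x l (y := Bt n.+1 (x :: rcons l oneE)) :
  omega y = xi (phi (psi y) - y - omega (b' y)).
Proof.
by have [_ _ _] := B_rext (B_bimodule n.+2) (omega_step (omega_bimodule_map n)); apply.
Qed.

Lemma phi_psi0 (x : B A H 0) : phi (psi x) = x.
Proof. exact: psi0_ord0. Qed.

Lemma b'_phi_psi n (x : B A H n.+1) : b' (phi (psi x)) = phi (psi (b' x)).
Proof. by rewrite b'_phi dX_psi. Qed.

Lemma omega_homotopy n (x : B A H n.+1) :
  b' (omega x) + omega (b' x) = phi (psi x) - x.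
Proof.
move: x; have lom m : linear (fun x : B A H m.+1 => b' (omega x) + omega (b' x)).
  apply: linear_add; first exact: (linear_comp (@b'_linear _) (@omega_linear _)).
  exact: (linear_comp (@omega_linear _) (@b'_linear _)).
have lpp m : linear (fun x : B A H m.+1 => phi (psi x) - x).
  apply: linear_sub; last exact: linear_id.
  exact: (linear_comp (@phi_linear _) (@psi_linear _)).
have rom m (x : B A H m.+1) e :
    b' (omega (B_ract x e)) + omega (b' (B_ract x e)) = B_ract (b' (omega x) + omega
      (b' x)) e.
  by rewrite b'_ract !omega_ract b'_ract [RHS](linD (@B_ract_linear _ e)).
have rpp m (x : B A H m.+1) e :
    phi (psi (B_ract x e)) - B_ract x e = B_ract (phi (psi x) - x) e.
  by rewrite psi_ract phi_ract [RHS](linB (@B_ract_linear _ e)).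
elim: n => [|n IH].
  apply: (B_ext_unit (lom 0%N) (lpp 0%N) (rom 0%N) (rpp 0%N)) => x l sz.
  rewrite omega_unit /= !subr0 addr0; set y := Bt _ _.
  have /(canRL (addrK _)) -> := b'_xi (phi (psi y) - y).
  rewrite (linB (@b'_linear _)) b'_phi_psi phi_psi0 subrr (lin0 (@xi_linear _)).
  by rewrite subr0.
apply: (B_ext_unit (lom n.+1) (lpp n.+1) (rom n.+1) (rpp n.+1)) => x l sz.
rewrite omega_unit; set y := Bt _ _; set v := _ - omega (b' y).
have /(canRL (addrK _)) -> := b'_xi v.
(* The induction hypothesis at b' y replaces phi psi b' y - b' y by b' omega b' y + omega b' b' y,
   and b' b' = 0. *)
have -> : b' v = 0.
  rewrite /v !(linB (@b'_linear _)) b'_phi_psi -IH b'_b' (lin0 (@omega_linear _)).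
  by rewrite addr0 subrr.
by rewrite (lin0 (@xi_linear _)) subr0 /v subrK.
Qed.

Lemma omega_homotopy0 (x : B A H 0) : b' (omega x) = phi (psi x) - x.
Proof. by rewrite phi_psi0 subrr /= (lin0 (@b'_linear 0)). Qed.

End CrossedProductAlgebra.

Theorem proposition1p2p1 (k : comNzRingType) (A H : algType k) (hH : hopf H)
    (act : H -> A -> A) (f : {linear tensor H H -> A})
    (act_weak : weak_action hH act) (E_crossed : crossed_product hH act f) :
  let phi := @phi k A H hH act f in
  let psi := @psi k A H hH act f in
  let dX := @dX k A H hH act f in
  let b' := @b' k A H hH act f in
  let omega := @omega k A H hH act f in
  [/\ (* phi is a morphism of complexes of E-bimodules *)
      (forall n, bimodule_map (@Xn_lact k A H hH act f n)
                   (@Xn_ract k A H hH act f n) (@B_lact k A H hH act f n)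
                   (@B_ract k A H hH act f n) (phi n))
      /\ (forall n (x : Xn A H n.+1), b' n (phi n.+1 x) = phi n (dX n x)),
      (* psi is a morphism of complexes of E-bimodules *)
      (forall n, bimodule_map (@B_lact k A H hH act f n)
                   (@B_ract k A H hH act f n) (@Xn_lact k A H hH act f n)
                   (@Xn_ract k A H hH act f n) (psi n))
      /\ (forall n (y : B A H n.+1), dX n (psi n.+1 y) = psi n (b' n y)),
      forall n (x : Xn A H n), psi n (phi n x) = x
    & homotopy hH act f (fun n y => phi n (psi n y)) (fun n y => y) omega].
Proof.
move=> phi psi dX b' omega; split.
- split=> [n|n x]; first exact: phi_bimodule_map.
  exact: b'_phi.
- split=> [n|n y]; first exact: psi_bimodule_map.
  exact: dX_psi.
- by move=> n x; apply: psi_phi.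
split=> [n|x|n x]; first exact: omega_bimodule_map.
  exact: omega_homotopy0.
exact: omega_homotopy.
Qed.
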